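(* For each integer $r\geq 1$, there exists a positive integer $n(r)$ such that for all integers $n\geq n(r)$, $$(-1)^{r-1}\Delta^{r}\log p(n)>0.$$
   Context: $p(n)$ denotes the partition function, i.e. the number of partitions of the positive integer $n$ (nonincreasing sequences of positive integers with sum $n$), with $p(0)=1$. $\Delta$ is the difference operator with respect to $n$, $\Delta f(n)=f(n+1)-f(n)$, and $\Delta^{r}$ is its $r$-fold iterate, so $\Delta^{r}\log p(n)=\sum_{k=0}^{r}(-1)^{r-k}\binom{r}{k}\log p(n+k)$. *)

(* Defs.v *)
From mathcomp Require Import all_boot.

Set Implicit Arguments.
Unset Strict Implicit.
Unset Printing Implicit Defensive.

Definition is_integer_partition (n : nat) (s : seq nat) : bool :=
  [&& sorted geq s, all (fun k => 0 < k) s & sumn s == n].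

(* A partition of n has at most n parts, all of them at most n, so the bounded
   sequences below miss none of them: see partition_numberP. *)
Definition partition_number (n : nat) : nat :=
  #|[set t : {bseq n of 'I_n.+1} |
      is_integer_partition n [seq val i | i <- t]]|.

Lemma partition_numberP (n : nat) :
  exists l : seq (seq nat),
    [/\ uniq l, l =i is_integer_partition n & size l = partition_number n].
Proof.
pose A := [set t : {bseq n of 'I_n.+1} |
            is_integer_partition n [seq val i | i <- t]].
pose f (t : {bseq n of 'I_n.+1}) := [seq val i | i <- t].
exists [seq f t | t <- enum A]; split.
- rewrite map_inj_uniq ?enum_uniq// => t u /(inj_map val_inj).
  exact: val_inj.
- move=> s; apply/mapP/idP => [[t]|]; first by rewrite mem_enum inE => At ->.
  move=> sP; move: (sP) => /and3P[_ s_gt0 /eqP sn].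
  have size_s : size s <= n.
    rewrite -sn; elim: s s_gt0 {sP sn} => //= x s IHs /andP[x0 s0].
    by rewrite -add1n leq_add// IHs.
  have s_le x : x \in s -> x < n.+1.
    rewrite ltnS -sn; elim: s {sP s_gt0 sn size_s} => //= y s IHs.
    rewrite inE => /predU1P[->|/IHs xs]; first exact: leq_addr.
    exact: leq_trans xs (leq_addl _ _).
  have fs : [seq val i | i <- [seq (inord x : 'I_n.+1) | x <- s]] = s.
    by rewrite -map_comp -[RHS]map_id; apply/eq_in_map => x /s_le; exact: inordK.
  have size_t : size [seq (inord x : 'I_n.+1) | x <- s] <= n.
    by rewrite size_map.
  exists (Bseq size_t) => //.
  by rewrite mem_enum inE /= fs.
- by rewrite size_map -cardE.
Qed.

(* Main.v *)
(* Circle method with a single major arc.  By the pentagonal number theorem and Poisson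
   summation, P(q) = sum p(n) q^n satisfies, at q = e^{-z} in a sector |arg z| < pi/2,
     P(q) = C z^{1/2} exp(pi^2/(6 z) - z/24) (1 + exponentially small).
   Cauchy's formula is used on the arc |z| = t, t = pi / sqrt(6 (n - 1/24)), up to an angle of
   cosine 4/5, continued by a vertical segment on which P is exponentially smaller.  On the arc
   the exponent 2 lambda cos th is real, lambda = (n - 1/24) t, and u = sin (th/2) makes the
   integral Gaussian, so that, up to a relative error smaller than any power of n,
     log p(n) = c + 2 lambda - 2 log lambda + log (1 - 1/(2 lambda)).
   The r-th difference of the first term 2 lambda ~ sqrt n has sign (-1)^(r-1) and order
   n^(1/2 - r); all the others contribute O(n^(-r)).  Of C and of the Gaussian integral only the
   positivity matters. *)

From Stdlib Require Import Reals Lra Lia Arith.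
From Coquelicot Require Import Coquelicot.

Local Notation RC := R_CompleteNormedModule.
Local Notation RN := R_NormedModule.

(** * Contour shift for the Gaussian integral *)

Local Open Scope R_scope.

(** An error known only by its size has an r-th difference bounded only by 2^r times that size. So
    the error in log p(n) has to be O(n^(-r)) for the given r, and every larger term has to be an
    explicit power or logarithm of n - 1/24, whose differences are controlled by derivatives. An
    asymptotic equivalent of p(n) is therefore not enough, and the integral over the arc is
    evaluated in closed form up to a Gaussian tail instead of by Laplace's method. The arc is
    circular in z because with (n - 1/24) t = pi^2/(6 t) = lambda the imaginary parts of (n - 1/24)
    z and pi^2/(6 z) cancel on |z| = t. The complex analysis is carried out with real integrals.
    Shifting a line of integration is differentiation under an integral with respect to a homotopy
    parameter; Cauchy's formula is applied to polynomials, with explicit primitives; a complex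
    identity is obtained from the real parts of its multiples by c, |c| <= 1. *)

Ltac continuity_2d :=
  lazymatch goal with
  | |- continuity_2d_pt (fun u v => @?f u v + @?g u v) _ _ =>
      apply (continuity_2d_pt_plus f g); continuity_2d
  | |- continuity_2d_pt (fun u v => @?f u v - @?g u v) _ _ =>
      apply (continuity_2d_pt_minus f g); continuity_2d
  | |- continuity_2d_pt (fun u v => @?f u v * @?g u v) _ _ =>
      apply (continuity_2d_pt_mult f g); continuity_2d
  | |- continuity_2d_pt (fun u v => - @?f u v) _ _ =>
      apply (continuity_2d_pt_opp f); continuity_2d
  | |- continuity_2d_pt (fun u v => exp (@?f u v)) _ _ =>
      apply (continuity_1d_2d_pt_comp exp f);
      [apply derivable_continuous_pt, derivable_pt_exp | continuity_2d]
  | |- continuity_2d_pt (fun u v => cos (@?f u v)) _ _ =>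
      apply (continuity_1d_2d_pt_comp cos f);
      [apply continuity_cos | continuity_2d]
  | |- continuity_2d_pt (fun u v => sin (@?f u v)) _ _ =>
      apply (continuity_1d_2d_pt_comp sin f);
      [apply continuity_sin | continuity_2d]
  | |- continuity_2d_pt (fun u v => u) _ _ => apply continuity_2d_pt_id1
  | |- continuity_2d_pt (fun u v => v) _ _ => apply continuity_2d_pt_id2
  | |- _ => apply continuity_2d_pt_const
  end.

(* Real part of c m e^{-(p + iq)^2} for complex c, m. *)
Definition gauss_field (c1 c2 m1 m2 p q : R) : R :=
  exp (q * q - p * p) * ((c1 * m1 - c2 * m2) * cos (2 * p * q)
    + (c1 * m2 + c2 * m1) * sin (2 * p * q)).

(** Integrands along the homotopy from the real axis, s = 0, to the line x (1 + u) + e, s = 1. The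
    factor m of [gauss_field] is the x-derivative of the moving point here and its s-derivative in
    [homotopy_flux]. *)
Definition homotopy_flow (c1 c2 u1 u2 e1 e2 s x : R) : R :=
  gauss_field c1 c2 (1 + s * u1) (s * u2)
    (x * (1 + s * u1) + s * e1) (x * (s * u2) + s * e2).
Definition homotopy_flux (c1 c2 u1 u2 e1 e2 s x : R) : R :=
  gauss_field c1 c2 (x * u1 + e1) (x * u2 + e2)
    (x * (1 + s * u1) + s * e1) (x * (s * u2) + s * e2).

(* With xi = x (1 + s u) + s e one has d_s (xi_x e^{-xi^2}) = d_x (xi_s e^{-xi^2}). *)
Lemma homotopy_conservation (c1 c2 u1 u2 e1 e2 : R) :
  exists D : R -> R -> R,
  (forall s x, is_derive (fun s => homotopy_flow c1 c2 u1 u2 e1 e2 s x) s (D s x)) /\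
  (forall s x, is_derive (homotopy_flux c1 c2 u1 u2 e1 e2 s) x (D s x)) /\
  (forall s x, continuity_2d_pt D s x).
Proof.
eexists (fun s x => _); split; [|split]; intros s x.
- unfold homotopy_flow, gauss_field; auto_derive; [exact I | reflexivity].
- unfold homotopy_flux, gauss_field; auto_derive; [exact I | ring].
- cbv beta; continuity_2d.
Qed.

Lemma homotopy_flow_continuous (c1 c2 u1 u2 e1 e2 s x : R) :
  continuous (homotopy_flow c1 c2 u1 u2 e1 e2 s) x.
Proof.
apply (ex_derive_continuous (V := RN)).
unfold homotopy_flow, gauss_field; auto_derive; exact I.
Qed.

(** Under the integral sign the conservation law becomes a boundary term: moving the line costs only
    what flows through its two ends. *)
Lemma homotopy_flow_int_derive (c1 c2 u1 u2 e1 e2 a b s : R) :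
  is_derive (fun s => RInt (homotopy_flow c1 c2 u1 u2 e1 e2 s) a b) s
    (homotopy_flux c1 c2 u1 u2 e1 e2 s b - homotopy_flux c1 c2 u1 u2 e1 e2 s a).
Proof.
destruct (homotopy_conservation c1 c2 u1 u2 e1 e2) as (D & Ds & Dx & Dc).
replace (homotopy_flux c1 c2 u1 u2 e1 e2 s b - homotopy_flux c1 c2 u1 u2 e1 e2 s a)
  with (RInt (fun x => Derive (fun s => homotopy_flow c1 c2 u1 u2 e1 e2 s x) s) a b).
- apply is_derive_RInt_param with (f := homotopy_flow c1 c2 u1 u2 e1 e2).
  + apply filter_forall; intros s' x _; eexists; apply Ds.
  + intros x _; apply continuity_2d_pt_ext with D; [|apply Dc].
    intros s' x'; symmetry; apply is_derive_unique, Ds.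
  + apply filter_forall; intros s'; apply (ex_RInt_continuous (V := RC)).
    intros x _; apply homotopy_flow_continuous.
- rewrite (RInt_ext _ (D s)).
  + apply is_RInt_unique, (is_RInt_derive (V := RC)); intros x _.
    * apply Dx.
    * apply continuity_pt_filterlim; intros eps Heps.
      destruct (Dc s x (mkposreal eps Heps)) as [d Hd].
      exists d; split; [apply cond_pos|]; intros y [_ Hy].
      apply Hd; [rewrite Rminus_diag, Rabs_R0; apply cond_pos | exact Hy].
  + intros x _; apply is_derive_unique, Ds.
Qed.

Lemma gauss_field_bound (c1 c2 m1 m2 p q K : R) :
  Rabs c1 <= 1 -> Rabs c2 <= 1 -> Rabs m1 <= K -> Rabs m2 <= K ->
  Rabs (gauss_field c1 c2 m1 m2 p q) <= 4 * K * exp (q * q - p * p).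
Proof.
intros H1 H2 H3 H4; unfold gauss_field.
rewrite Rabs_mult, (Rabs_pos_eq (exp _)), Rmult_comm by (left; apply exp_pos).
apply Rmult_le_compat_r; [left; apply exp_pos|].
assert (P : forall c m, Rabs c <= 1 -> Rabs m <= K -> Rabs (c * m) <= K).
{ intros c m Hc Hm; rewrite Rabs_mult.
  pose proof (Rabs_pos c); pose proof (Rabs_pos m); nra. }
assert (Q : forall a b, Rabs a <= 2 * K -> Rabs b <= 1 -> Rabs (a * b) <= 2 * K).
{ intros a b Ha Hb; rewrite Rabs_mult.
  pose proof (Rabs_pos a); pose proof (Rabs_pos b); nra. }
assert (Hc : Rabs (cos (2 * p * q)) <= 1) by (apply Rabs_le, COS_bound).
assert (Hs : Rabs (sin (2 * p * q)) <= 1) by (apply Rabs_le, SIN_bound).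
eapply Rle_trans; [apply Rabs_triang|].
assert (A : Rabs (c1 * m1 - c2 * m2) <= 2 * K).
{ unfold Rminus; eapply Rle_trans; [apply Rabs_triang|].
  rewrite Rabs_Ropp; pose proof (P c1 m1 H1 H3); pose proof (P c2 m2 H2 H4); lra. }
assert (B : Rabs (c1 * m2 + c2 * m1) <= 2 * K).
{ eapply Rle_trans; [apply Rabs_triang|].
  pose proof (P c1 m2 H1 H4); pose proof (P c2 m1 H2 H3); lra. }
pose proof (Q _ _ A Hc); pose proof (Q _ _ B Hs); lra.
Qed.

Lemma exp_le (x y : R) : x <= y -> exp x <= exp y.
Proof. intros [H | ->]; [left; apply exp_increasing, H | right; reflexivity]. Qed.

Lemma exp_neg_le_inv (y : R) : 0 < y -> exp (- y) <= / y.
Proof.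
intros Hy; rewrite exp_Ropp; apply Rinv_le_contravar; [exact Hy|].
pose proof (exp_ineq1_le y); lra.
Qed.

(** The modulus of e^{-xi^2} is e^{q^2 - p^2}, and p^2 - q^2 = (p + q)(p - q). The cone condition
    |u2| < 1 + u1 keeps both factors of size |x|, uniformly in s. The crude e^{-y} <= 1/y, with y of
    order x^2, absorbs the linear factor xi_s and leaves 1/|x|. *)
Lemma homotopy_flux_bound (c1 c2 u1 u2 e1 e2 : R) :
  Rabs c1 <= 1 -> Rabs c2 <= 1 -> Rabs u2 < 1 + u1 ->
  exists K X, 0 <= K /\ 1 <= X /\ forall s x, 0 <= s <= 1 -> X <= Rabs x ->
  Rabs (homotopy_flux c1 c2 u1 u2 e1 e2 s x) <= K / Rabs x.
Proof.
intros Hc1 Hc2 Hu.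
(* Both 1 + s u1 + s u2 and 1 + s u1 - s u2 interpolate between 1 and a number that is at least 1 +
   u1 - |u2|, so [c0] is a lower bound for every s in [0, 1]. *)
set (c0 := Rmin 1 (1 + u1 - Rabs u2)); set (E := Rabs e1 + Rabs e2).
set (U := Rabs u1 + Rabs u2).
assert (Hc0 : 0 < c0) by (apply Rmin_glb_lt; lra).
assert (HE : 0 <= E) by (unfold E; pose proof (Rabs_pos e1); pose proof (Rabs_pos e2); lra).
assert (HU : 0 <= U) by (unfold U; pose proof (Rabs_pos u1); pose proof (Rabs_pos u2); lra).
(* Beyond 2 E / c0 the offset s e takes away at most half of c0 |x|, which leaves c0 |x| / 2 for
   each factor. *)
exists (16 * (U + E) / (c0 * c0)), (1 + 2 * E / c0).
assert (0 <= 2 * E / c0) by (apply Rdiv_le_0_compat; lra).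
split; [apply Rdiv_le_0_compat; nra|]; split; [lra|].
intros s x Hs Hx.
assert (Hx1 : 1 <= Rabs x) by lra.
assert (Hcx : 2 * E <= c0 * Rabs x).
{ replace (2 * E) with (c0 * (2 * E / c0)) by (field; lra).
  apply Rmult_le_compat_l; lra. }
set (p := x * (1 + s * u1) + s * e1); set (q := x * (s * u2) + s * e2).
assert (Hpq : c0 * c0 * (Rabs x * Rabs x) / 4 <= p * p - q * q).
{ assert (M : forall d, - Rabs u2 <= d <= Rabs u2 -> c0 <= 1 + s * u1 + s * d).
  { intros d Hd. pose proof (Rmin_l 1 (1 + u1 - Rabs u2)).
    pose proof (Rmin_r 1 (1 + u1 - Rabs u2)). fold c0 in H0, H1. nra. }
  assert (D1 := M u2 ltac:(apply Rabs_le_between; lra)).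
  assert (D2 := M (- u2) ltac:(apply Rabs_le_between; rewrite Rabs_Ropp; lra)).
  assert (E1 : - E <= s * (e1 + e2) <= E /\ - E <= s * (e1 - e2) <= E).
  { unfold E; pose proof (Rle_abs e1); pose proof (Rle_abs e2).
    pose proof (Rle_abs (- e1)); pose proof (Rle_abs (- e2)).
    rewrite Rabs_Ropp in *; split; split; nra. }
  replace (p * p - q * q) with ((x * (1 + s * u1 + s * u2) + s * (e1 + e2))
    * (x * (1 + s * u1 + s * - u2) + s * (e1 - e2))) by (unfold p, q; ring).
  unfold Rabs in Hcx, Hx1 |- *; destruct (Rcase_abs x).
  - assert (c0 * - x / 2 <= - (x * (1 + s * u1 + s * u2) + s * (e1 + e2))) by nra.
    assert (c0 * - x / 2 <= - (x * (1 + s * u1 + s * - u2) + s * (e1 - e2))) by nra.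
    assert (0 <= c0 * - x / 2) by nra. nra.
  - assert (c0 * x / 2 <= (x * (1 + s * u1 + s * u2) + s * (e1 + e2))) by nra.
    assert (c0 * x / 2 <= (x * (1 + s * u1 + s * - u2) + s * (e1 - e2))) by nra.
    assert (0 <= c0 * x / 2) by nra. nra. }
assert (Hm : forall u e, Rabs u <= U -> Rabs e <= E -> Rabs (x * u + e) <= (U + E) * Rabs x).
{ intros u e Hu' He; eapply Rle_trans; [apply Rabs_triang|]; rewrite Rabs_mult.
  pose proof (Rabs_pos u); nra. }
assert (0 <= (U + E) * Rabs x) by nra.
eapply Rle_trans.
- apply (gauss_field_bound c1 c2 _ _ p q ((U + E) * Rabs x)); auto.
  + apply Hm; unfold U, E; pose proof (Rabs_pos u2); pose proof (Rabs_pos e2); lra.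
  + apply Hm; unfold U, E; pose proof (Rabs_pos u1); pose proof (Rabs_pos e1); lra.
- assert (Hy : 0 < c0 * c0 * (Rabs x * Rabs x) / 4).
  { apply Rdiv_lt_0_compat; [|lra]; repeat apply Rmult_lt_0_compat; lra. }
  apply Rle_trans with (4 * ((U + E) * Rabs x) * / (c0 * c0 * (Rabs x * Rabs x) / 4)).
  + apply Rmult_le_compat_l; [lra|].
    eapply Rle_trans; [|apply exp_neg_le_inv, Hy]; apply exp_le; lra.
  + right; field; lra.
Qed.

(** By the mean value theorem in s, the difference of the two integrals is a difference of fluxes at
    L and -L for one intermediate s. *)
Lemma gauss_line_shift (c1 c2 u1 u2 e1 e2 : R) :
  Rabs c1 <= 1 -> Rabs c2 <= 1 -> Rabs u2 < 1 + u1 ->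
  exists K X, 0 <= K /\ 1 <= X /\ forall L, X <= L ->
  Rabs (RInt (homotopy_flow c1 c2 u1 u2 e1 e2 1) (- L) L
        - RInt (homotopy_flow c1 c2 u1 u2 e1 e2 0) (- L) L) <= K / L.
Proof.
intros Hc1 Hc2 Hu.
destruct (homotopy_flux_bound c1 c2 u1 u2 e1 e2 Hc1 Hc2 Hu) as (K & X & HK & HX & H).
exists (2 * K), X; split; [lra|]; split; [exact HX|]; intros L HL.
destruct (MVT_gen (fun s => RInt (homotopy_flow c1 c2 u1 u2 e1 e2 s) (- L) L) 0 1
  (fun s => homotopy_flux c1 c2 u1 u2 e1 e2 s L - homotopy_flux c1 c2 u1 u2 e1 e2 s (- L)))
  as (s & Hs & ->).
- intros s _; exact (homotopy_flow_int_derive c1 c2 u1 u2 e1 e2 (- L) L s).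
- intros s _; apply (continuity_pt_filterlim (fun s => RInt (homotopy_flow c1 c2 u1 u2 e1 e2 s) (- L) L)).
  apply (ex_derive_continuous (V := RN)
    (fun s => RInt (homotopy_flow c1 c2 u1 u2 e1 e2 s) (- L) L)).
  eexists; exact (homotopy_flow_int_derive c1 c2 u1 u2 e1 e2 (- L) L s).
- rewrite Rmin_left, Rmax_right in Hs by lra.
  assert (H1 := H s L Hs ltac:(rewrite Rabs_pos_eq; lra)).
  assert (H2 := H s (- L) Hs ltac:(rewrite Rabs_Ropp, Rabs_pos_eq; lra)).
  rewrite Rabs_Ropp in H2; rewrite (Rabs_pos_eq L) in H1, H2 by lra.
  rewrite Rminus_0_r, Rmult_1_r; unfold Rminus.
  eapply Rle_trans; [apply Rabs_triang|]; rewrite Rabs_Ropp.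
  replace (2 * K / L) with (K / L + K / L) by (field; lra); lra.
Qed.

(** * The Gaussian integral over the half-line *)

Lemma continuous_gauss (x : R) : continuous (fun x => exp (- (x * x))) x.
Proof.
apply (ex_derive_continuous (V := RN)); auto_derive; exact I.
Qed.

Lemma ex_RInt_gauss (a b : R) : ex_RInt (fun x => exp (- (x * x))) a b.
Proof.
apply (ex_RInt_continuous (V := RC)); intros x _; apply continuous_gauss.
Qed.

(** For x >= 1 the integrand is at most e^{-x}. This tail of order e^{-L}, instead of e^{-L^2}, is
    the origin of the sqrt lam in the error term of [partition_asymptotic]. *)
Lemma gauss_tail (L M : R) : 1 <= L <= M ->
  0 <= RInt (fun x => exp (- (x * x))) L M <= exp (- L).
Proof.
intros HLM; split.
- apply RInt_ge_0; [lra | apply ex_RInt_gauss | intros; left; apply exp_pos].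
- assert (HI : is_RInt (fun x => exp (- x)) L M (- exp (- M) - - exp (- L))).
  { apply (is_RInt_derive (V := RC) (fun x => - exp (- x))); intros x _.
    - auto_derive; [exact I | ring].
    - apply (ex_derive_continuous (V := RN)); auto_derive; exact I. }
  apply Rle_trans with (RInt (fun x => exp (- x)) L M).
  + apply RInt_le; [lra | apply ex_RInt_gauss | eexists; exact HI |].
    intros x Hx; left; apply exp_increasing; nra.
  + rewrite (is_RInt_unique _ _ _ _ HI); pose proof (exp_pos (- M)); lra.
Qed.

Lemma gauss_integral_limit :
  exists kappa, 0 < kappa /\ forall L, 1 <= L ->
  0 <= kappa - RInt (fun x => exp (- (x * x))) 0 L <= exp (- L).
Proof.
set (G L := RInt (fun x => exp (- (x * x))) 0 L).
assert (HG : forall L M, G M - G L = RInt (fun x => exp (- (x * x))) L M).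
{ intros L M; unfold G.
  rewrite <- (RInt_Chasles _ 0 L M) by apply ex_RInt_gauss; unfold plus; simpl; ring. }
assert (HT : forall L M, 1 <= L <= M -> 0 <= G M - G L <= exp (- L)).
{ intros L M HLM; rewrite HG; apply gauss_tail, HLM. }
destruct (ex_finite_lim_seq_incr (fun n => G (INR n + 1)) (G 1 + exp (Ropp 1))) as [k Hk].
- intros n; assert (0 <= INR n) by apply pos_INR; rewrite S_INR.
  destruct (HT (INR n + 1) (INR n + 1 + 1)) as [H1 _]; lra.
- intros n; assert (0 <= INR n) by apply pos_INR.
  destruct (HT 1 (INR n + 1)) as [_ H1]; lra.
- assert (B : forall L, 1 <= L -> 0 <= k - G L <= exp (- L)).
  { intros L HL; destruct (INR_unbounded L) as [N HN]; split.
    - apply Rle_minus_r; rewrite Rplus_0_l.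
      apply (is_lim_seq_le_loc (fun _ => G L) (fun n => G (INR n + 1)) (G L) k);
        [|apply is_lim_seq_const | exact Hk].
      exists N; intros n Hn; apply le_INR in Hn.
      destruct (HT L (INR n + 1)); lra.
    - apply Rle_minus_l.
      apply (is_lim_seq_le_loc (fun n => G (INR n + 1)) (fun _ => exp (- L) + G L) k (exp (- L) + G L));
        [|exact Hk | apply is_lim_seq_const].
      exists N; intros n Hn; apply le_INR in Hn.
      destruct (HT L (INR n + 1)); lra. }
  exists k; split; [|exact B].
  apply Rlt_le_trans with (G 1); [|destruct (B 1); lra].
  apply RInt_gt_0; [lra | intros; apply exp_pos | intros; apply continuous_gauss].
Qed.

(** * Alternating Poisson summation *)

Lemma continuous_ex_RInt (f : R -> R) (a b : R) :
  (forall x, continuous f x) -> ex_RInt f a b.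
Proof.
intros Hf; apply (ex_RInt_continuous (V := RC)); intros; apply Hf.
Qed.

Lemma continuous_pow (f : R -> R) (n : nat) (x : R) :
  continuous f x -> continuous (fun x => f x ^ n) x.
Proof.
intros Hf; induction n as [|n IH]; simpl; [apply continuous_const|].
apply (continuous_mult f (fun x => f x ^ n)); assumption.
Qed.

Lemma continuous_Rcomp (h f : R -> R) (x : R) :
  continuity h -> continuous f x -> continuous (fun x => h (f x)) x.
Proof.
intros Hh Hf; apply (continuous_comp f h); [exact Hf|].
apply continuity_pt_filterlim, Hh.
Qed.

Ltac cont :=
  lazymatch goal with
  | |- forall _, _ => intro; cont
  | H : forall x, continuous ?h x |- continuous ?h _ => apply H
  | H : forall x, continuous ?h x |- continuous (fun x => ?h x) _ => apply H
  | |- continuous (fun x => @?f x + @?g x) _ => apply (continuous_plus f g); cont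
  | |- continuous (fun x => @?f x - @?g x) _ => apply (continuous_minus f g); cont
  | |- continuous (fun x => @?f x * @?g x) _ => apply (continuous_mult f g); cont
  | |- continuous (fun x => - @?f x) _ => apply (continuous_opp f); cont
  | |- continuous (fun x => @?f x ^ ?n) _ => apply (continuous_pow f n); cont
  | |- continuous (fun x => cos (@?f x)) _ =>
      apply (continuous_Rcomp cos f); [exact continuity_cos | cont]
  | |- continuous (fun x => sin (@?f x)) _ =>
      apply (continuous_Rcomp sin f); [exact continuity_sin | cont]
  | |- continuous (fun x => exp (@?f x)) _ =>
      apply (continuous_Rcomp exp f);
      [exact (derivable_continuous exp derivable_exp) | cont]
  | |- continuous (fun x => Rabs (@?f x)) _ =>
      apply (continuous_Rcomp Rabs f); [exact Rcontinuity_abs | cont]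
  | |- continuous (fun x => x) _ => apply continuous_id
  | H : forall x, continuous ?h x |- continuous (fun x => ?h (@?f x)) _ =>
      apply (continuous_comp f h); [cont | apply H]
  | |- continuous (fun x => ?c) _ => apply continuous_const
  | |- _ => auto
  end.

Lemma RInt_abs_bound (f h : R -> R) (a b : R) : a <= b ->
  (forall x, continuous f x) -> (forall x, continuous h x) ->
  (forall x, a <= x <= b -> Rabs (f x) <= h x) -> Rabs (RInt f a b) <= RInt h a b.
Proof.
intros Hab Hf Hh H.
apply (norm_RInt_le (V := RN) f h a b);
  [exact Hab | exact H | apply (RInt_correct (V := RC)) ..];
  apply continuous_ex_RInt; assumption.
Qed.

Lemma RInt_Rplus (f g : R -> R) (a b : R) :
  (forall x, continuous f x) -> (forall x, continuous g x) ->
  RInt (fun x => f x + g x) a b = RInt f a b + RInt g a b.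
Proof.
intros Hf Hg; apply (RInt_plus (V := RC) f g);
  apply continuous_ex_RInt; assumption.
Qed.

Lemma RInt_Rminus (f g : R -> R) (a b : R) :
  (forall x, continuous f x) -> (forall x, continuous g x) ->
  RInt (fun x => f x - g x) a b = RInt f a b - RInt g a b.
Proof.
intros Hf Hg; apply (RInt_minus (V := RC) f g);
  apply continuous_ex_RInt; assumption.
Qed.

Lemma RInt_Rscal (c : R) (f : R -> R) (a b : R) :
  (forall x, continuous f x) -> RInt (fun x => c * f x) a b = c * RInt f a b.
Proof.
intros Hf; apply (RInt_scal (V := RC) f a b c).
apply continuous_ex_RInt; assumption.
Qed.

Lemma RInt_Rext (f g : R -> R) (a b : R) : (forall x, f x = g x) -> RInt f a b = RInt g a b :> R.
Proof. intros H; apply RInt_ext; intros x _; apply H. Qed.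

Lemma RInt_odd (f : R -> R) (a : R) :
  (forall x, continuous f x) -> (forall x, f (- x) = - f x) -> RInt f (- a) a = 0.
Proof.
intros Hf Hodd.
assert (H := RInt_comp_lin (V := RC) f (-1) 0 (- a) a).
replace (-1 * - a + 0) with a in H by ring; replace (-1 * a + 0) with (- a) in H by ring.
rewrite <- (opp_RInt_swap (V := RC) f (- a) a) in H
  by (apply continuous_ex_RInt, Hf).
rewrite (RInt_Rext _ f) in H.
- specialize (H (continuous_ex_RInt f _ _ Hf)); unfold opp in H; simpl in H; lra.
- intros x; change (-1 * f (-1 * x + 0) = f x).
  replace (-1 * x + 0) with (- x) by ring; rewrite Hodd; ring.
Qed.

Lemma RInt_translate (f : R -> R) (a b v : R) : (forall x, continuous f x) ->
  RInt (fun x => f (x + v)) a b = RInt f (a + v) (b + v).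
Proof.
intros Hf.
assert (H := RInt_comp_lin (V := RC) f 1 v a b).
rewrite !Rmult_1_l in H; rewrite <- H by (apply continuous_ex_RInt, Hf).
apply RInt_Rext; intros x.
change (f (x + v) = 1 * f (1 * x + v)); rewrite !Rmult_1_l; reflexivity.
Qed.

Lemma cos_even_abs (x : R) : cos (Rabs x) = cos x.
Proof. unfold Rabs; destruct (Rcase_abs x); [apply cos_neg | reflexivity]. Qed.

Lemma cos_pi_far (y d : R) : 0 <= d -> d <= Rabs y <= 1 - d -> Rabs (cos (PI * y)) <= cos (PI * d).
Proof.
intros Hd Hy; pose proof PI_RGT_0.
rewrite <- cos_even_abs, Rabs_mult, (Rabs_pos_eq PI) by lra.
apply Rabs_le; split.
- rewrite <- Rtrigo_facts.cos_pi_minus.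
  replace (PI - PI * d) with (PI * (1 - d)) by ring.
  apply cos_decr_1; nra.
- apply cos_decr_1; nra.
Qed.

(** Only the window |x - x0| <= d/2 is kept, where the cosine is at least cos (pi d/2). By
    [cos_pi_far] the kernel is at most cos (pi d)^m at distance d or more, which is exponentially
    smaller. *)
Lemma cos_kernel_mass (x0 d : R) (m : nat) : 0 < d -> Rabs x0 + d < 1 / 2 ->
  d * cos (PI * (d / 2)) ^ m <= RInt (fun x => Rabs (cos (PI * (x - x0)) ^ m)) (- (1 / 2)) (1 / 2).
Proof.
intros Hd Hx; pose proof PI_RGT_0.
set (h := fun x => Rabs (cos (PI * (x - x0)) ^ m)).
assert (Hh : forall x, continuous h x) by (unfold h; cont).
assert (Hpos : forall a b, a <= b -> 0 <= RInt h a b).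
{ intros a b Hab; apply RInt_ge_0; [exact Hab | apply continuous_ex_RInt, Hh | intros; apply Rabs_pos]. }
assert (- Rabs x0 <= x0 <= Rabs x0) by (apply Rabs_le_between; lra).
rewrite <- (RInt_Chasles (V := RC) h _ (x0 - d / 2) _)
  by (apply continuous_ex_RInt, Hh).
rewrite <- (RInt_Chasles (V := RC) h (x0 - d / 2) (x0 + d / 2) _)
  by (apply continuous_ex_RInt, Hh).
assert (H1 := Hpos (- (1 / 2)) (x0 - d / 2) ltac:(lra)).
assert (H2 := Hpos (x0 + d / 2) (1 / 2) ltac:(lra)).
unfold plus; simpl.
enough (d * cos (PI * (d / 2)) ^ m <= RInt h (x0 - d / 2) (x0 + d / 2)) by lra.
replace (d * cos (PI * (d / 2)) ^ m)
  with (RInt (fun _ => cos (PI * (d / 2)) ^ m) (x0 - d / 2) (x0 + d / 2)).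
- apply RInt_le; [lra | apply ex_RInt_const | apply continuous_ex_RInt, Hh |].
  intros x Hx'; unfold h; rewrite <- RPow_abs.
  apply pow_incr; split; [apply cos_ge_0; nra|].
  rewrite <- (cos_even_abs (PI * (x - x0))), Rabs_mult, (Rabs_pos_eq PI) by lra.
  assert (Rabs (x - x0) <= d / 2) by (apply Rabs_le; lra).
  pose proof (Rabs_pos (x - x0)).
  eapply Rle_trans; [|apply Rle_abs]; apply cos_decr_1; nra.
- rewrite RInt_const.
  change ((x0 + d / 2 - (x0 - d / 2)) * cos (PI * (d / 2)) ^ m = d * cos (PI * (d / 2)) ^ m).
  field.
Qed.

(** If g x0 exceeded eps, g would be at least eps + eta on a window around x0, where the kernel
    gathers its mass as M grows, and the integral would exceed eps times that mass. The odd power is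
    negative at distances beyond 1/2, so the mass is that of the absolute value. *)
Lemma cos_kernel_concentration_le (g : R -> R) (x0 eps : R) :
  (forall x, continuous g x) -> Rabs x0 < 1 / 2 -> 0 <= eps ->
  (forall M, RInt (fun x => g x * cos (PI * (x - x0)) ^ (2 * M + 1)) (- (1 / 2)) (1 / 2)
     <= eps * RInt (fun x => Rabs (cos (PI * (x - x0)) ^ (2 * M + 1))) (- (1 / 2)) (1 / 2)) ->
  g x0 <= eps.
Proof.
intros Hg Hx0 Heps HM; apply Rnot_lt_le; intros Hlt; pose proof PI_RGT_0.
set (eta := (g x0 - eps) / 2); assert (Heta : 0 < eta) by (unfold eta; lra).
destruct (proj2 (continuity_pt_filterlim g x0) (Hg x0) eta Heta) as (d0 & Hd0 & Hnear).
(* Inside the continuity radius, and small enough that |x - x0| <= 1 - d on the whole interval, away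
   from the second peak of |cos (pi y)| at |y| = 1. *)
set (d := Rmin (d0 / 2) ((1 / 2 - Rabs x0) / 2)).
assert (Hd : 0 < d) by (apply Rmin_glb_lt; lra).
assert (Hdl : d <= d0 / 2) by apply Rmin_l.
assert (Hdr : d <= (1 / 2 - Rabs x0) / 2) by apply Rmin_r.
assert (Hgn : forall x, Rabs (x - x0) <= d -> eps + eta <= g x).
{ intros x Hx; destruct (Req_dec x x0) as [->|Hne]; [unfold eta in *; lra|].
  assert (Hlt' : Rabs (g x - g x0) < eta).
  { apply Hnear; split; [split; [exact I | auto] | unfold R_dist; simpl; unfold R_dist; lra]. }
  apply Rabs_lt_between in Hlt'; unfold eta in *; lra. }
pose proof (Rabs_pos x0) as Habs0.
destruct (continuity_ab_maj (fun x => Rabs (g x)) (- (1 / 2)) (1 / 2)) as (xm & HB & _); [lra| |].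
{ intros x _; apply continuity_pt_filterlim.
  apply (continuous_Rcomp Rabs g); [exact Rcontinuity_abs | apply Hg]. }
set (B := Rabs (g xm)); assert (HB0 : 0 <= B) by apply Rabs_pos.
set (rho := cos (PI * d)); set (sigma := cos (PI * (d / 2))).
assert (Hrho : 0 <= rho) by (apply cos_ge_0; nra).
assert (Hsig : rho < sigma) by (apply cos_decreasing_1; nra).
set (C := B + eps + eta).
(* The term C rho^(2M+1) pays for everything outside the window. Since rho < sigma, this inequality
   fails for large M. *)
assert (Hkey : forall M, eta * d * sigma ^ (2 * M + 1) <= C * rho ^ (2 * M + 1)).
{ intros M; set (k := fun x => cos (PI * (x - x0)) ^ (2 * M + 1)).
  assert (Hk : forall x, continuous k x) by (unfold k; cont).
  specialize (HM M); fold k in HM.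
  assert (Hmass := cos_kernel_mass x0 d (2 * M + 1) Hd ltac:(lra)).
  change (fun x => Rabs (cos (PI * (x - x0)) ^ (2 * M + 1))) with (fun x => Rabs (k x)) in *.
  change (fun x => g x * cos (PI * (x - x0)) ^ (2 * M + 1)) with (fun x => g x * k x) in *.
  assert (Hpt : forall x, - (1 / 2) < x < 1 / 2 ->
     (eta + eps) * Rabs (k x) - C * rho ^ (2 * M + 1) <= g x * k x).
  { intros x Hx.
    destruct (Rle_lt_dec (Rabs (x - x0)) d) as [Hn|Hf].
    - assert (Hk0 : 0 <= k x).
      { apply pow_le; rewrite <- cos_even_abs, Rabs_mult, (Rabs_pos_eq PI) by lra.
        pose proof (Rabs_pos (x - x0)); apply cos_ge_0; nra. }
      rewrite Rabs_pos_eq by exact Hk0; specialize (Hgn x Hn).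
      assert (0 <= C * rho ^ (2 * M + 1)) by (apply Rmult_le_pos; [unfold C; lra | apply pow_le, Hrho]).
      nra.
    - assert (Hkr : Rabs (k x) <= rho ^ (2 * M + 1)).
      { unfold k; rewrite <- RPow_abs; apply pow_incr; split; [apply Rabs_pos|].
        apply cos_pi_far; [lra|]; split; [lra|].
        unfold Rminus at 1; eapply Rle_trans; [apply Rabs_triang|]; rewrite Rabs_Ropp.
        assert (Rabs x <= 1 / 2) by (apply Rabs_le; lra); lra. }
      assert (Hgk : - (B * Rabs (k x)) <= g x * k x).
      { apply Rle_trans with (- (Rabs (g x) * Rabs (k x))).
        - apply Ropp_le_contravar, Rmult_le_compat_r; [apply Rabs_pos | apply HB; lra].
        - rewrite <- Rabs_mult; pose proof (Rle_abs (- (g x * k x))); rewrite Rabs_Ropp in *; lra. }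
      assert (C * Rabs (k x) <= C * rho ^ (2 * M + 1)) by (apply Rmult_le_compat_l; [unfold C; lra | exact Hkr]).
      unfold C in *; lra. }
  assert (Hint : RInt (fun x => (eta + eps) * Rabs (k x) - C * rho ^ (2 * M + 1)) (- (1 / 2)) (1 / 2)
    <= RInt (fun x => g x * k x) (- (1 / 2)) (1 / 2)).
  { apply RInt_le; [lra | apply continuous_ex_RInt; cont | apply continuous_ex_RInt; cont | exact Hpt]. }
  rewrite RInt_Rminus, RInt_Rscal, RInt_const in Hint by cont.
  change (scal ?a ?b) with (a * b) in Hint.
  fold sigma in Hmass.
  assert (eta * (d * sigma ^ (2 * M + 1)) <= eta * RInt (fun x => Rabs (k x)) (- (1 / 2)) (1 / 2))
    by (apply Rmult_le_compat_l; lra).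
  lra. }
assert (HC : 0 < C) by (unfold C; lra).
assert (Hq : Rabs (rho / sigma) < 1).
{ rewrite Rabs_pos_eq by (apply Rdiv_le_0_compat; lra).
  apply Rmult_lt_reg_r with sigma; [lra|]; unfold Rdiv; rewrite Rmult_assoc, Rinv_l; lra. }
destruct (pow_lt_1_zero _ Hq (eta * d / C)) as [N HN].
{ apply Rdiv_lt_0_compat; [apply Rmult_lt_0_compat|]; lra. }
specialize (HN (2 * N + 1)%nat ltac:(lia)); specialize (Hkey N).
assert (Hs : 0 < sigma ^ (2 * N + 1)) by (apply pow_lt; lra).
assert (HN' : (rho / sigma) ^ (2 * N + 1) < eta * d / C) by (eapply Rle_lt_trans; [apply Rle_abs | exact HN]).
apply (Rmult_lt_compat_r (C * sigma ^ (2 * N + 1))) in HN'; [|nra].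
replace ((rho / sigma) ^ (2 * N + 1) * (C * sigma ^ (2 * N + 1))) with (C * rho ^ (2 * N + 1)) in HN'.
- replace (eta * d / C * (C * sigma ^ (2 * N + 1))) with (eta * d * sigma ^ (2 * N + 1)) in HN' by (field; lra).
  lra.
- unfold Rdiv; rewrite Rpow_mult_distr, pow_inv; field; lra.
Qed.

Lemma cos_kernel_concentration (g : R -> R) (x0 eps : R) :
  (forall x, continuous g x) -> Rabs x0 < 1 / 2 -> 0 <= eps ->
  (forall M, Rabs (RInt (fun x => g x * cos (PI * (x - x0)) ^ (2 * M + 1)) (- (1 / 2)) (1 / 2))
     <= eps * RInt (fun x => Rabs (cos (PI * (x - x0)) ^ (2 * M + 1))) (- (1 / 2)) (1 / 2)) ->
  Rabs (g x0) <= eps.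
Proof.
intros Hg Hx0 Heps HM; apply Rabs_le; split.
- apply Ropp_le_cancel; rewrite Ropp_involutive.
  apply (cos_kernel_concentration_le (fun x => - g x)); auto.
  { cont. }
  intros M; eapply Rle_trans; [|apply HM].
  rewrite (RInt_Rext _ (fun x => -1 * (g x * cos (PI * (x - x0)) ^ (2 * M + 1)))) by (intros; simpl; ring).
  rewrite RInt_Rscal by cont.
  match goal with |- -1 * ?I <= _ => pose proof (Rle_abs (- I)); rewrite Rabs_Ropp in *; lra end.
- apply (cos_kernel_concentration_le g); auto.
  intros M; eapply Rle_trans; [apply Rle_abs | apply HM].
Qed.

(** * Fourier coefficients at the odd multiples of pi *)

Definition half_freq (j : nat) : R := (2 * INR j + 1) * PI.

Lemma half_freq_shift (j n : nat) (x : R) :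
  cos (half_freq j * (x + INR n)) = (-1) ^ n * cos (half_freq j * x).
Proof.
unfold half_freq; induction n as [|n IH]; [simpl; rewrite Rplus_0_r; ring|].
rewrite S_INR.
replace ((2 * INR j + 1) * PI * (x + (INR n + 1)))
  with ((2 * INR j + 1) * PI * (x + INR n) + PI + 2 * INR j * PI) by ring.
rewrite cos_period, neg_cos, IH; simpl; ring.
Qed.

(** With v = pi (x - x0), cos^2 v = (1 + cos 2v)/2 moves the frequency index by -1, 0 or 1, so that
    M squares reach only indices up to j + M. The weights 1/2, 1/4, 1/4 add up to 1 and the bound
    [delta] is not worsened. Against the even g a phase a contributes only the factor cos a. *)
Lemma cos_kernel_span (g : R -> R) (x0 delta : R) (J : nat) :
  (forall x, continuous g x) -> (forall x, g (- x) = g x) ->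
  (forall j, (j <= J)%nat ->
    Rabs (RInt (fun x => g x * cos (half_freq j * x)) (- (1 / 2)) (1 / 2)) <= delta) ->
  forall M j a, (j + M <= J)%nat ->
  Rabs (RInt (fun x => g x * (cos (PI * (x - x0)) ^ (2 * M) * cos (half_freq j * x + a)))
    (- (1 / 2)) (1 / 2)) <= delta.
Proof.
intros Hg Heven Hdelta M; induction M as [|M IH]; intros j a HjM.
- rewrite (RInt_Rext _ (fun x => cos a * (g x * cos (half_freq j * x))
    - sin a * (g x * sin (half_freq j * x)))) by (intros; simpl; rewrite cos_plus; ring).
  rewrite RInt_Rminus, !RInt_Rscal by cont.
  rewrite (RInt_odd (fun x => g x * sin (half_freq j * x))).
  + rewrite Rmult_0_r, Rminus_0_r, Rabs_mult.
    specialize (Hdelta j ltac:(lia)).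
    assert (Rabs (cos a) <= 1) by (apply Rabs_le, COS_bound).
    pose proof (Rabs_pos (RInt (fun x => g x * cos (half_freq j * x)) (- (1 / 2)) (1 / 2))); nra.
  + cont.
  + intros x; rewrite Heven, Ropp_mult_distr_r_reverse, sin_neg; ring.
- set (k := fun (c b : R) x => g x * (cos (PI * (x - x0)) ^ (2 * M) * cos (c * x + b))).
  assert (Hk : forall c b x, continuous (k c b) x) by (intros c b; unfold k; cont).
  assert (Hup := IH (S j) (a - 2 * PI * x0) ltac:(lia)).
  assert (Hmid := IH j a ltac:(lia)).
  (* At j = 0 the lower frequency is -pi; by evenness of cos it has index 0 again, with the phase
     reversed. *)
  assert (Hdown : exists c b, Rabs (RInt (k c b) (- (1 / 2)) (1 / 2)) <= delta /\
    forall x, cos (c * x + b) = cos (half_freq j * x + a - 2 * (PI * (x - x0)))).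
  { destruct j as [|j].
    - exists (half_freq 0), (- (a + 2 * PI * x0)); split; [apply IH; lia|].
      intros x; rewrite <- cos_neg; f_equal; unfold half_freq; simpl; ring.
    - exists (half_freq j), (a + 2 * PI * x0); split; [apply IH; lia|].
      intros x; f_equal; unfold half_freq; rewrite S_INR; ring. }
  destruct Hdown as (c & b & Hdown & Hcb).
  rewrite (RInt_Rext _ (fun x => 1 / 2 * k (half_freq j) a x
     + (1 / 4 * k (half_freq (S j)) (a - 2 * PI * x0) x + 1 / 4 * k c b x))).
  + assert (H1 := Hk (half_freq j) a); assert (H2 := Hk c b).
    assert (H3 := Hk (half_freq (S j)) (a - 2 * PI * x0)).
    rewrite !RInt_Rplus, !RInt_Rscal by cont.
    fold (k (half_freq j) a) in Hmid; fold (k (half_freq (S j)) (a - 2 * PI * x0)) in Hup.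
    apply Rabs_le_between in Hup; apply Rabs_le_between in Hmid; apply Rabs_le_between in Hdown.
    apply Rabs_le; lra.
  + intros x; unfold k; rewrite Hcb.
    replace (half_freq (S j) * x + (a - 2 * PI * x0))
      with (half_freq j * x + a + 2 * (PI * (x - x0)))
      by (unfold half_freq; rewrite S_INR; ring).
    set (y := half_freq j * x + a); set (v := PI * (x - x0)).
    assert (Hv : cos (y - 2 * v) + cos (y + 2 * v) = 2 * cos y * (2 * (cos v * cos v) - 1)).
    { rewrite cos_minus, cos_plus, cos_2a_cos; ring. }
    replace (2 * S M)%nat with (S (S (2 * M))) by lia.
    rewrite <- !tech_pow_Rmult.
    replace (cos (y - 2 * v)) with (2 * cos y * (2 * (cos v * cos v) - 1) - cos (y + 2 * v)) by lra.
    field.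
Qed.

(** For even f, the symmetric partial sums of the series of (-1)^n f (x + n) over the integers, with
    x - n reflected to n - x. The full sum changes sign under x -> x + 1, hence the odd multiples of
    pi as frequencies. *)
Fixpoint alt_sum (f : R -> R) (N : nat) (x : R) : R :=
  match N with
  | 0%nat => f x
  | S n => alt_sum f n x + (-1) ^ S n * (f (INR (S n) - x) + f (INR (S n) + x))
  end.

Fixpoint cos_sum (I : nat -> R) (J : nat) (x : R) : R :=
  match J with
  | 0%nat => 0
  | S j => cos_sum I j x + 2 * I j * cos (half_freq j * x)
  end.

Lemma alt_sum_continuous (f : R -> R) (N : nat) :
  (forall x, continuous f x) -> forall x, continuous (alt_sum f N) x.
Proof. intros Hf; induction N as [|N IH]; cbn [alt_sum]; cont. Qed.

Lemma cos_sum_continuous (I : nat -> R) (J : nat) : forall x, continuous (cos_sum I J) x.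
Proof. induction J as [|J IH]; cbn [cos_sum]; cont. Qed.

Lemma alt_sum_even (f : R -> R) (N : nat) (x : R) :
  (forall x, f (- x) = f x) -> alt_sum f N (- x) = alt_sum f N x.
Proof.
intros Hf; induction N as [|N IH]; cbn [alt_sum]; [apply Hf|].
rewrite IH; unfold Rminus; rewrite Ropp_involutive; ring.
Qed.

Lemma cos_sum_even (I : nat -> R) (J : nat) (x : R) : cos_sum I J (- x) = cos_sum I J x.
Proof.
induction J as [|J IH]; simpl; [reflexivity|].
rewrite IH, Ropp_mult_distr_r_reverse, cos_neg; reflexivity.
Qed.

(** Unfolding: translation by n multiplies the cosine by (-1)^n, which cancels the sign of the n-th
    term, and the translated unit intervals join into one. *)
Lemma alt_sum_coef (f : R -> R) (j N : nat) :
  (forall x, continuous f x) -> (forall x, f (- x) = f x) ->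
  RInt (fun x => alt_sum f N x * cos (half_freq j * x)) (- (1 / 2)) (1 / 2)
  = RInt (fun x => f x * cos (half_freq j * x)) (- (INR N + 1 / 2)) (INR N + 1 / 2) :> R.
Proof.
intros Hf Heven; set (h := fun x => f x * cos (half_freq j * x)).
assert (Hh : forall x, continuous h x) by (unfold h; cont).
induction N as [|N IH]; [simpl; rewrite Rplus_0_l; reflexivity|].
assert (Hc := fun N => alt_sum_continuous f N Hf).
rewrite (RInt_Rext _ (fun x => alt_sum f N x * cos (half_freq j * x)
   + (h (x + - INR (S N)) + h (x + INR (S N))))).
- rewrite !RInt_Rplus by (assert (Hc' := Hc N); cont).
  rewrite IH, !RInt_translate by exact Hh.
  rewrite S_INR; pose proof (pos_INR N).
  rewrite <- (RInt_Chasles (V := RC) h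
    (- (INR N + 1 + 1 / 2)) (- (INR N + 1 / 2)) (INR N + 1 + 1 / 2))
    by (apply continuous_ex_RInt, Hh).
  rewrite <- (RInt_Chasles (V := RC) h
    (- (INR N + 1 / 2)) (INR N + 1 / 2) (INR N + 1 + 1 / 2))
    by (apply continuous_ex_RInt, Hh).
  unfold plus; simpl.
  replace (- (1 / 2) + - (INR N + 1)) with (- (INR N + 1 + 1 / 2)) by field.
  replace (1 / 2 + - (INR N + 1)) with (- (INR N + 1 / 2)) by field.
  replace (- (1 / 2) + (INR N + 1)) with (INR N + 1 / 2) by field.
  replace (1 / 2 + (INR N + 1)) with (INR N + 1 + 1 / 2) by field.
  ring.
- intros x; unfold h; cbn [alt_sum].
  rewrite half_freq_shift.
  assert (Hm := half_freq_shift j (S N) (x + - INR (S N))).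
  replace (x + - INR (S N) + INR (S N)) with x in Hm by ring.
  rewrite <- (Heven (x + - INR (S N))).
  replace (- (x + - INR (S N))) with (INR (S N) - x) by ring.
  rewrite (Rplus_comm x (INR (S N))).
  assert (Hs : (-1) ^ S N * (-1) ^ S N = 1).
  { rewrite <- Rpow_mult_distr; replace (-1 * -1) with 1 by ring; apply pow1. }
  set (s := (-1) ^ S N) in *; set (C1 := cos (half_freq j * x)) in *.
  set (C2 := cos (half_freq j * (x + - INR (S N)))) in *.
  replace C2 with (s * C1) by (rewrite Hm, <- Rmult_assoc, Hs; ring).
  ring.
Qed.

Lemma half_freq_orthogonal (i j : nat) :
  RInt (fun x => cos (half_freq i * x) * cos (half_freq j * x)) (- (1 / 2)) (1 / 2)
  = (if Nat.eq_dec i j then 1 / 2 else 0) :> R.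
Proof.
pose proof PI_RGT_0 as HPI.
assert (Hsin : forall k : Z, k <> 0%Z ->
  RInt (fun x => cos (2 * IZR k * PI * x)) (- (1 / 2)) (1 / 2) = 0 :> R).
{ intros k Hk; assert (HkR : IZR k <> 0) by (apply (eq_IZR_contrapositive k 0%Z), Hk).
  assert (HI : is_RInt (fun x => cos (2 * IZR k * PI * x)) (- (1 / 2)) (1 / 2)
    (sin (2 * IZR k * PI * (1 / 2)) / (2 * IZR k * PI)
     - sin (2 * IZR k * PI * - (1 / 2)) / (2 * IZR k * PI))).
  { apply (is_RInt_derive (V := RC)
      (fun x => sin (2 * IZR k * PI * x) / (2 * IZR k * PI))); intros x _.
    - auto_derive; [exact I | field; lra].
    - revert x; cont. }
  rewrite (is_RInt_unique _ _ _ _ HI).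
  replace (2 * IZR k * PI * (1 / 2)) with (IZR k * PI) by field.
  replace (2 * IZR k * PI * - (1 / 2)) with (- (IZR k * PI)) by field.
  rewrite sin_neg, (sin_eq_0_1 (IZR k * PI)) by (exists k; reflexivity).
  match goal with |- ?a = ?b => change (@eq R a b) end; field; lra. }
rewrite (RInt_Rext _ (fun x => 1 / 2 * cos (2 * IZR (Z.of_nat i - Z.of_nat j) * PI * x)
  + 1 / 2 * cos (2 * IZR (Z.of_nat i + Z.of_nat j + 1) * PI * x))).
- rewrite RInt_Rplus, !RInt_Rscal by cont.
  rewrite (Hsin (Z.of_nat i + Z.of_nat j + 1)%Z) by lia.
  destruct (Nat.eq_dec i j) as [->|Hij]; [|rewrite Hsin by lia; ring].
  rewrite (RInt_Rext _ (fun _ => 1)).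
  + rewrite RInt_const; change (1 / 2 * ((1 / 2 - - (1 / 2)) * 1) + 1 / 2 * 0 = 1 / 2); field.
  + intros x; rewrite Z.sub_diag.
    replace (2 * 0 * PI * x) with 0 by ring; apply cos_0.
- intros x; rewrite minus_IZR, !plus_IZR, <- !INR_IZR_INZ.
  replace (2 * (INR i - INR j) * PI * x) with (half_freq i * x - half_freq j * x)
    by (unfold half_freq; ring).
  replace (2 * (INR i + INR j + 1) * PI * x) with (half_freq i * x + half_freq j * x)
    by (unfold half_freq; ring).
  rewrite cos_minus, cos_plus; field.
Qed.

Lemma cos_sum_coef (I : nat -> R) (j J : nat) :
  RInt (fun x => cos_sum I J x * cos (half_freq j * x)) (- (1 / 2)) (1 / 2)
  = (if Nat.ltb j J then I j else 0) :> R.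
Proof.
induction J as [|J IH]; cbn [cos_sum].
- rewrite (RInt_Rext _ (fun _ => 0)) by (intros; simpl; ring).
  rewrite RInt_const; apply Rmult_0_r.
- assert (Hc := cos_sum_continuous I J).
  rewrite (RInt_Rext _ (fun x => cos_sum I J x * cos (half_freq j * x)
    + 2 * I J * (cos (half_freq J * x) * cos (half_freq j * x)))) by (intros; simpl; ring).
  rewrite RInt_Rplus, RInt_Rscal, IH, half_freq_orthogonal by cont.
  destruct (Nat.eq_dec J j) as [->|Hne].
  + rewrite Nat.ltb_irrefl, (proj2 (Nat.ltb_lt j (S j))) by lia; field.
  + destruct (Nat.ltb_spec j J); destruct (Nat.ltb_spec j (S J)); try lia; ring.
Qed.

Lemma ex_series_tail (b : nat -> R) (eps : R) : ex_series b -> 0 < eps ->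
  exists K, forall n m, (K <= n)%nat -> Rabs (sum_n_m b (S n) m) <= eps.
Proof.
intros Hb Heps; destruct (Cauchy_ex_series b Hb (mkposreal eps Heps)) as [K HK].
exists K; intros n m Hn; destruct (Nat.le_gt_cases (S n) m) as [Hm|Hm].
- left; apply (HK (S n) m); lia.
- rewrite sum_n_m_zero by lia; change (Rabs 0 <= eps); rewrite Rabs_R0; lra.
Qed.

Lemma uniform_tail (F : nat -> R -> R) (b : nat -> R) (D : R -> Prop) (eps : R) :
  ex_series b -> 0 < eps ->
  (forall n x, D x -> Rabs (F (S n) x - F n x) <= b (S n)) ->
  exists K, forall n x, (K <= n)%nat -> D x -> Rabs (F n x - F K x) <= eps.
Proof.
intros Hb Heps Hstep; destruct (ex_series_tail b eps Hb Heps) as [K HK].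
exists K; intros n x Hn Hx.
apply Rle_trans with (sum_n_m b (S K) n); [|eapply Rle_trans; [apply Rle_abs | apply HK; lia]].
induction Hn as [|n Hn IH].
- rewrite Rminus_diag, Rabs_R0, sum_n_m_zero by lia; right; reflexivity.
- rewrite sum_n_Sm by lia.
  replace (F (S n) x - F K x) with ((F n x - F K x) + (F (S n) x - F n x)) by ring.
  eapply Rle_trans; [apply Rabs_triang|].
  apply Rplus_le_compat; [exact IH | apply Hstep, Hx].
Qed.

Lemma is_lim_seq_uniform_finite (u : nat -> nat -> R) (l : nat -> R) (J : nat) (eta : R) :
  0 < eta -> (forall j, is_lim_seq (u j) (l j)) ->
  exists N, forall n j, (N <= n)%nat -> (j <= J)%nat -> Rabs (u j n - l j) <= eta.
Proof.
intros Heta Hu; induction J as [|J [N HN]].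
- destruct (proj1 (is_lim_seq_Reals _ _) (Hu 0%nat) eta Heta) as [N HN].
  exists N; intros n j Hn Hj; replace j with 0%nat by lia; left; apply HN, Hn.
- destruct (proj1 (is_lim_seq_Reals _ _) (Hu (S J)) eta Heta) as [N' HN'].
  exists (N + N')%nat; intros n j Hn Hj.
  destruct (Nat.eq_dec j (S J)) as [->|Hne]; [left; apply HN'; lia | apply HN; lia].
Qed.

(** The difference of the two partial sums has small coefficients at all low frequencies, hence a
    small integral against the kernel centred at x0, hence a small value at x0. The summability of
    [b] and [I] makes both partial sums uniformly Cauchy, so that the truncations can be fixed
    before the kernel is sharpened. *)
Lemma alternating_poisson (f : R -> R) (I b : nat -> R) (x0 : R) :
  (forall x, continuous f x) -> (forall x, f (- x) = f x) ->
  (forall n x, Rabs x <= 1 / 2 -> Rabs (f (INR (S n) - x) + f (INR (S n) + x)) <= b (S n)) ->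
  ex_series b ->
  (forall j, is_lim_seq (fun N => RInt (fun x => f x * cos (half_freq j * x))
     (- (INR N + 1 / 2)) (INR N + 1 / 2)) (I j)) ->
  ex_series (fun j => Rabs (I j)) -> Rabs x0 < 1 / 2 ->
  is_lim_seq (fun N => alt_sum f N x0 - cos_sum I N x0) 0.
Proof.
intros Hf Heven Hb Hbs HI HIs Hx0; apply is_lim_seq_Reals; intros e He.
(* Two tails in the kernel estimate and two more in passing from K1 and K2 to n: 4 eps in all. *)
set (eps := e / 8); assert (Heps : 0 < eps) by (unfold eps; lra).
destruct (uniform_tail (alt_sum f) b (fun x => Rabs x <= 1 / 2) eps Hbs Heps) as [K1 HK1].
{ intros n x Hx; cbn [alt_sum].
  replace (alt_sum f n x + _ - alt_sum f n x)
    with ((-1) ^ S n * (f (INR (S n) - x) + f (INR (S n) + x))) by ring.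
  rewrite Rabs_mult, pow_1_abs, Rmult_1_l; apply Hb, Hx. }
destruct (uniform_tail (cos_sum I) (fun j => 2 * Rabs (I (pred j))) (fun _ => True) eps) as [K2 HK2].
{ apply ex_series_incr_1; simpl; apply (ex_series_scal_l (K := R_AbsRing) 2 (fun j => Rabs (I j))), HIs. }
{ exact Heps. }
{ intros n x _; cbn [cos_sum pred].
  replace (cos_sum I n x + _ - cos_sum I n x) with (2 * I n * cos (half_freq n * x)) by ring.
  rewrite !Rabs_mult, (Rabs_pos_eq 2) by lra.
  assert (Rabs (cos (half_freq n * x)) <= 1) by (apply Rabs_le, COS_bound).
  pose proof (Rabs_pos (I n)); nra. }
set (g0 := fun x => alt_sum f K1 x - cos_sum I K2 x).
assert (Hg0 : forall x, continuous g0 x).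
{ assert (H1 := alt_sum_continuous f K1 Hf); assert (H2 := cos_sum_continuous I K2).
  unfold g0; cont. }
assert (Hmain : Rabs (g0 x0) <= 2 * eps).
{ apply cos_kernel_concentration; [exact Hg0 | exact Hx0 | lra |]; intros M.
  set (k := fun x => cos (PI * (x - x0)) ^ (2 * M + 1)).
  assert (Hk : forall x, continuous k x) by (unfold k; cont).
  change (fun x => Rabs (cos (PI * (x - x0)) ^ (2 * M + 1))) with (fun x => Rabs (k x)).
  change (fun x => g0 x * cos (PI * (x - x0)) ^ (2 * M + 1)) with (fun x => g0 x * k x).
  apply le_epsilon; intros eta Heta.
  (* [J] exceeds M, so the cosine sum has its coefficient I j at each frequency j <= M met by the
     kernel. [N] is then large enough for [alt_sum] to have the same coefficients up to eta. *)
  set (J := (K2 + M + 1)%nat).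
  destruct (is_lim_seq_uniform_finite (fun j N => RInt (fun x => f x * cos (half_freq j * x))
     (- (INR N + 1 / 2)) (INR N + 1 / 2)) I M eta Heta HI) as [N0 HN0].
  set (N := (K1 + N0)%nat).
  set (g := fun x => alt_sum f N x - cos_sum I J x).
  assert (H1 := alt_sum_continuous f N Hf); assert (H2 := cos_sum_continuous I J).
  assert (Hg : forall x, continuous g x) by (unfold g; cont).
  assert (Hgk : Rabs (RInt (fun x => g x * k x) (- (1 / 2)) (1 / 2)) <= eta).
  { rewrite (RInt_Rext _ (fun x => g x * (cos (PI * (x - x0)) ^ (2 * M) * cos (half_freq 0 * x + - (PI * x0))))).
    - apply (cos_kernel_span g x0 eta M); [exact Hg | | | lia].
      + intros x; unfold g; rewrite alt_sum_even, cos_sum_even by exact Heven; reflexivity.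
      + intros j Hj.
        rewrite (RInt_Rext _ (fun x => alt_sum f N x * cos (half_freq j * x)
          - cos_sum I J x * cos (half_freq j * x))) by (intros; unfold g; ring).
        rewrite RInt_Rminus, alt_sum_coef, cos_sum_coef by (assumption || cont).
        rewrite (proj2 (Nat.ltb_lt j J)) by (unfold J; lia).
        apply HN0; unfold N; lia.
    - intros x; unfold k; rewrite pow_add, pow_1; f_equal; f_equal; f_equal.
      unfold half_freq; simpl; ring. }
  assert (Hdiff : Rabs (RInt (fun x => (g0 x - g x) * k x) (- (1 / 2)) (1 / 2))
    <= RInt (fun x => 2 * eps * Rabs (k x)) (- (1 / 2)) (1 / 2)).
  { apply RInt_abs_bound; [lra | cont | cont |]; intros x Hx.
    rewrite Rabs_mult; apply Rmult_le_compat_r; [apply Rabs_pos|].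
    assert (Hx' : Rabs x <= 1 / 2) by (apply Rabs_le; lra).
    assert (A := HK1 N x ltac:(unfold N; lia) Hx').
    assert (B := HK2 J x ltac:(unfold J; lia) Logic.I).
    apply Rabs_le_between in A; apply Rabs_le_between in B.
    apply Rabs_le; unfold g0, g; lra. }
  rewrite (RInt_Rext _ (fun x => (g0 x - g x) * k x + g x * k x)) by (intros; simpl; ring).
  rewrite RInt_Rplus by cont.
  rewrite RInt_Rscal in Hdiff by cont.
  eapply Rle_trans; [apply Rabs_triang|]; lra. }
exists (K1 + K2)%nat; intros n Hn.
assert (A := HK1 n x0 ltac:(lia) ltac:(lra)); assert (B := HK2 n x0 ltac:(lia) Logic.I).
unfold g0 in Hmain; unfold R_dist; rewrite Rminus_0_r.
apply Rabs_le_between in A; apply Rabs_le_between in B; apply Rabs_le_between in Hmain.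
apply Rabs_def1; unfold eps in *; lra.
Qed.

(** * Partitions with bounded parts and limits of complex sums *)

(** Removing a part S N' is not a structural descent in n, hence the fuel; n is enough fuel because
    every removal takes away at least 1. *)
Fixpoint bounded_partitions (N : nat) : nat -> nat :=
  match N with
  | O => fun n => match n with O => 1%nat | _ => 0%nat end
  | S N' => fun n =>
      (fix go (fuel n : nat) : nat :=
        (bounded_partitions N' n +
         match fuel with
         | O => 0
         | S f => if S N' <=? n then go f (n - S N') else 0
         end)%nat) n n
  end.

Lemma bounded_partitions_S (N n : nat) :
  bounded_partitions (S N) n =
  (bounded_partitions N n + if S N <=? n then bounded_partitions (S N) (n - S N) else 0)%nat.
Proof.
cbn [bounded_partitions].
set (go := fix go (fuel n : nat) : nat :=
  (bounded_partitions N n + match fuel with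
   | O => 0 | S f => if S N <=? n then go f (n - S N) else 0 end)%nat).
assert (Hgo : forall fuel n, go fuel n = (bounded_partitions N n + match fuel with
   | O => 0 | S f => if S N <=? n then go f (n - S N) else 0 end)%nat)
  by (intros [|fuel] m; reflexivity).
assert (Hfuel : forall f1 f2 n, (n <= f1)%nat -> (n <= f2)%nat -> go f1 n = go f2 n).
{ induction f1 as [|f1 IH]; intros f2 m H1 H2.
  - replace m with 0%nat by lia; destruct f2; rewrite !Hgo; [reflexivity|].
    destruct (Nat.leb_spec (S N) 0); [lia | reflexivity].
  - rewrite (Hgo (S f1)), (Hgo f2); f_equal; destruct f2 as [|f2].
    + destruct (Nat.leb_spec (S N) m); [lia | reflexivity].
    + destruct (Nat.leb_spec (S N) m); [|reflexivity]; apply IH; lia. }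
rewrite Hgo; f_equal; destruct n as [|n]; [reflexivity|].
destruct (Nat.leb_spec (S N) (S n)); [|reflexivity]; apply Hfuel; lia.
Qed.

Lemma bounded_partitions_stable (N n : nat) : (n <= N)%nat ->
  bounded_partitions N n = bounded_partitions n n.
Proof.
intros H; induction H as [|N H IH]; [reflexivity|].
rewrite bounded_partitions_S; destruct (Nat.leb_spec (S N) n); lia.
Qed.

Lemma bounded_partitions_le (N n : nat) :
  (bounded_partitions N n <= bounded_partitions n n)%nat.
Proof.
assert (Hmono : forall M, (N <= M)%nat -> (bounded_partitions N n <= bounded_partitions M n)%nat).
{ intros M HM; induction HM as [|M HM IH]; [lia|].
  rewrite bounded_partitions_S; lia. }
destruct (Nat.le_gt_cases n N).
- rewrite bounded_partitions_stable by lia; lia.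
- apply Hmono; lia.
Qed.

Local Open Scope C_scope.

(** * Limits and partial sums of complex sequences *)

Definition clim (u : nat -> C) (l : C) : Prop :=
  is_lim_seq (fun n => Cmod (u n - l)) 0%R.

Lemma clim_squeeze (u : nat -> C) (l : C) (e : nat -> R) :
  (exists N, forall n, (N <= n)%nat -> (Cmod (u n - l) <= e n)%R) ->
  is_lim_seq e 0%R -> clim u l.
Proof.
intros [N Hu] He; apply (is_lim_seq_le_le_loc (fun _ => 0%R) _ e).
- exists N; intros n Hn; split; [apply Cmod_ge_0 | apply Hu, Hn].
- apply is_lim_seq_const.
- exact He.
Qed.

Lemma clim_const (c : C) : clim (fun _ => c) c.
Proof.
apply clim_squeeze with (fun _ => 0%R); [|apply is_lim_seq_const].
exists 0%nat; intros n _; replace (c - c) with (RtoC 0) by ring; rewrite Cmod_0; lra.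
Qed.

Lemma clim_plus (u v : nat -> C) (l m : C) :
  clim u l -> clim v m -> clim (fun n => u n + v n) (l + m).
Proof.
intros Hu Hv; apply clim_squeeze with (fun n => Cmod (u n - l) + Cmod (v n - m))%R.
- exists 0%nat; intros n _; replace (u n + v n - (l + m)) with ((u n - l) + (v n - m)) by ring.
  apply Cmod_triangle.
- replace (Finite 0) with (Rbar_plus 0 0) by (simpl; f_equal; ring).
  apply is_lim_seq_plus'; assumption.
Qed.

Lemma clim_mult (u v : nat -> C) (l m : C) :
  clim u l -> clim v m -> clim (fun n => u n * v n) (l * m).
Proof.
intros Hu Hv.
apply clim_squeeze with (fun n => Cmod (u n - l) * Cmod (v n - m) +
  (Cmod (u n - l) * Cmod m + Cmod l * Cmod (v n - m)))%R.
- exists 0%nat; intros n _.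
  replace (u n * v n - l * m)
    with ((u n - l) * (v n - m) + ((u n - l) * m + l * (v n - m))) by ring.
  eapply Rle_trans; [apply Cmod_triangle|]; rewrite Cmod_mult.
  apply Rplus_le_compat_l; eapply Rle_trans; [apply Cmod_triangle|].
  rewrite !Cmod_mult; apply Rle_refl.
- evar_last.
  + apply is_lim_seq_plus'; [apply is_lim_seq_mult'; eassumption|].
    apply is_lim_seq_plus'; apply is_lim_seq_mult';
      [eassumption | apply is_lim_seq_const | apply is_lim_seq_const | eassumption].
  + f_equal; ring.
Qed.

Lemma clim_ext (u v : nat -> C) (l : C) : (forall n, u n = v n) -> clim u l -> clim v l.
Proof.
intros H; apply is_lim_seq_ext; intros n; rewrite H; reflexivity.
Qed.

Lemma clim_shift (u : nat -> C) (l : C) (k : nat) : clim u l -> clim (fun n => u (n + k)%nat) l.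
Proof. intros H; apply (is_lim_seq_incr_n (fun n => Cmod (u n - l)) k), H. Qed.

Lemma Cmod_zero_eq (x y : C) : Cmod (x - y) = 0%R -> x = y.
Proof.
intros H; apply Cmod_eq_0 in H.
replace x with (x - y + y) by ring; rewrite H; ring.
Qed.

Lemma clim_unique (u : nat -> C) (l m : C) : clim u l -> clim u m -> l = m.
Proof.
intros Hl Hm; apply Cmod_zero_eq, Rle_antisym; [|apply Cmod_ge_0].
apply (is_lim_seq_le (fun _ => Cmod (l - m)) (fun n => Cmod (u n - l) + Cmod (u n - m))%R
  (Cmod (l - m)) 0%R).
- intros n; replace (l - m) with (- (u n - l) + (u n - m)) by ring.
  eapply Rle_trans; [apply Cmod_triangle|]; rewrite Cmod_opp; apply Rle_refl.
- apply is_lim_seq_const.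
- replace (Finite 0) with (Rbar_plus 0 0) by (simpl; f_equal; ring).
  apply is_lim_seq_plus'; assumption.
Qed.

Lemma clim_Cmod_le (u : nat -> C) (l : C) (B : R) :
  (exists N, forall n, (N <= n)%nat -> (Cmod (u n) <= B)%R) -> clim u l -> (Cmod l <= B)%R.
Proof.
intros [N HB] Hu; rewrite <- (Rplus_0_l B).
apply (is_lim_seq_le_loc (fun n => Cmod l) (fun n => Cmod (u n - l) + B)%R (Cmod l) (0 + B)%R).
- exists N; intros n Hn; replace l with (- (u n - l) + u n) at 1 by ring.
  eapply Rle_trans; [apply Cmod_triangle|]; rewrite Cmod_opp.
  apply Rplus_le_compat_l, HB, Hn.
- apply is_lim_seq_const.
- apply is_lim_seq_plus'; [exact Hu | apply is_lim_seq_const].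
Qed.

Fixpoint csum (u : nat -> C) (n : nat) : C :=
  match n with O => 0 | S m => csum u m + u m end.

Lemma csum_ext (u v : nat -> C) (n : nat) :
  (forall i, (i < n)%nat -> u i = v i) -> csum u n = csum v n.
Proof.
induction n as [|n IH]; intros H; simpl; [reflexivity|].
rewrite IH, H by (intros; try apply H; lia); reflexivity.
Qed.

Lemma csum_plus (u v : nat -> C) (n : nat) :
  csum (fun i => u i + v i) n = csum u n + csum v n.
Proof. induction n as [|n IH]; simpl; [ring | rewrite IH; ring]. Qed.

Lemma csum_shift (u : nat -> C) (q : C) (k M : nat) :
  csum (fun n => (if k <=? n then u (n - k)%nat else 0) * q ^ n) (M + k) =
  q ^ k * csum (fun n => u n * q ^ n) M.
Proof.
induction M as [|M IH]; simpl.
- transitivity (RtoC 0); [|ring].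
  assert (H : forall j, (j <= k)%nat ->
    csum (fun n => (if k <=? n then u (n - k)%nat else 0) * q ^ n) j = 0).
  { induction j as [|j IH]; intros Hj; simpl; [reflexivity|].
    rewrite IH by lia; destruct (Nat.leb_spec k j); [lia | ring]. }
  apply H; lia.
- rewrite IH, (proj2 (Nat.leb_le k (M + k))) by lia.
  replace (M + k - k)%nat with M by lia; rewrite Cpow_add_r; ring.
Qed.

Lemma csum_Cmod_diff (u : nat -> C) (b : nat -> R) (n m : nat) :
  (forall i, (Cmod (u i) <= b i)%R) -> (n <= m)%nat ->
  (Cmod (csum u m - csum u n) <= sum_n_m b n (pred m))%R.
Proof.
intros Hb Hnm; induction Hnm as [|m Hnm IH].
- replace (csum u n - csum u n) with (RtoC 0) by ring; rewrite Cmod_0.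
  destruct n as [|n]; simpl pred.
  + rewrite sum_n_n; pose proof (Hb 0%nat); pose proof (Cmod_ge_0 (u 0%nat)); lra.
  + rewrite sum_n_m_zero by lia; apply Rle_refl.
- simpl; replace (csum u m + u m - csum u n) with ((csum u m - csum u n) + u m) by ring.
  eapply Rle_trans; [apply Cmod_triangle|].
  destruct m as [|m].
  + simpl in *; replace n with 0%nat by lia; simpl.
    rewrite sum_n_n; replace (0 - 0) with (RtoC 0) by ring; rewrite Cmod_0, Rplus_0_l; apply Hb.
  + simpl pred in IH; destruct (Nat.eq_dec n (S m)) as [->|Hne].
    * replace (csum u (S m) - csum u (S m)) with (RtoC 0) by ring.
      rewrite Cmod_0, Rplus_0_l, sum_n_n; apply Hb.
    * rewrite sum_n_Sm by lia; apply Rplus_le_compat; [exact IH | apply Hb].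
Qed.

(** Real and imaginary parts are treated together, as additive functionals dominated by the
    modulus. *)
Lemma csum_converges (u : nat -> C) (b : nat -> R) :
  (forall i, (Cmod (u i) <= b i)%R) -> ex_series b -> exists l, clim (csum u) l.
Proof.
intros Hb Hs.
assert (Hcomp : forall f : C -> R, (forall z, Rabs (f z) <= Cmod z)%R ->
  (forall x y : C, f (x + y)%C = (f x + f y)%R) ->
  exists l : R, is_lim_seq (fun n => f (csum u n)) l).
{ intros f Hf Hadd.
  assert (Hex : ex_series (fun n => f (u n))).
  { apply (ex_series_le (K := R_AbsRing) (V := RC)) with b; [|exact Hs].
    intros n; eapply Rle_trans; [apply Hf | apply Hb]. }
  exists (Series (fun n => f (u n))).
  apply is_lim_seq_incr_1.
  apply is_lim_seq_ext with (sum_n (fun n => f (u n))).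
  - assert (Hf0 : f 0 = 0%R).
    { pose proof (Hf 0) as H0; rewrite Cmod_0 in H0; pose proof (Rabs_pos (f 0)).
      destruct (Req_dec (f 0) 0) as [|Hne]; [assumption|].
      pose proof (Rabs_pos_lt _ Hne); lra. }
    induction n as [|n IH]; [rewrite sum_O; simpl; rewrite Hadd, Hf0; ring|].
    rewrite sum_Sn, IH; simpl; rewrite (Hadd _ (u (S n))); reflexivity.
  - apply (Series_correct _ Hex). }
destruct (Hcomp fst) as [l1 H1].
{ intros z; eapply Rle_trans; [apply Rmax_l | apply Rmax_Cmod]. }
{ reflexivity. }
destruct (Hcomp snd) as [l2 H2].
{ intros z; eapply Rle_trans; [apply Rmax_r | apply Rmax_Cmod]. }
{ reflexivity. }
exists (l1, l2).
apply clim_squeeze with (fun n => sqrt 2 * (Rabs (fst (csum u n) - l1) + Rabs (snd (csum u n) - l2)))%R.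
- exists 0%nat; intros n _; eapply Rle_trans; [apply Cmod_2Rmax|].
  apply Rmult_le_compat_l; [apply sqrt_pos|]; simpl.
  change (fst (csum u n) + - l1)%R with (fst (csum u n) - l1)%R.
  change (snd (csum u n) + - l2)%R with (snd (csum u n) - l2)%R.
  apply Rmax_lub; pose proof (Rabs_pos (fst (csum u n) - l1));
    pose proof (Rabs_pos (snd (csum u n) - l2)); lra.
- assert (Habs : forall (v : nat -> R) (l : R), is_lim_seq v l -> is_lim_seq (fun n => Rabs (v n - l)) 0%R).
  { intros v l Hv; replace (Finite 0) with (Rbar_abs (Finite (l - l)))
      by (simpl; rewrite Rminus_diag, Rabs_R0; reflexivity).
    apply is_lim_seq_abs, is_lim_seq_minus'; [exact Hv | apply is_lim_seq_const]. }
  evar_last; [apply is_lim_seq_mult'; [apply is_lim_seq_const | apply is_lim_seq_plus'; apply Habs; eassumption]|].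
  f_equal; ring.
Qed.

Lemma csum_limit_dist (u : nat -> C) (b : nat -> R) (l : C) (n : nat) (e : R) :
  (forall i, (Cmod (u i) <= b i)%R) -> clim (csum u) l ->
  (forall m, (Rabs (sum_n_m b n m) <= e)%R) -> (Cmod (csum u n - l) <= e)%R.
Proof.
intros Hb Hl He.
apply (clim_Cmod_le (fun m => csum u n + -1 * csum u m)).
- exists n; intros m Hm; replace (csum u n + -1 * csum u m) with (- (csum u m - csum u n)) by ring.
  rewrite Cmod_opp; eapply Rle_trans; [apply csum_Cmod_diff with (b := b); assumption|].
  eapply Rle_trans; [apply Rle_abs | apply He].
- replace (csum u n - l) with (csum u n + -1 * l) by ring.
  apply clim_plus; [apply clim_const | apply clim_mult; [apply clim_const | exact Hl]].
Qed.

(** * Euler's product and Shanks' identity *)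

Fixpoint euler_prod (q : C) (n : nat) : C :=
  match n with O => 1 | S m => euler_prod q m * (1 - q ^ S m) end.

Definition bp_sum (N : nat) (q : C) (M : nat) : C :=
  csum (fun n => INR (bounded_partitions N n) * q ^ n) M.

Definition p_sum (q : C) (M : nat) : C :=
  csum (fun n => INR (bounded_partitions n n) * q ^ n) M.

(** Truncated form of (1 - q^(N+1)) B_(N+1) = B_N for the generating functions of partitions with
    bounded parts; the lengths of the truncations differ by the removed part N + 1. *)
Lemma bp_sum_S (N M : nat) (q : C) :
  bp_sum (S N) q (M + S N) = bp_sum N q (M + S N) + q ^ S N * bp_sum (S N) q M.
Proof.
unfold bp_sum; rewrite <- csum_shift, <- csum_plus; apply csum_ext; intros n _.
rewrite bounded_partitions_S.
destruct (S N <=? n); rewrite plus_INR, RtoC_plus; simpl INR; ring.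
Qed.

Lemma csum_RtoC_ge0 (u : nat -> R) (n m : nat) : (n <= m)%nat -> (forall i, 0 <= u i)%R ->
  exists a b, csum (fun i => RtoC (u i)) n = RtoC a /\ csum (fun i => RtoC (u i)) m = RtoC b /\
   (0 <= a <= b)%R.
Proof.
intros Hnm Hu; induction Hnm as [|m Hnm (a & b & Ha & Hb & Hab)].
- assert (H : exists a, csum (fun i => RtoC (u i)) n = RtoC a /\ (0 <= a)%R).
  { induction n as [|n (a & Ha & Ha0)]; [exists 0%R; split; [reflexivity | lra]|].
    exists (a + u n)%R; simpl; rewrite Ha, RtoC_plus; split; [reflexivity|].
    specialize (Hu n); lra. }
  destruct H as (a & Ha & Ha0); exists a, a; repeat split; auto; lra.
- exists a, (b + u m)%R; simpl; rewrite Hb, RtoC_plus; repeat split; auto; try lra.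
  specialize (Hu m); lra.
Qed.

Fixpoint euler_prod_R (r : R) (n : nat) : R :=
  match n with O => 1%R | S m => (euler_prod_R r m * (1 - r ^ S m))%R end.

Local Open Scope R_scope.

Lemma pow_unit (r : R) (n : nat) : 0 <= r < 1 -> 0 <= r ^ S n <= r.
Proof.
intros Hr; simpl; assert (0 <= r ^ n <= 1).
{ split; [apply pow_le; lra|]; rewrite <- (pow1 n); apply pow_incr; lra. }
split; [apply Rmult_le_pos; lra | nra].
Qed.

Lemma euler_prod_R_pos (r : R) (n : nat) : 0 <= r < 1 -> 0 < euler_prod_R r n.
Proof.
intros Hr; induction n as [|n IH]; cbn [euler_prod_R]; [lra|].
apply Rmult_lt_0_compat; [exact IH|]; pose proof (pow_unit r n Hr); lra.
Qed.

Lemma geom_partial (r : R) (n : nat) : 0 <= r < 1 -> r * (1 - r ^ n) / (1 - r) + r ^ S n = r * (1 - r ^ S n) / (1 - r).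
Proof. intros Hr; simpl; field; lra. Qed.

(** For x = r^k <= r, 1/(1 - x) = 1 + x/(1 - x) <= exp (x/(1 - r)), and these exponents add up to at
    most r/(1 - r)^2. *)
Lemma euler_prod_R_lower (r : R) : 0 <= r < 1 ->
  exists d, 0 < d /\ forall n, d <= euler_prod_R r n.
Proof.
intros Hr; exists (exp (- (r / (1 - r) / (1 - r)))); split; [apply exp_pos|]; intros n.
apply Rle_trans with (exp (- (r * (1 - r ^ n) / (1 - r) / (1 - r)))).
- apply exp_le, Ropp_le_contravar.
  assert (0 <= r ^ n) by (apply pow_le; lra).
  unfold Rdiv; repeat apply Rmult_le_compat_r;
    try (left; apply Rinv_0_lt_compat; lra); nra.
- induction n as [|n IH]; cbn [euler_prod_R].
  + simpl; replace (r * (1 - 1) / (1 - r) / (1 - r)) with 0 by (field; lra).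
    rewrite Ropp_0, exp_0; lra.
  + rewrite <- geom_partial by exact Hr.
    replace (- ((r * (1 - r ^ n) / (1 - r) + r ^ S n) / (1 - r)))
      with (- (r * (1 - r ^ n) / (1 - r) / (1 - r)) + - (r ^ S n / (1 - r))) by (field; lra).
    rewrite exp_plus; pose proof (pow_unit r n Hr) as Hx.
    apply Rmult_le_compat; [left; apply exp_pos .. | exact IH |].
    set (x := r ^ S n) in *.
    rewrite exp_Ropp; assert (H1 := exp_ineq1_le (x / (1 - r))).
    rewrite <- (Rinv_inv (1 - x)); apply Rinv_le_contravar; [apply Rinv_0_lt_compat; lra|].
    eapply Rle_trans; [|exact H1].
    replace (/ (1 - x)) with (1 + x / (1 - x)) by (field; lra).
    apply Rplus_le_compat_l; unfold Rdiv; apply Rmult_le_compat_l; [lra|].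
    apply Rinv_le_contravar; lra.
Qed.

(** All terms being nonnegative, 1 - r^(N+1) times a partial sum for N + 1 is at most a longer
    partial sum for N. The bound thus precedes convergence and yields it in
    [partitions_summable]. *)
Lemma bp_sum_bound (N M : nat) (r : R) : 0 <= r < 1 ->
  exists s, bp_sum N r M = RtoC s /\ 0 <= s /\ euler_prod_R r N * s <= 1.
Proof.
intros Hr.
assert (Hre : forall N M, exists a b, bp_sum N r M = RtoC a /\ bp_sum N r (M + N) = RtoC b /\ 0 <= a <= b).
{ intros n m; unfold bp_sum.
  destruct (csum_RtoC_ge0 (fun i => INR (bounded_partitions n i) * r ^ i) m (m + n))
    as (a & b & Ha & Hb & Hab); [lia | intros i; apply Rmult_le_pos; [apply pos_INR | apply pow_le; lra] |].
  exists a, b; rewrite <- Ha, <- Hb; repeat split; try lra; apply csum_ext; intros i _;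
    rewrite RtoC_mult, RtoC_pow; reflexivity. }
revert M; induction N as [|N IH]; intros M.
- destruct (Hre 0%nat M) as (a & _ & Ha & _ & Hab & _); exists a; split; [exact Ha|].
  split; [exact Hab|]; cbn [euler_prod_R]; rewrite Rmult_1_l.
  assert (Hs : forall m, bp_sum 0 r (S m) = RtoC 1).
  { induction m as [|m IHm]; unfold bp_sum in *.
    - simpl; ring.
    - change (csum (fun n => INR (bounded_partitions 0 n) * r ^ n) (S m) + RtoC (INR 0) * r ^ S m = 1)%C.
      rewrite IHm; simpl INR; ring. }
  destruct M as [|M].
  + unfold bp_sum in Ha; simpl in Ha; apply RtoC_inj in Ha; lra.
  + rewrite Hs in Ha; apply RtoC_inj in Ha; lra.
- destruct (Hre (S N) M) as (a & b & Ha & Hb & Hab); exists a; split; [exact Ha|]; split; [lra|].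
  destruct (IH (M + S N)%nat) as (s & Hs & Hs0 & Hs1).
  rewrite bp_sum_S, Hs, Ha, <- RtoC_pow, <- RtoC_mult, <- RtoC_plus in Hb.
  apply RtoC_inj in Hb; cbn [euler_prod_R].
  pose proof (euler_prod_R_pos r N Hr).
  rewrite Rmult_assoc, (Rmult_comm (1 - _)).
  eapply Rle_trans; [|exact Hs1]; apply Rmult_le_compat_l; lra.
Qed.

Lemma partitions_summable (r : R) : 0 <= r < 1 ->
  ex_series (fun n => INR (bounded_partitions n n) * r ^ n).
Proof.
intros Hr; destruct (euler_prod_R_lower r Hr) as (d & Hd & Hdn).
assert (Hpos : forall n, 0 <= INR (bounded_partitions n n) * r ^ n)
  by (intros n; apply Rmult_le_pos; [apply pos_INR | apply pow_le; lra]).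
destruct (ex_finite_lim_seq_incr (sum_n (fun n => INR (bounded_partitions n n) * r ^ n)) (/ d)) as [l Hl].
- intros n; rewrite sum_Sn; unfold plus; simpl; specialize (Hpos (S n)); simpl in Hpos; lra.
- intros n; destruct (bp_sum_bound (S n) (S n) r Hr) as (s & Hs & Hs0 & Hs1).
  assert (Heq : RtoC (sum_n (fun n => INR (bounded_partitions n n) * r ^ n) n) = bp_sum (S n) r (S n)).
  { transitivity (p_sum r (S n)).
    - unfold p_sum; clear s Hs Hs0 Hs1; induction n as [|n IH].
      + rewrite sum_O; simpl; rewrite RtoC_mult; ring.
      + rewrite sum_Sn.
        match goal with |- RtoC (plus ?a ?b) = _ => change (RtoC (a + b) = csum (fun n => INR (bounded_partitions n n) * r ^ n)%C (S n) + INR (bounded_partitions (S n) (S n)) * r ^ S n)%C end.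
        rewrite RtoC_plus, IH, RtoC_mult, RtoC_pow; reflexivity.
    - apply csum_ext; intros i Hi; rewrite (bounded_partitions_stable (S n)) by lia; reflexivity. }
  rewrite Hs in Heq; apply RtoC_inj in Heq; rewrite Heq.
  apply Rmult_le_reg_l with d; [exact Hd|]; rewrite Rinv_r by lra.
  eapply Rle_trans; [|exact Hs1]; apply Rmult_le_compat_r; auto.
- exists l; exact Hl.
Qed.

Lemma INR_nonneg_Cmod (n : nat) (q : C) (k : nat) : Cmod (INR n * q ^ k)%C = INR n * Cmod q ^ k.
Proof. rewrite Cmod_mult, Cmod_pow, Cmod_R, Rabs_pos_eq by apply pos_INR; reflexivity. Qed.

Lemma p_term_bound (r : R) (q : C) (n : nat) : Cmod q <= r ->
  Cmod (INR (bounded_partitions n n) * q ^ n)%C <= INR (bounded_partitions n n) * r ^ n.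
Proof.
intros Hq; rewrite INR_nonneg_Cmod; apply Rmult_le_compat_l; [apply pos_INR|].
apply pow_incr; split; [apply Cmod_ge_0 | exact Hq].
Qed.

Lemma bp_term_bound (r : R) (q : C) (N n : nat) : Cmod q <= r ->
  Cmod (INR (bounded_partitions N n) * q ^ n)%C <= INR (bounded_partitions n n) * r ^ n.
Proof.
intros Hq; rewrite INR_nonneg_Cmod; apply Rmult_le_compat; try apply pos_INR.
- apply pow_le, Cmod_ge_0.
- apply le_INR, bounded_partitions_le.
- apply pow_incr; split; [apply Cmod_ge_0 | exact Hq].
Qed.

Lemma bp_series_product (q : C) (N : nat) : Cmod q < 1 ->
  exists A, clim (bp_sum N q) A /\ (euler_prod q N * A = 1)%C.
Proof.
intros Hq; induction N as [|N (A & HA & HA1)].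
- exists (RtoC 1); split; [|simpl; ring].
  apply clim_squeeze with (fun _ => 0); [|apply is_lim_seq_const].
  exists 1%nat; intros [|n] Hn; [lia|]; right.
  replace (bp_sum 0 q (S n)) with (RtoC 1); [replace (1 - 1)%C with (RtoC 0) by ring; apply Cmod_0|].
  clear Hn; induction n as [|n IH].
  + unfold bp_sum; simpl; ring.
  + change (RtoC 1 = bp_sum 0 q (S n) + INR 0 * q ^ S n)%C; rewrite <- IH; simpl INR; ring.
- destruct (csum_converges (fun n => INR (bounded_partitions (S N) n) * q ^ n)%C
    (fun n => INR (bounded_partitions n n) * Cmod q ^ n)) as [B HB].
  { intros n; apply bp_term_bound; lra. }
  { apply partitions_summable; split; [apply Cmod_ge_0 | exact Hq]. }
  exists B; split; [exact HB|].
  assert (HBA : (B = A + q ^ S N * B)%C).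
  { apply (clim_unique (fun M => bp_sum (S N) q (M + S N)%nat)).
    - apply clim_shift, HB.
    - apply clim_ext with (fun M => bp_sum N q (M + S N)%nat + q ^ S N * bp_sum (S N) q M)%C.
      + intros M; symmetry; apply bp_sum_S.
      + apply clim_plus; [apply clim_shift, HA | apply clim_mult; [apply clim_const | exact HB]]. }
  cbn [euler_prod]; transitivity (euler_prod q N * A)%C; [|exact HA1].
  assert (HA' : (A = B - q ^ S N * B)%C).
  { transitivity (A + q ^ S N * B - q ^ S N * B)%C; [ring | rewrite <- HBA; reflexivity]. }
  rewrite HA'; ring.
Qed.

Lemma euler_prod_upper (q : C) : Cmod q < 1 ->
  exists K, 0 <= K /\ forall n, Cmod (euler_prod q n) <= K.
Proof.
intros Hq; pose proof (Cmod_ge_0 q) as Hq0.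
exists (exp (/ (1 - Cmod q))); split; [left; apply exp_pos|]; intros n.
assert (Hpow : forall m, 0 <= Cmod q ^ m) by (intros m; apply pow_le, Hq0).
apply Rle_trans with (exp ((1 - Cmod q ^ n) / (1 - Cmod q))).
- induction n as [|n IH].
  + simpl; rewrite Cmod_1; replace ((1 - 1) / (1 - Cmod q)) with 0 by (field; lra).
    rewrite exp_0; lra.
  + cbn [euler_prod]; rewrite Cmod_mult.
    replace ((1 - Cmod q ^ S n) / (1 - Cmod q))
      with ((1 - Cmod q ^ n) / (1 - Cmod q) + Cmod q ^ n) by (simpl; field; lra).
    rewrite exp_plus; apply Rmult_le_compat; try apply Cmod_ge_0; [exact IH|].
    eapply Rle_trans; [|apply exp_ineq1_le].
    unfold Cminus; eapply Rle_trans; [apply Cmod_triangle|].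
    rewrite Cmod_1, Cmod_opp, Cmod_pow; apply Rplus_le_compat_l; simpl.
    specialize (Hpow n); nra.
- apply exp_le; rewrite <- (Rmult_1_l (/ (1 - Cmod q))); unfold Rdiv.
  apply Rmult_le_compat_r; [left; apply Rinv_0_lt_compat; lra|].
  specialize (Hpow n); lra.
Qed.

(** [euler_prod q N] is the exact inverse of the series with parts at most N, which agrees with the
    full series up to q^N. The product with P misses 1 only by a bounded factor times two tails of
    the majorant. *)
Lemma partition_series (q : C) : Cmod q < 1 ->
  exists P, clim (p_sum q) P /\ clim (fun N => euler_prod q N * P)%C 1.
Proof.
intros Hq; pose proof (Cmod_ge_0 q) as Hq0.
assert (Hs := partitions_summable (Cmod q) (conj Hq0 Hq)).
set (b := fun n => INR (bounded_partitions n n) * Cmod q ^ n) in *.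
assert (Hb : forall n, Cmod (INR (bounded_partitions n n) * q ^ n)%C <= b n)
  by (intros n; apply p_term_bound; lra).
destruct (csum_converges _ b Hb Hs) as [P HP]; exists P; split; [exact HP|].
destruct (euler_prod_upper q Hq) as (K & HK0 & HK).
apply is_lim_seq_Reals; intros e He.
destruct (ex_series_tail b (e / (4 * (K + 1))) Hs) as [N0 HN0]; [apply Rdiv_lt_0_compat; lra|].
exists (S N0); intros N HN; unfold R_dist; rewrite Rminus_0_r, Rabs_pos_eq by apply Cmod_ge_0.
destruct (bp_series_product q N Hq) as (A & HA & HA1).
assert (HPd : (euler_prod q N * P - 1 = euler_prod q N * (P - A))%C) by (rewrite <- HA1 at 1; ring).
rewrite HPd.
rewrite Cmod_mult.
assert (HPA : Cmod (P - A)%C <= 2 * (e / (4 * (K + 1)))).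
{ replace (P - A)%C with (- (p_sum q N - P) + (bp_sum N q N - A))%C.
  - assert (HNN : N = S (pred N)) by lia.
    eapply Rle_trans; [apply Cmod_triangle|]; rewrite Cmod_opp.
    assert (H1 : Cmod (p_sum q N - P)%C <= e / (4 * (K + 1))).
    { apply csum_limit_dist with b; [exact Hb | exact HP |].
      intros m; rewrite HNN; apply HN0; lia. }
    assert (H2 : Cmod (bp_sum N q N - A)%C <= e / (4 * (K + 1))).
    { apply csum_limit_dist with b; [intros i; apply bp_term_bound; lra | exact HA |].
      intros m; rewrite HNN; apply HN0; lia. }
    lra.
  - replace (bp_sum N q N) with (p_sum q N); [ring|].
    apply csum_ext; intros i Hi; rewrite (bounded_partitions_stable N) by lia; reflexivity. }
apply Rle_lt_trans with (K * (2 * (e / (4 * (K + 1))))).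
- apply Rmult_le_compat; try apply Cmod_ge_0; [apply HK | exact HPA].
- apply Rmult_lt_reg_r with (4 * (K + 1)); [lra|].
  replace (K * (2 * (e / (4 * (K + 1)))) * (4 * (K + 1))) with (2 * K * e) by (field; lra).
  nra.
Qed.

(** Uniformity over |q| <= r allows the generating function to be replaced by one polynomial on the
    whole contour, so that only finite sums are integrated. *)
Lemma p_sum_uniform (r e : R) : 0 <= r < 1 -> 0 < e ->
  exists M0, forall M q P, (M0 <= M)%nat -> Cmod q <= r -> clim (p_sum q) P ->
  Cmod (p_sum q M - P)%C <= e.
Proof.
intros Hr He; destruct (ex_series_tail _ e (partitions_summable r Hr) He) as [N0 HN0].
exists (S N0); intros [|M] q P HM Hq HP; [lia|].
apply csum_limit_dist with (fun n => INR (bounded_partitions n n) * r ^ n).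
- intros i; apply p_term_bound, Hq.
- exact HP.
- intros m; apply HN0; lia.
Qed.

(** * Shanks' finite form of the pentagonal number theorem *)

Fixpoint tri (s : nat) : nat := match s with O => O | S k => (tri k + S k)%nat end.

Local Open Scope C_scope.

(** The exponents are the generalized pentagonal numbers k (3k - 1)/2 and k (3k + 1)/2, written as
    k^2 plus a triangular number. *)
Fixpoint pent_sum (q : C) (n : nat) : C :=
  match n with
  | O => 1
  | S m => pent_sum q m + (-1) ^ S m * (q ^ (S m * S m + tri m) + q ^ (S m * S m + tri (S m)))
  end.

(** Shanks' interpolation: the term s = 0 is the finite Euler product, every later term carries a
    factor q^n, and the full sum j = n + 1 is the truncated pentagonal series. *)
Definition shanks_sum (q : C) (n j : nat) : C :=
  csum (fun s => (-1) ^ s * (euler_prod q n / euler_prod q s) * q ^ (s * n + tri s)) j.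

Lemma one_minus_pow_neq_0 (q : C) (n : nat) : (Cmod q < 1)%R -> 1 - q ^ S n <> 0.
Proof.
intros Hq H.
assert (Hp : q ^ S n = 1) by (replace (q ^ S n) with (1 - (1 - q ^ S n)) by ring; rewrite H; ring).
assert (Hc : (Cmod (q ^ S n) = 1)%R) by (rewrite Hp; apply Cmod_1).
rewrite Cmod_pow in Hc; pose proof (pow_unit (Cmod q) n (conj (Cmod_ge_0 q) Hq)); lra.
Qed.

Lemma euler_prod_neq_0 (q : C) (n : nat) : (Cmod q < 1)%R -> euler_prod q n <> 0.
Proof.
intros Hq; induction n as [|n IH]; cbn [euler_prod].
- apply C1_nz.
- apply Cmult_neq_0; [exact IH | apply one_minus_pow_neq_0, Hq].
Qed.

(** The change caused by raising n telescopes in j to a single term. At j = n its exponent is (n +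
    1)^2 + n (n + 1)/2, the first of the two new pentagonal numbers; the second comes from the
    additional summand s = n + 1. *)
Lemma shanks_step (q : C) (n j : nat) : (Cmod q < 1)%R ->
  shanks_sum q (S n) (S j) - shanks_sum q n (S j) =
  - ((-1) ^ j * (euler_prod q n / euler_prod q j) * q ^ (S j * S n + tri j)).
Proof.
intros Hq; induction j as [|j IH].
- unfold shanks_sum; cbn [csum euler_prod tri].
  rewrite !Nat.add_0_r, Nat.mul_1_l; simpl (0 * _)%nat.
  simpl ((-1) ^ 0); simpl (q ^ 0); field; apply C1_nz.
- replace (shanks_sum q (S n) (S (S j)) - shanks_sum q n (S (S j)))
    with ((shanks_sum q (S n) (S j) - shanks_sum q n (S j))
      + ((-1) ^ S j * (euler_prod q (S n) / euler_prod q (S j)) * q ^ (S j * S n + tri (S j))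
       - (-1) ^ S j * (euler_prod q n / euler_prod q (S j)) * q ^ (S j * n + tri (S j))))
    by (unfold shanks_sum; cbn [csum]; ring).
  rewrite IH; clear IH; cbn [euler_prod].
  replace (S j * S n + tri (S j))%nat with ((S j * S n + tri j) + S j)%nat by (cbn [tri]; lia).
  replace (S j * n + tri (S j))%nat with (S j * S n + tri j)%nat by (cbn [tri]; lia).
  replace (S (S j) * S n + tri (S j))%nat with ((S j * S n + tri j) + S j + S n)%nat by (cbn [tri]; lia).
  set (e := (S j * S n + tri j)%nat); rewrite !Cpow_add_r.
  rewrite (Cpow_S (-1) j).
  assert (Hj := euler_prod_neq_0 q j Hq); assert (Hj1 := one_minus_pow_neq_0 q j Hq).
  generalize dependent (euler_prod q j); intros Dj HDj.
  generalize dependent (q ^ S j); intros Y HY.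
  set (X := q ^ e); set (Z := q ^ S n); set (D := euler_prod q n).
  set (sg := (-1) ^ j).
  clearbody X Z D sg; field; split; assumption.
Qed.

Lemma shanks_identity (q : C) (n : nat) : (Cmod q < 1)%R ->
  shanks_sum q n (S n) = pent_sum q n.
Proof.
intros Hq; induction n as [|n IH].
- unfold shanks_sum; simpl; field; apply C1_nz.
- assert (H := shanks_step q n n Hq).
  assert (E : shanks_sum q (S n) (S n) = pent_sum q n
    - (-1) ^ n * (euler_prod q n / euler_prod q n) * q ^ (S n * S n + tri n)).
  { rewrite <- IH; replace (shanks_sum q (S n) (S n))
      with (shanks_sum q (S n) (S n) - shanks_sum q n (S n) + shanks_sum q n (S n)) by ring.
    rewrite H; ring. }
  replace (shanks_sum q (S n) (S (S n))) with (shanks_sum q (S n) (S n)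
    + (-1) ^ S n * (euler_prod q (S n) / euler_prod q (S n)) * q ^ (S n * S n + tri (S n)))
    by reflexivity.
  rewrite E; cbn [pent_sum]; rewrite (Cpow_S (-1) n).
  field; split; apply euler_prod_neq_0, Hq.
Qed.

(** * The theta transformation *)

Local Open Scope R_scope.

(** The terms s >= 1 of Shanks' sum total at most (K/d) r^n/(1 - r), so the finite products and the
    truncated pentagonal series have the same limit. *)
Lemma pent_sum_limit (q : C) (L : C) : Cmod q < 1 ->
  clim (pent_sum q) L -> clim (euler_prod q) L.
Proof.
intros Hq HL; pose proof (Cmod_ge_0 q) as Hq0; set (r := Cmod q) in *.
destruct (euler_prod_R_lower r (conj Hq0 Hq)) as (d & Hd & Hdn).
(* A lower bound for the denominators: the quotients of Euler products in Shanks' sum are then at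
   most K/d. *)
assert (Hlow : forall n, euler_prod_R r n <= Cmod (euler_prod q n)).
{ induction n as [|n IH]; cbn [euler_prod_R euler_prod]; [rewrite Cmod_1; lra|].
  rewrite Cmod_mult; pose proof (pow_unit r n (conj Hq0 Hq)).
  apply Rmult_le_compat; [left; apply euler_prod_R_pos; lra | lra | exact IH |].
  unfold r; rewrite <- Cmod_pow, <- Cmod_1 at 1.
  pose proof (Cmod_triangle (1 - q ^ S n) (q ^ S n)) as Ht.
  replace (1 - q ^ S n + q ^ S n)%C with (RtoC 1) in Ht by ring; lra. }
destruct (euler_prod_upper q Hq) as (K & HK & HKn).
assert (Hdist : forall n, Cmod (euler_prod q n - pent_sum q n)%C <= K / d * (r ^ n / (1 - r))).
{ intros n; rewrite <- shanks_identity by exact Hq.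
  assert (Hj : forall j, Cmod (euler_prod q n - shanks_sum q n (S j))%C
     <= K / d * (r ^ n * (1 - r ^ j) / (1 - r))).
  { induction j as [|j IH].
    - unfold shanks_sum; simpl.
      replace (euler_prod q n - _)%C with (RtoC 0) by (field; apply C1_nz).
      rewrite Cmod_0; right; field; lra.
    - replace (euler_prod q n - shanks_sum q n (S (S j)))%C with
        (euler_prod q n - shanks_sum q n (S j) +
         - ((-1) ^ S j * (euler_prod q n / euler_prod q (S j)) * q ^ (S j * n + tri (S j))))%C
        by (unfold shanks_sum; cbn [csum]; ring).
      eapply Rle_trans; [apply Cmod_triangle|]; rewrite Cmod_opp.
      replace (K / d * (r ^ n * (1 - r ^ S j) / (1 - r)))
        with (K / d * (r ^ n * (1 - r ^ j) / (1 - r)) + K / d * (r ^ n * r ^ j))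
        by (simpl; field; lra).
      apply Rplus_le_compat; [exact IH|].
      rewrite !Cmod_mult, Cmod_div, !Cmod_pow by (apply euler_prod_neq_0, Hq).
      replace (Cmod (-1)) with 1 by (rewrite Cmod_R, Rabs_left; lra).
      rewrite pow1, Rmult_1_l; fold r.
      pose proof (Hlow (S j)); pose proof (Hdn (S j)).
      apply Rmult_le_compat.
      + apply Rdiv_le_0_compat; [apply Cmod_ge_0 | lra].
      + apply pow_le, Hq0.
      + apply Rmult_le_compat; [apply Cmod_ge_0 | left; apply Rinv_0_lt_compat; lra | apply HKn |].
        apply Rinv_le_contravar; lra.
      + rewrite <- pow_add.
        replace (S j * n + tri (S j))%nat with ((n + j) + (j * n + tri j + 1))%nat by (cbn [tri]; lia).
        rewrite (pow_add r (n + j)); assert (0 <= r ^ (n + j)) by (apply pow_le, Hq0).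
        assert (0 <= r ^ (j * n + tri j + 1) <= 1).
        { split; [apply pow_le, Hq0|]; rewrite <- (pow1 (j * n + tri j + 1)); apply pow_incr; lra. }
        nra. }
  eapply Rle_trans; [apply (Hj n)|].
  apply Rmult_le_compat_l; [apply Rdiv_le_0_compat; lra|].
  apply Rmult_le_compat_r; [left; apply Rinv_0_lt_compat; lra|]; nra. }
apply clim_ext with (fun n => (euler_prod q n - pent_sum q n) + pent_sum q n)%C; [intros; ring|].
replace L with (0 + L)%C by ring; apply clim_plus; [|exact HL].
apply clim_squeeze with (fun n => K / d * (r ^ n / (1 - r))).
- exists 0%nat; intros n _; replace (euler_prod q n - pent_sum q n - 0)%C
    with (euler_prod q n - pent_sum q n)%C by ring; apply Hdist.
- assert (Hg : is_lim_seq (fun n => r ^ n) 0) by (apply is_lim_seq_geom; rewrite Rabs_pos_eq; lra).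
  evar_last; [apply is_lim_seq_mult'; [apply is_lim_seq_const|];
    unfold Rdiv; apply is_lim_seq_mult'; [exact Hg | apply is_lim_seq_const]|].
  f_equal; ring.
Qed.

(** * The complex exponential and complex Gaussians *)

Definition cexp (z : C) : C := (exp (fst z) * cos (snd z), exp (fst z) * sin (snd z)).

Lemma cexp_plus (a b : C) : cexp (a + b)%C = (cexp a * cexp b)%C.
Proof.
destruct a as [a1 a2], b as [b1 b2]; unfold cexp, Cmult, Cplus; simpl.
rewrite exp_plus, cos_plus, sin_plus; f_equal; ring.
Qed.

Lemma cexp_0 : cexp 0 = RtoC 1.
Proof. unfold cexp, RtoC; simpl; rewrite exp_0, cos_0, sin_0; f_equal; ring. Qed.

Lemma cexp_neq_0 (z : C) : cexp z <> RtoC 0.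
Proof.
intros H; apply C1_nz; rewrite <- cexp_0; replace (RtoC 0) with (z + - z)%C by ring.
rewrite cexp_plus, H; ring.
Qed.

Lemma cexp_opp (z : C) : cexp (- z)%C = (/ cexp z)%C.
Proof.
transitivity (cexp (- z) * (cexp z * / cexp z))%C.
- rewrite Cinv_r by apply cexp_neq_0; ring.
- rewrite Cmult_assoc, <- cexp_plus.
  replace (- z + z)%C with (RtoC 0) by ring; rewrite cexp_0; ring.
Qed.

Lemma Cmod_cexp (z : C) : Cmod (cexp z) = exp (fst z).
Proof.
unfold Cmod, cexp; simpl.
replace (_ + _) with (exp (fst z) * exp (fst z) * ((sin (snd z))² + (cos (snd z))²))
  by (unfold Rsqr; ring).
rewrite sin2_cos2, Rmult_1_r, sqrt_square; [reflexivity | left; apply exp_pos].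
Qed.

Lemma cexp_pow (z : C) (n : nat) : (cexp z ^ n)%C = cexp (INR n * z)%C.
Proof.
induction n as [|n IH].
- simpl; replace (0 * z)%C with (RtoC 0) by ring; symmetry; apply cexp_0.
- rewrite Cpow_S, IH, <- cexp_plus, S_INR, RtoC_plus; f_equal; ring.
Qed.

Lemma cexp_R (x : R) : cexp x = RtoC (exp x).
Proof. unfold cexp, RtoC; simpl; rewrite cos_0, sin_0; f_equal; ring. Qed.

Lemma gauss_field_re (c m xi : C) :
  gauss_field (fst c) (snd c) (fst m) (snd m) (fst xi) (snd xi) = fst (c * m * cexp (- (xi * xi)))%C.
Proof.
destruct c as [c1 c2], m as [m1 m2], xi as [p q]; unfold gauss_field, cexp, Cmult, Copp; simpl.
replace (- (p * p - q * q)) with (q * q - p * p) by ring.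
replace (- (p * q + q * p)) with (- (2 * p * q)) by ring.
rewrite cos_neg, sin_neg; ring.
Qed.

(** The free factor c lets the real Poisson formula prove a complex one: c = 1 gives its real part
    and c = -i its imaginary part. *)
Definition gauss_re (c w : C) (u : R) : R := fst (c * cexp (- w * (u * u)%R))%C.

Lemma gauss_re_expand (c w : C) (u : R) : gauss_re c w u =
  exp (- (fst w * (u * u))) * (fst c * cos (snd w * (u * u)) + snd c * sin (snd w * (u * u))).
Proof.
destruct c as [c1 c2], w as [a b]; unfold gauss_re, cexp, Cmult, Copp, RtoC; simpl.
replace (- a * (u * u) - - b * 0) with (- (a * (u * u))) by ring.
replace (- a * 0 + - b * (u * u)) with (- (b * (u * u))) by ring.
rewrite cos_neg, sin_neg; ring.
Qed.

Lemma gauss_re_continuous (c w : C) : forall u, continuous (gauss_re c w) u.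
Proof.
intros u; apply continuous_ext with (fun u =>
  exp (- (fst w * (u * u))) * (fst c * cos (snd w * (u * u)) + snd c * sin (snd w * (u * u)))).
- intros x; symmetry; apply gauss_re_expand.
- revert u; cont.
Qed.

Lemma gauss_re_even (c w : C) (u : R) : gauss_re c w (- u) = gauss_re c w u.
Proof. unfold gauss_re; replace (- u * - u) with (u * u) by ring; reflexivity. Qed.

Lemma Rabs_fst_le (z : C) : Rabs (fst z) <= Cmod z.
Proof. eapply Rle_trans; [apply Rmax_l | apply Rmax_Cmod]. Qed.

Lemma Rabs_snd_le (z : C) : Rabs (snd z) <= Cmod z.
Proof. eapply Rle_trans; [apply Rmax_r | apply Rmax_Cmod]. Qed.

Lemma gauss_re_bound (c w : C) (u : R) : Rabs (gauss_re c w u) <= Cmod c * exp (- (fst w * (u * u))).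
Proof.
unfold gauss_re; eapply Rle_trans; [apply Rabs_fst_le|].
rewrite Cmod_mult, Cmod_cexp; right; f_equal; f_equal; destruct w; simpl; ring.
Qed.

Lemma pow_exp (x : R) (n : nat) : exp x ^ n = exp (INR n * x).
Proof.
induction n as [|n IH]; [simpl; rewrite Rmult_0_l, exp_0; reflexivity|].
rewrite <- tech_pow_Rmult, IH, <- exp_plus, S_INR; f_equal; ring.
Qed.

(** For |x| <= 1/2 both squares are at least (n + 1/2)^2 >= n, which makes the majorant
    geometric. *)
Lemma gauss_re_tail (c w : C) (n : nat) (x : R) : 0 < fst w -> Rabs x <= 1 / 2 ->
  Rabs (gauss_re c w (INR (S n) - x) + gauss_re c w (INR (S n) + x))
  <= 2 * Cmod c * exp (- fst w) ^ n.
Proof.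
intros Hw Hx; apply Rabs_le_between in Hx; pose proof (pos_INR n).
assert (H1 : forall y, Rabs y <= 1 / 2 ->
  Rabs (gauss_re c w (INR (S n) + y)) <= Cmod c * exp (- fst w) ^ n).
{ intros y Hy; apply Rabs_le_between in Hy.
  eapply Rle_trans; [apply gauss_re_bound|]; apply Rmult_le_compat_l; [apply Cmod_ge_0|].
  rewrite pow_exp; apply exp_le; rewrite S_INR.
  assert (INR n <= (INR n + 1 + y) * (INR n + 1 + y)) by nra; nra. }
eapply Rle_trans; [apply Rabs_triang|].
assert (A := H1 x ltac:(apply Rabs_le; lra)); assert (B := H1 (- x) ltac:(apply Rabs_le; lra)).
unfold Rminus; lra.
Qed.

(* The completed square: -w x^2 + i beta x = -(v x - i beta/(2v))^2 - beta^2/(4w), w = v^2. *)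
Lemma gauss_fourier_limit (c v : C) (beta kappa : R) :
  Cmod c <= 1 -> Rabs (snd v) < fst v ->
  (forall L, 1 <= L -> 0 <= kappa - RInt (fun x => exp (- (x * x))) 0 L <= exp (- L)) ->
  is_lim_seq (fun N => RInt (fun x => gauss_re (c * v)%C (v * v)%C x * cos (beta * x))
     (- (INR N + 1 / 2)) (INR N + 1 / 2))
   (2 * kappa * fst (c * cexp (- ((beta * beta)%R / (4 * (v * v)))))%C).
Proof.
intros Hc Hv Hk.
assert (Hv0 : v <> RtoC 0).
{ intros ->; simpl in Hv; rewrite Rabs_R0 in Hv; lra. }
set (E := cexp (- ((beta * beta)%R / (4 * (v * v))))%C).
(* The constant [E] is put into the coefficient of the homotopy: the start s = 0 is then the plain
   Gaussian times [fst d], and at the end s = 1 it cancels against the constant of the completed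
   square. *)
set (d := (c * E)%C).
set (e := (- (Ci * beta) / (2 * v))%C).
(* Re (1/v^2) has the sign of v1^2 - v2^2, which is positive in the cone. *)
assert (HE : Cmod E <= 1).
{ unfold E; rewrite Cmod_cexp, <- exp_0; apply exp_le.
  destruct v as [v1 v2]; simpl in Hv.
  assert (Hn : 0 < v1 * v1 - v2 * v2).
  { unfold Rabs in Hv; destruct (Rcase_abs v2); nra. }
  assert (HD : 0 < 16 * ((v1 * v1 - v2 * v2) * (v1 * v1 - v2 * v2) + 4 * (v1 * v2) * (v1 * v2))).
  { assert (0 <= (v1 * v2) * (v1 * v2)) by apply Rle_0_sqr.
    assert (0 < (v1 * v1 - v2 * v2) * (v1 * v1 - v2 * v2)) by (apply Rmult_lt_0_compat; exact Hn).
    lra. }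
  unfold Cdiv, Cinv, Cmult, Copp, RtoC; simpl.
  match goal with |- ?X <= 0 => replace X with (- (4 * (beta * beta) * (v1 * v1 - v2 * v2)
    / (16 * ((v1 * v1 - v2 * v2) * (v1 * v1 - v2 * v2) + 4 * (v1 * v2) * (v1 * v2))))) end.
  - apply Rge_le, Ropp_0_le_ge_contravar, Rdiv_le_0_compat; [|exact HD].
    assert (0 <= beta * beta) by apply Rle_0_sqr; nra.
  - field; split; nra. }
assert (Hd : Cmod d <= 1).
{ unfold d; rewrite Cmod_mult; pose proof (Cmod_ge_0 c); pose proof (Cmod_ge_0 E); nra. }
destruct (gauss_line_shift (fst d) (snd d) (fst v - 1) (snd v) (fst e) (snd e))
  as (K & X & HK & HX & HL).
{ eapply Rle_trans; [apply Rabs_fst_le | exact Hd]. }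
{ eapply Rle_trans; [apply Rabs_snd_le | exact Hd]. }
{ lra. }
assert (Hflow1 : forall L, RInt (homotopy_flow (fst d) (snd d) (fst v - 1) (snd v) (fst e) (snd e) 1) (- L) L
   = RInt (fun x => gauss_re (c * v)%C (v * v)%C x * cos (beta * x)) (- L) L :> R).
{ intros L.
  (* The contribution of i sin (beta x), an odd function of x, which integrates to 0. *)
  set (od := fun x => - (gauss_re (- Ci * (c * v))%C (v * v)%C x * sin (beta * x))).
  assert (Hg := gauss_re_continuous (c * v)%C (v * v)%C).
  assert (Hg' := gauss_re_continuous (- Ci * (c * v))%C (v * v)%C).
  assert (Hod : forall x, continuous od x) by (unfold od; cont).
  rewrite (RInt_Rext _ (fun x => gauss_re (c * v)%C (v * v)%C x * cos (beta * x) + od x)).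
  - rewrite RInt_Rplus by cont.
    rewrite (RInt_odd od); [ring | exact Hod |].
    intros x; unfold od; rewrite gauss_re_even, Ropp_mult_distr_r_reverse, sin_neg; ring.
  - intros x; unfold homotopy_flow.
    replace (1 + 1 * (fst v - 1)) with (fst v) by ring; rewrite !Rmult_1_l.
    transitivity (fst (d * v * cexp (- ((x * v + e) * (x * v + e))))%C).
    + rewrite <- gauss_field_re; f_equal; simpl; ring.
    + assert (Hsq : (- ((x * v + e) * (x * v + e)) =
        - - ((beta * beta)%R / (4 * (v * v))) + (- (v * v) * (x * x)%R + Ci * (beta * x)%R))%C).
      { unfold e; rewrite !RtoC_mult.
        transitivity (- (v * v) * (x * x) + Ci * (beta * x) - (Ci * Ci) * (beta * beta) / (4 * (v * v)))%C.
        - field; exact Hv0.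
        - replace (Ci * Ci)%C with (RtoC (-1)) by (unfold Ci, Cmult, RtoC; simpl; f_equal; ring).
          field; exact Hv0. }
      rewrite Hsq, !cexp_plus; unfold d.
      rewrite cexp_opp; fold E.
      replace (c * E * v * (/ E * (cexp (- (v * v) * (x * x)%R) * cexp (Ci * (beta * x)%R))))%C
        with (c * v * cexp (- (v * v) * (x * x)%R) * cexp (Ci * (beta * x)%R))%C
        by (field; apply cexp_neq_0).
      unfold od, gauss_re.
      replace (- Ci * (c * v) * cexp (- (v * v) * (x * x)%R))%C
        with (- Ci * (c * v * cexp (- (v * v) * (x * x)%R)))%C by ring.
      generalize (c * v * cexp (- (v * v) * (x * x)%R))%C; intros [g1 g2].
      unfold cexp, Ci, RtoC; simpl.
      replace (0 * (beta * x) - 1 * 0) with 0 by ring.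
      replace (0 * 0 + 1 * (beta * x)) with (beta * x) by ring.
      rewrite exp_0; ring. }
assert (Hflow0 : forall L, RInt (homotopy_flow (fst d) (snd d) (fst v - 1) (snd v) (fst e) (snd e) 0) (- L) L
   = 2 * fst d * RInt (fun x => exp (- (x * x))) 0 L :> R).
{ intros L.
  assert (Hg : forall x, continuous (fun x => exp (- (x * x))) x) by apply continuous_gauss.
  rewrite (RInt_Rext _ (fun x => fst d * exp (- (x * x)))).
  - rewrite RInt_Rscal by exact Hg.
    rewrite <- (RInt_Chasles (V := RC) _ (- L) 0 L) by apply ex_RInt_gauss.
    assert (Hhalf : RInt (fun x => exp (- (x * x))) (- L) 0 = RInt (fun x => exp (- (x * x))) 0 L :> R).
    { assert (H := RInt_comp_lin (V := RC) (fun x => exp (- (x * x))) (-1) 0 0 L).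
      replace (-1 * 0 + 0) with 0 in H by ring; replace (-1 * L + 0) with (- L) in H by ring.
      specialize (H (ex_RInt_gauss _ _)).
      rewrite <- (opp_RInt_swap (V := RC) _ (- L) 0) in H by apply ex_RInt_gauss.
      rewrite (RInt_Rext _ (fun x => -1 * exp (- (x * x)))) in H.
      - rewrite RInt_Rscal in H by exact Hg; unfold opp in H; simpl in H; lra.
      - intros x; change (-1 * exp (- ((-1 * x + 0) * (-1 * x + 0))) = -1 * exp (- (x * x))).
        f_equal; f_equal; ring. }
    rewrite Hhalf; unfold plus; simpl; ring.
  - intros x; unfold homotopy_flow, gauss_field.
    replace (2 * (x * (1 + 0 * (fst v - 1)) + 0 * fst e) * (x * (0 * snd v) + 0 * snd e)) with 0 by ring.
    rewrite cos_0, sin_0.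
    replace ((x * (0 * snd v) + 0 * snd e) * (x * (0 * snd v) + 0 * snd e)
      - (x * (1 + 0 * (fst v - 1)) + 0 * fst e) * (x * (1 + 0 * (fst v - 1)) + 0 * fst e))
      with (- (x * x)) by ring.
    ring. }
fold d; apply is_lim_seq_Reals; intros eps Heps.
set (B := K + 2 * Rabs (fst d) + 1).
assert (HB : 0 < B) by (unfold B; pose proof (Rabs_pos (fst d)); lra).
destruct (INR_unbounded (X + B / eps)) as [N HN].
exists N; intros n Hn; apply le_INR in Hn.
assert (HBe : 0 < B / eps) by (apply Rdiv_lt_0_compat; lra).
set (L := INR n + 1 / 2); assert (HLX : X + B / eps <= L) by (unfold L; lra).
specialize (HL L ltac:(lra)); rewrite Hflow1, Hflow0 in HL.
specialize (Hk L ltac:(lra)); unfold R_dist.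
assert (HeL : exp (- L) <= / L) by (apply exp_neg_le_inv; lra).
replace (RInt _ _ _ - 2 * kappa * fst d) with
  ((RInt (fun x => gauss_re (c * v)%C (v * v)%C x * cos (beta * x)) (- L) L
    - 2 * fst d * RInt (fun x => exp (- (x * x))) 0 L)
   + - (2 * fst d * (kappa - RInt (fun x => exp (- (x * x))) 0 L))) by (unfold L; ring).
eapply Rle_lt_trans; [apply Rabs_triang|].
rewrite Rabs_Ropp, !Rabs_mult, (Rabs_pos_eq 2), (Rabs_pos_eq (kappa - _)) by lra.
apply Rle_lt_trans with ((K + 2 * Rabs (fst d)) / L).
- unfold Rdiv at 1; rewrite Rmult_plus_distr_r; apply Rplus_le_compat; [exact HL|].
  apply Rmult_le_compat_l; [pose proof (Rabs_pos (fst d)); lra | lra].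
- apply Rmult_lt_reg_r with L; [lra|].
  replace ((K + 2 * Rabs (fst d)) / L * L) with (K + 2 * Rabs (fst d)) by (field; lra).
  assert (eps * (B / eps) = B) by (field; lra).
  assert (eps * (B / eps) <= eps * L) by (apply Rmult_le_compat_l; lra).
  unfold B in *; lra.
Qed.

Lemma tri_INR (s : nat) : INR (tri s) = INR s * (INR s + 1) / 2.
Proof.
induction s as [|s IH]; cbn [tri]; [simpl; field|].
rewrite plus_INR, IH, !S_INR; field.
Qed.

(* (3/2) (n -+ 1/6)^2 = n (3n -+ 1)/2 + 1/24 turns Euler's series into a Gaussian sum. *)
Lemma pent_sum_gauss (c w : C) (N : nat) :
  fst (c * cexp (- (w / 36)) * pent_sum (cexp (- (2 / 3 * w))) N)%C
  = alt_sum (gauss_re c w) N (1 / 6).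
Proof.
induction N as [|N IH].
- cbn [pent_sum alt_sum]; unfold gauss_re; f_equal; rewrite Cmult_1_r; f_equal; f_equal.
  rewrite RtoC_mult, RtoC_div by lra; field.
- cbn [pent_sum alt_sum]; rewrite <- IH.
  set (q := cexp (- (2 / 3 * w))%C).
  replace (c * cexp (- (w / 36)) * (pent_sum q N + (-1) ^ S N *
     (q ^ (S N * S N + tri N) + q ^ (S N * S N + tri (S N)))))%C
    with (c * cexp (- (w / 36)) * pent_sum q N + RtoC ((-1) ^ S N) *
     (c * (cexp (- (w / 36)) * q ^ (S N * S N + tri N))
       + c * (cexp (- (w / 36)) * q ^ (S N * S N + tri (S N)))))%C
    by (rewrite RtoC_pow; ring).
  assert (Hn : INR (S N) = INR N + 1) by apply S_INR.
  unfold q; rewrite !cexp_pow, <- !cexp_plus, !plus_INR, !mult_INR, !tri_INR, Hn.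
  assert (H1 : (- (w / 36) + ((INR N + 1) * (INR N + 1) + INR N * (INR N + 1) / 2)%R * - (2 / 3 * w)
    = - w * ((INR N + 1 - 1 / 6) * (INR N + 1 - 1 / 6))%R)%C).
  { destruct w as [a b]; unfold Cplus, Copp, Cmult, Cdiv, Cinv, RtoC; simpl; f_equal; field. }
  assert (H2 : (- (w / 36) + ((INR N + 1) * (INR N + 1) + (INR N + 1) * (INR N + 1 + 1) / 2)%R * - (2 / 3 * w)
    = - w * ((INR N + 1 + 1 / 6) * (INR N + 1 + 1 / 6))%R)%C).
  { destruct w as [a b]; unfold Cplus, Copp, Cmult, Cdiv, Cinv, RtoC; simpl; f_equal; field. }
  rewrite H1, H2; unfold gauss_re.
  generalize (c * cexp (- w * ((INR N + 1 - 1 / 6) * (INR N + 1 - 1 / 6))%R))%C.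
  generalize (c * cexp (- w * ((INR N + 1 + 1 / 6) * (INR N + 1 + 1 / 6))%R))%C.
  generalize (c * cexp (- (w / 36)) * pent_sum (cexp (- (2 / 3 * w))) N)%C.
  generalize ((-1) ^ S N); intros s [x1 x2] [y1 y2] [z1 z2].
  unfold Cplus, Cmult, RtoC; simpl; ring.
Qed.

Definition theta_term (w : C) (j : nat) : C :=
  (cos (half_freq j * (1 / 6)) * cexp (- ((half_freq j * half_freq j)%R / (4 * w))))%C.

(** (2j + 1)^2 >= 1 + 8j, with equality at j = 0 and j = 1, turns the Gaussian decay into a
    geometric one of ratio e^{-8 rho}. *)
Lemma theta_term_bound (w : C) (j : nat) : 0 <= fst (/ (4 * w))%C ->
  let rho := PI * PI * fst (/ (4 * w))%C in
  Cmod (cexp (- ((half_freq j * half_freq j)%R / (4 * w))))%C <= exp (- rho) * exp (- (8 * rho)) ^ j.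
Proof.
intros Hw rho; rewrite Cmod_cexp, pow_exp, <- exp_plus; apply exp_le.
unfold Cdiv; destruct (/ (4 * w))%C as [a b]; simpl in *.
unfold half_freq, rho.
assert (0 <= PI * PI) by apply Rle_0_sqr.
assert (Hj : INR j <= INR j * INR j).
{ destruct j as [|j]; [simpl; lra|]; rewrite S_INR; pose proof (pos_INR j); nra. }
assert (0 <= PI * PI * a * (4 * (INR j * INR j - INR j))).
{ apply Rmult_le_pos; [apply Rmult_le_pos; assumption | lra]. }
replace (- ((2 * INR j + 1) * PI * ((2 * INR j + 1) * PI) * a - 0 * b))
  with (- (PI * PI * a) + INR j * - (8 * (PI * PI * a)) - PI * PI * a * (4 * (INR j * INR j - INR j))) by ring.
lra.
Qed.

Lemma clim_components (u : nat -> C) :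
  is_lim_seq (fun n => fst (u n)) 0 -> is_lim_seq (fun n => snd (u n)) 0 -> clim u 0.
Proof.
intros H1 H2; apply clim_squeeze with (fun n => sqrt 2 * (Rabs (fst (u n)) + Rabs (snd (u n)))).
- exists 0%nat; intros n _; replace (u n - 0)%C with (u n) by ring.
  eapply Rle_trans; [apply Cmod_2Rmax|]; apply Rmult_le_compat_l; [apply sqrt_pos|].
  pose proof (Rabs_pos (fst (u n))); pose proof (Rabs_pos (snd (u n))).
  apply Rmax_lub; lra.
- apply (is_lim_seq_abs _ 0) in H1; apply (is_lim_seq_abs _ 0) in H2.
  simpl in H1, H2; rewrite Rabs_R0 in H1, H2.
  evar_last; [apply is_lim_seq_mult'; [apply is_lim_seq_const | apply is_lim_seq_plus'; eassumption]|].
  f_equal; ring.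
Qed.

Lemma ex_series_Rscal (c : R) (a : nat -> R) : ex_series a -> ex_series (fun n => c * a n).
Proof. intros H; apply (ex_series_scal_l (K := R_AbsRing) c a), H. Qed.

Lemma geom_series_exp (a : R) : 0 < a -> ex_series (fun n => exp (- a) ^ n).
Proof.
intros Ha; exists (/ (1 - exp (- a))); apply is_series_geom.
rewrite Rabs_pos_eq by (left; apply exp_pos); rewrite <- exp_0; apply exp_increasing; lra.
Qed.

Lemma inv_4w_pos (w : C) : 0 < fst w -> 0 < fst (/ (4 * w))%C.
Proof.
intros Hw; destruct w as [a b]; simpl in *.
apply Rdiv_lt_0_compat; [lra|].
assert (0 <= b * b) by apply Rle_0_sqr; nra.
Qed.

(** Poisson summation at x = 1/6 for the Gaussian with w = v^2, in the directions c = 1 and c = -i.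
    The 4 is the 2 of [cos_sum] times the 2 of the Fourier integral over both half-lines. *)
Lemma theta_transformation (v : C) (kappa : R) :
  Rabs (snd v) < fst v ->
  (forall L, 1 <= L -> 0 <= kappa - RInt (fun x => exp (- (x * x))) 0 L <= exp (- L)) ->
  exists Theta, clim (csum (theta_term (v * v))) Theta /\
  clim (pent_sum (cexp (- (2 / 3 * (v * v))))%C) (cexp (v * v / 36) / v * (4 * kappa * Theta))%C.
Proof.
intros Hv Hk; set (w := (v * v)%C).
assert (Hv0 : v <> RtoC 0) by (intros ->; simpl in Hv; rewrite Rabs_R0 in Hv; lra).
assert (Hw : 0 < fst w).
{ apply Rabs_lt_between in Hv.
  assert (H := Rmult_lt_0_compat (fst v + snd v) (fst v - snd v) ltac:(lra) ltac:(lra)).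
  unfold w; destruct v as [v1 v2]; simpl in *; lra. }
assert (Hw4 := inv_4w_pos w Hw).
set (rho := PI * PI * fst (/ (4 * w))%C).
assert (Hrho : 0 < rho) by
  (pose proof PI_RGT_0; apply Rmult_lt_0_compat; [apply Rmult_lt_0_compat; lra | exact Hw4]).
assert (Hb : forall j, Cmod (cexp (- ((half_freq j * half_freq j)%R / (4 * w))))%C
   <= exp (- rho) * exp (- (8 * rho)) ^ j) by (intros j; apply theta_term_bound; lra).
assert (Hser : ex_series (fun j => exp (- rho) * exp (- (8 * rho)) ^ j)).
{ apply ex_series_Rscal, geom_series_exp; lra. }
destruct (csum_converges (theta_term w) (fun j => exp (- rho) * exp (- (8 * rho)) ^ j)) as [Theta HTheta].
{ intros j; unfold theta_term; rewrite Cmod_mult, Cmod_R.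
  eapply Rle_trans; [|apply Hb].
  assert (Rabs (cos (half_freq j * (1 / 6))) <= 1) by (apply Rabs_le, COS_bound).
  pose proof (Cmod_ge_0 (cexp (- ((half_freq j * half_freq j)%R / (4 * w)))%C)).
  pose proof (Rabs_pos (cos (half_freq j * (1 / 6)))); nra. }
{ exact Hser. }
exists Theta; split; [exact HTheta|].
assert (Hdir : forall c, Cmod c <= 1 -> is_lim_seq (fun N =>
  fst (c * (v * cexp (- (w / 36)) * pent_sum (cexp (- (2 / 3 * w))) N - 4 * kappa * csum (theta_term w) N))%C) 0).
{ intros c Hc.
  set (I := fun j => 2 * kappa * fst (c * cexp (- ((half_freq j * half_freq j)%R / (4 * w))))%C).
  apply is_lim_seq_ext with (fun N => alt_sum (gauss_re (c * v) w) N (1 / 6) - cos_sum I N (1 / 6)).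
  - intros N.
    assert (HI : cos_sum I N (1 / 6) = fst (c * (4 * kappa * csum (theta_term w) N))%C).
    { induction N as [|N IH]; [simpl; ring|].
      cbn [cos_sum csum]; rewrite IH; unfold I, theta_term.
      generalize (csum (fun j => cos (half_freq j * (1 / 6)) * cexp (- ((half_freq j * half_freq j)%R / (4 * w))))%C N).
      generalize (cexp (- ((half_freq N * half_freq N)%R / (4 * w))))%C.
      destruct c as [c1 c2]; intros [e1 e2] [s1 s2]; unfold Cmult, Cplus, RtoC; simpl; ring. }
    rewrite HI, <- pent_sum_gauss.
    transitivity (fst (c * v * cexp (- (w / 36)) * pent_sum (cexp (- (2 / 3 * w))) N
       - c * (4 * kappa * csum (theta_term w) N))%C); [reflexivity|].
    f_equal; ring.
  - apply alternating_poisson with (b := fun n => 2 * Cmod (c * v)%C * exp (- fst w) ^ pred n).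
    + apply gauss_re_continuous.
    + apply gauss_re_even.
    + intros n x Hx; apply gauss_re_tail; assumption.
    + apply ex_series_incr_1; simpl.
      apply ex_series_Rscal, geom_series_exp, Hw.
    + intros j; apply gauss_fourier_limit; assumption.
    + apply (ex_series_le (K := R_AbsRing) (V := RC))
        with (fun j => Rabs (2 * kappa) * (exp (- rho) * exp (- (8 * rho)) ^ j)).
      * intros j; change (Rabs (Rabs (I j)) <= Rabs (2 * kappa) * (exp (- rho) * exp (- (8 * rho)) ^ j)).
        rewrite Rabs_Rabsolu; unfold I; rewrite Rabs_mult.
        apply Rmult_le_compat_l; [apply Rabs_pos|].
        eapply Rle_trans; [apply Rabs_fst_le|]; rewrite Cmod_mult.
        eapply Rle_trans; [|apply Hb].
        pose proof (Cmod_ge_0 (cexp (- ((half_freq j * half_freq j)%R / (4 * w)))%C)).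
        pose proof (Cmod_ge_0 c); nra.
      * apply ex_series_Rscal, Hser.
    + rewrite Rabs_pos_eq; lra. }
set (X := fun N => (v * cexp (- (w / 36)) * pent_sum (cexp (- (2 / 3 * w))) N - 4 * kappa * csum (theta_term w) N)%C).
assert (HX : clim X 0).
{ apply clim_components.
  - apply is_lim_seq_ext with (fun N => fst (1 * X N)%C).
    + intros N; f_equal; ring.
    + apply Hdir; rewrite Cmod_1; lra.
  - apply is_lim_seq_ext with (fun N => fst (- Ci * X N)%C).
    + intros N; destruct (X N) as [x y]; unfold Ci; simpl; ring.
    + apply Hdir; rewrite Cmod_opp, Cmod_Ci; lra. }
apply clim_ext with (fun N => cexp (w / 36) / v * (X N + 4 * kappa * csum (theta_term w) N))%C.
- intros N; unfold X; rewrite cexp_opp; field; split; [apply cexp_neq_0 | exact Hv0].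
- replace (4 * kappa * Theta)%C with (0 + 4 * kappa * Theta)%C by ring.
  apply clim_mult; [apply clim_const|]; apply clim_plus; [exact HX|].
  apply clim_mult; [apply clim_const | exact HTheta].
Qed.

(** * The generating function near the real axis *)

Lemma RtoC_neq_0 (x : R) : x <> 0 -> RtoC x <> RtoC 0.
Proof. intros H H0; apply H, RtoC_inj, H0. Qed.

Lemma cexp_Ci (x : R) : cexp (Ci * x)%C = (cos x, sin x).
Proof.
unfold cexp, Ci, Cmult, RtoC; simpl.
replace (0 * x - 1 * 0) with 0 by ring; replace (0 * 0 + 1 * x) with x by ring.
rewrite exp_0; f_equal; ring.
Qed.

Lemma theta_tail (w Theta : C) : 0 < fst w ->
  let rho := PI * PI * fst (/ (4 * w))%C in
  exp (- (8 * rho)) <= 1 / 2 -> clim (csum (theta_term w)) Theta ->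
  Cmod (Theta - theta_term w 0)%C <= 2 * (exp (- rho) * exp (- (8 * rho))).
Proof.
intros Hw rho Hx HT; set (x := exp (- (8 * rho))) in *.
assert (Hx0 : 0 < x) by apply exp_pos; assert (He : 0 < exp (- rho)) by apply exp_pos.
apply clim_Cmod_le with (fun N => csum (theta_term w) (N + 1) + - theta_term w 0)%C.
- exists 0%nat; intros N _.
  assert (H : Cmod (csum (theta_term w) (S N) + - theta_term w 0)%C
    <= exp (- rho) * (x * (1 - x ^ N) / (1 - x))).
  { induction N as [|N IH].
    - simpl; replace (0 + theta_term w 0 + - theta_term w 0)%C with (RtoC 0) by ring.
      rewrite Cmod_0; right; field; lra.
    - replace (csum (theta_term w) (S (S N)) + - theta_term w 0)%C
        with (csum (theta_term w) (S N) + - theta_term w 0 + theta_term w (S N))%C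
        by (cbn [csum]; ring).
      eapply Rle_trans; [apply Cmod_triangle|].
      replace (exp (- rho) * (x * (1 - x ^ S N) / (1 - x)))
        with (exp (- rho) * (x * (1 - x ^ N) / (1 - x)) + exp (- rho) * x ^ S N)
        by (simpl; field; lra).
      apply Rplus_le_compat; [exact IH|].
      unfold theta_term; rewrite Cmod_mult, Cmod_R.
      eapply Rle_trans; [|apply (theta_term_bound w (S N)); left; apply inv_4w_pos, Hw].
      assert (Rabs (cos (half_freq (S N) * (1 / 6))) <= 1) by (apply Rabs_le, COS_bound).
      pose proof (Cmod_ge_0 (cexp (- ((half_freq (S N) * half_freq (S N))%R / (4 * w)))%C)).
      pose proof (Rabs_pos (cos (half_freq (S N) * (1 / 6)))); nra. }
  rewrite Nat.add_1_r; eapply Rle_trans; [exact H|].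
  rewrite (Rmult_comm 2), Rmult_assoc; apply Rmult_le_compat_l; [lra|].
  assert (0 <= x ^ N) by (apply pow_le; lra).
  apply Rmult_le_reg_r with (1 - x); [lra|].
  replace (x * (1 - x ^ N) / (1 - x) * (1 - x)) with (x * (1 - x ^ N)) by (field; lra).
  nra.
- apply clim_plus; [apply (clim_shift _ _ 1), HT | apply clim_const].
Qed.

Definition polar (t th : R) : C := (t * cexp (Ci * th))%C.

Lemma polar_inv (t th : R) : 0 < t -> (/ polar t th = (/ t)%R * cexp (- (Ci * th)))%C.
Proof.
intros Ht; unfold polar; rewrite cexp_opp, RtoC_inv by lra.
field; split; [apply cexp_neq_0 | apply RtoC_neq_0; lra].
Qed.

(* The modular asymptotics of prod 1/(1 - q^k) at q = e^{-z}, z = t e^{i th}. *)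
Definition gf_main (C0 t th : R) : C :=
  (C0 * sqrt t * cexp (Ci * (th / 2)%R + ((PI * PI / 6)%R / polar t th - polar t th / 24)))%C.

(** The correction E multiplies P and not the main term because the theta series describes the Euler
    product, that is 1/P; E is this series divided by its first term. *)
Definition gf_asymptotic (C0 : R) : Prop := forall t th P,
  0 < t -> Rabs th < PI / 2 ->
  let rho := PI * PI * cos th / (6 * t) in
  exp (- (8 * rho)) <= 1 / 2 ->
  clim (p_sum (cexp (- polar t th)%C)) P ->
  exists E, Cmod (E - 1)%C <= 4 * exp (- (8 * rho)) /\ (P * E = gf_main C0 t th)%C.

Lemma gf_asymptotic_exists : exists C0, 0 < C0 /\ gf_asymptotic C0.
Proof.
destruct gauss_integral_limit as (kappa & Hkappa & Hk).
assert (Hcos6 : 1 / 2 <= cos (PI / 6)).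
{ rewrite <- cos_PI3; pose proof PI_RGT_0; left; apply cos_decreasing_1; lra. }
(* With kappa = sqrt pi/2 and cos (pi/6) = sqrt 3/2 this is the classical constant 1/sqrt (2 pi). *)
exists (sqrt (3 / 2) / (4 * kappa * cos (PI / 6))); split.
{ apply Rdiv_lt_0_compat; [apply sqrt_lt_R0; lra | apply Rmult_lt_0_compat; lra]. }
intros t th P Ht Hth rho Hrho HP.
(* A square root of 3z/2, so that e^{-2 v^2/3} = e^{-z}; the sector |th| < pi/2 for z is the cone
   |Im v| < Re v. *)
set (v := (sqrt (3 / 2 * t) * cexp (Ci * (th / 2)%R))%C).
assert (Hs : 0 < sqrt (3 / 2 * t)) by (apply sqrt_lt_R0; lra).
assert (Hvv : (v * v = (3 / 2)%R * polar t th)%C).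
{ unfold v, polar; transitivity (RtoC (sqrt (3 / 2 * t) * sqrt (3 / 2 * t)) * cexp (Ci * th))%C.
  - replace (Ci * th)%C with (Ci * (th / 2)%R + Ci * (th / 2)%R)%C.
    + rewrite cexp_plus, RtoC_mult; ring.
    + rewrite <- Cmult_plus_distr_l, <- RtoC_plus; do 2 f_equal; field.
  - rewrite sqrt_sqrt by lra; rewrite RtoC_mult; ring. }
apply Rabs_lt_between in Hth.
assert (Hcth : 0 < cos th) by (apply cos_gt_0; lra).
assert (Hv : Rabs (snd v) < fst v).
{ unfold v; rewrite cexp_Ci; simpl; rewrite !Rmult_0_l, Rminus_0_r, Rplus_0_r.
  rewrite Rabs_mult, (Rabs_pos_eq (sqrt _)) by lra; apply Rmult_lt_compat_l; [exact Hs|].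
  assert (Hc2 : 0 < cos (th / 2)) by (apply cos_gt_0; lra).
  assert (H2 : cos th = cos (th / 2) * cos (th / 2) - sin (th / 2) * sin (th / 2))
    by (rewrite <- cos_2a; f_equal; field).
  unfold Rabs; destruct (Rcase_abs (sin (th / 2))); nra. }
assert (Hfw : fst (v * v)%C = 3 / 2 * (t * cos th)).
{ rewrite Hvv; unfold polar; rewrite cexp_Ci; simpl; ring. }
assert (Hv0 : v <> RtoC 0) by (intros H0; rewrite H0 in Hv; simpl in Hv; rewrite Rabs_R0 in Hv; lra).
assert (Hpol0 : polar t th <> RtoC 0).
{ unfold polar; apply Cmult_neq_0; [apply RtoC_neq_0; lra | apply cexp_neq_0]. }
assert (Hw4 : fst (/ (4 * (v * v)))%C = cos th / (6 * t)).
{ rewrite Hvv; replace (/ (4 * ((3 / 2)%R * polar t th)))%C with ((/ 6)%R * / polar t th)%C.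
  - rewrite polar_inv, cexp_opp, cexp_Ci by exact Ht; unfold Cinv; simpl.
    replace (cos th * (cos th * 1) + sin th * (sin th * 1)) with (Rsqr (sin th) + Rsqr (cos th))
      by (unfold Rsqr; ring).
    rewrite sin2_cos2; field; lra.
  - rewrite RtoC_inv, RtoC_div by lra; field; exact Hpol0. }
destruct (theta_transformation v kappa Hv Hk) as (Theta & HT & Hpent).
assert (Hrho' : PI * PI * fst (/ (4 * (v * v)))%C = rho) by (rewrite Hw4; unfold rho; field; lra).
assert (Hfwpos : 0 < fst (v * v)%C) by (rewrite Hfw; nra).
assert (Htail := theta_tail (v * v)%C Theta Hfwpos); cbv zeta in Htail; rewrite Hrho' in Htail.
specialize (Htail Hrho HT).
replace (2 / 3 * (v * v))%C with (polar t th) in Hpent by (rewrite Hvv, RtoC_div by lra; field).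
assert (Hq : Cmod (cexp (- polar t th)%C) < 1).
{ rewrite Cmod_cexp, <- exp_0; apply exp_increasing; unfold polar; rewrite cexp_Ci; simpl.
  assert (0 < t * cos th) by (apply Rmult_lt_0_compat; lra); lra. }
assert (Heul := pent_sum_limit _ _ Hq Hpent).
destruct (partition_series _ Hq) as (P' & HP' & HP1).
rewrite (clim_unique _ _ _ HP' HP) in HP1; clear P' HP'.
assert (Hprod : (cexp (v * v / 36) / v * (4 * kappa * Theta) * P = 1)%C).
{ eapply clim_unique; [|exact HP1]; apply clim_mult; [exact Heul | apply clim_const]. }
set (a := ((PI * PI)%R / (4 * (v * v)))%C).
assert (Hterm : theta_term (v * v) 0 = (cos (PI / 6) * cexp (- a))%C).
{ unfold theta_term, a, half_freq; simpl INR.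
  replace ((2 * 0 + 1) * PI) with PI by ring; replace (PI * (1 / 6)) with (PI / 6) by field; reflexivity. }
assert (Hc6 : RtoC (cos (PI / 6)) <> RtoC 0) by (apply RtoC_neq_0; lra).
exists (Theta * cexp a / cos (PI / 6))%C; split.
- replace (Theta * cexp a / cos (PI / 6) - 1)%C
    with ((Theta - theta_term (v * v) 0) * (cexp a / cos (PI / 6)))%C.
  + rewrite Cmod_mult, Cmod_div, Cmod_R, (Rabs_pos_eq (cos _)), Cmod_cexp by (assumption || lra).
    assert (Ha : fst a = rho) by (unfold a, Cdiv; rewrite <- Hrho'; destruct (/ (4 * (v * v)))%C; simpl; ring).
    rewrite Ha; assert (H0 : 0 < exp rho) by apply exp_pos.
    apply Rle_trans with (2 * (exp (- rho) * exp (- (8 * rho))) * (exp rho / (1 / 2))).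
    * apply Rmult_le_compat; [apply Cmod_ge_0 | | exact Htail |].
      -- apply Rdiv_le_0_compat; lra.
      -- unfold Rdiv; apply Rmult_le_compat_l; [lra|]; apply Rinv_le_contravar; lra.
    * right; rewrite exp_Ropp; field; lra.
  + rewrite Hterm, cexp_opp; field; split; first [assumption | apply cexp_neq_0].
- assert (Hkc : RtoC kappa <> RtoC 0) by (apply RtoC_neq_0; lra).
  transitivity (P * (cexp (v * v / 36) / v * (4 * kappa * Theta)) *
    (v * cexp (- (v * v / 36)) * cexp a / (4 * kappa * cos (PI / 6))))%C.
  + rewrite cexp_opp; field; repeat split; try assumption; apply cexp_neq_0.
  + replace (P * (cexp (v * v / 36) / v * (4 * kappa * Theta)))%C with (RtoC 1)
      by (rewrite <- Hprod; ring).
    unfold gf_main.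
    replace (- (v * v / 36))%C with (- (polar t th / 24))%C by (rewrite Hvv, RtoC_div by lra; field).
    assert (Ha : a = ((PI * PI / 6)%R / polar t th)%C).
    { unfold a; rewrite Hvv, !RtoC_div by lra; field; exact Hpol0. }
    rewrite Ha; unfold v; replace (sqrt (3 / 2 * t)) with (sqrt (3 / 2) * sqrt t)
      by (symmetry; apply sqrt_mult; lra).
    assert (HC : RtoC (sqrt (3 / 2) / (4 * kappa * cos (PI / 6)))
      = (sqrt (3 / 2) / (4 * kappa * cos (PI / 6)))%C).
    { rewrite RtoC_div, !RtoC_mult; [reflexivity|]; apply Rgt_not_eq, Rmult_lt_0_compat; lra. }
    rewrite HC, RtoC_mult; unfold Cminus; rewrite !cexp_plus.
    field; split; assumption.
Qed.

(** * The minor arcs *)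

Lemma Cmod_sq (z : C) : Cmod z * Cmod z = fst z * fst z + snd z * snd z.
Proof.
unfold Cmod; rewrite sqrt_sqrt; [ring|].
pose proof (pow2_ge_0 (fst z)); pose proof (pow2_ge_0 (snd z)); lra.
Qed.

(* |1 - z|^2 = (1 - x)^2 + 2 d with x = |z|, d = x - Re z <= 2 x, while
   e^d <= (1 - d/2)^{-2} <= 1 + d / (1 - x)^2. *)
Lemma one_minus_lower (z : C) : Cmod z < 1 ->
  (1 - Cmod z) * exp ((Cmod z - fst z) / 2) <= Cmod (1 - z)%C.
Proof.
intros Hz; pose proof (Cmod_ge_0 z) as Hx0; set (x := Cmod z) in *.
set (d := x - fst z).
assert (Hre := Rabs_fst_le z); fold x in Hre; apply Rabs_le_between in Hre.
assert (Hd : 0 <= d <= 2 * x) by (unfold d; lra).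
assert (Hsq : Cmod (1 - z)%C * Cmod (1 - z)%C = (1 - x) * (1 - x) + 2 * d).
{ assert (H := Cmod_sq z); fold x in H; rewrite Cmod_sq.
  destruct z as [a b]; unfold d; simpl in *; lra. }
assert (Hinv : exp (d / 2) <= / (1 - d / 2)).
{ rewrite <- (Ropp_involutive (d / 2)) at 1; rewrite exp_Ropp.
  apply Rinv_le_contravar; [lra|]; pose proof (exp_ineq1_le (- (d / 2))); lra. }
assert (He : 0 < exp (d / 2)) by apply exp_pos.
assert (Hinv' : exp (d / 2) * (1 - d / 2) <= 1).
{ apply Rmult_le_compat_r with (r := 1 - d / 2) in Hinv; [|lra].
  rewrite Rinv_l in Hinv; lra. }
apply Rsqr_incr_0_var; [|apply Cmod_ge_0]; unfold Rsqr; rewrite Hsq.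
apply Rmult_le_reg_r with ((1 - d / 2) * (1 - d / 2)); [apply Rmult_lt_0_compat; lra|].
apply Rle_trans with ((1 - x) * (1 - x)).
- replace ((1 - x) * exp (d / 2) * ((1 - x) * exp (d / 2)) * ((1 - d / 2) * (1 - d / 2)))
    with ((1 - x) * (1 - x) * ((exp (d / 2) * (1 - d / 2)) * (exp (d / 2) * (1 - d / 2)))) by ring.
  assert (0 <= exp (d / 2) * (1 - d / 2)) by (apply Rmult_le_pos; lra).
  assert (0 <= (1 - x) * (1 - x)) by (apply Rmult_le_pos; lra).
  assert ((exp (d / 2) * (1 - d / 2)) * (exp (d / 2) * (1 - d / 2)) <= 1) by nra.
  nra.
- assert (0 <= (1 - x) * (1 - x) <= (1 - d / 2) * (1 - d / 2)).
  { split; [apply Rmult_le_pos; lra | apply Rmult_le_compat; lra]. }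
  assert (0 <= d * d) by (apply Rmult_le_pos; lra). nra.
Qed.

(** Closed form of the sum over k >= 1 of r^k - Re q^k, where |q| = r and v = 1 - cos (arg q). *)
Definition arc_gain (r v : R) : R := r * (1 + r) * v / ((1 - r) * ((1 - r) * (1 - r) + 2 * r * v)).

Lemma csum_geom (q : C) (N : nat) : (1 - q)%C <> 0 ->
  csum (fun k => q ^ S k)%C N = (q * (1 - q ^ N) / (1 - q))%C.
Proof.
intros Hq; induction N as [|N IH]; cbn [csum].
- simpl; field; exact Hq.
- rewrite IH, !Cpow_S; field; exact Hq.
Qed.

Lemma clim_pow (q : C) : Cmod q < 1 -> clim (fun N => q ^ N)%C 0.
Proof.
intros Hq; apply clim_squeeze with (fun N => Cmod q ^ N).
- exists 0%nat; intros n _; replace (q ^ n - 0)%C with (q ^ n)%C by ring; rewrite Cmod_pow; lra.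
- apply is_lim_seq_geom; rewrite Rabs_pos_eq; [exact Hq | apply Cmod_ge_0].
Qed.

Lemma one_minus_neq_0 (q : C) : Cmod q < 1 -> (1 - q)%C <> 0.
Proof.
intros Hq; assert (H := one_minus_pow_neq_0 q 0 Hq); rewrite Cpow_1_r in H; exact H.
Qed.

Lemma csum_geom_limit (q : C) : Cmod q < 1 -> clim (csum (fun k => q ^ S k)%C) (q / (1 - q))%C.
Proof.
intros Hq; assert (Hq1 := one_minus_neq_0 q Hq).
apply clim_ext with (fun N => q / (1 - q) * (1 + -1 * q ^ N))%C.
- intros N; rewrite csum_geom by exact Hq1; field; exact Hq1.
- assert (HL : clim (fun N => q / (1 - q) * (1 + -1 * q ^ N))%C (q / (1 - q) * (1 + -1 * 0))%C).
  { apply clim_mult; [apply clim_const|]; apply clim_plus; [apply clim_const|].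
    apply clim_mult; [apply clim_const | apply clim_pow, Hq]. }
  replace (q / (1 - q) * (1 + -1 * 0))%C with (q / (1 - q))%C in HL by (field; exact Hq1).
  exact HL.
Qed.

Lemma arc_gain_geom (x y : R) : 0 < x ->
  let r := exp (- x) in let q := cexp (- (x, y))%C in
  fst (r / (1 - r) - q / (1 - q))%C = arc_gain r (1 - cos y).
Proof.
intros Hx r q.
assert (Hr : 0 < r < 1).
{ unfold r; split; [apply exp_pos | rewrite <- exp_0; apply exp_increasing; lra]. }
assert (Hcs := sin2_cos2 y); unfold Rsqr in Hcs.
assert (Hc := COS_bound y).
assert (Hden : 0 < (1 - r) * (1 - r) + 2 * r * (1 - cos y)).
{ assert (0 < (1 - r) * (1 - r)) by (apply Rmult_lt_0_compat; lra).
  assert (0 <= r * (1 - cos y)) by (apply Rmult_le_pos; lra); lra. }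
assert (Hq : q = (r * cos y, - (r * sin y))).
{ unfold q, r, cexp; simpl; rewrite cos_neg, sin_neg; f_equal; ring. }
assert (Hfst : fst (q / (1 - q))%C = (r * cos y - r * r) / ((1 - r) * (1 - r) + 2 * r * (1 - cos y))).
{ rewrite Hq; unfold Cdiv, Cinv; simpl.
  set (c := cos y) in *; set (s := sin y) in *.
  replace ((1 + - (r * c)) * ((1 + - (r * c)) * 1) + (0 + - - (r * s)) * ((0 + - - (r * s)) * 1))
    with ((1 - r) * (1 - r) + 2 * r * (1 - c)).
  - set (D := (1 - r) * (1 - r) + 2 * r * (1 - c)) in *.
    replace (r * c - r * r) with (r * c - r * r * (s * s + c * c)) by (rewrite Hcs; ring).
    field; lra.
  - replace ((1 + - (r * c)) * ((1 + - (r * c)) * 1) + (0 + - - (r * s)) * ((0 + - - (r * s)) * 1))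
      with (1 - 2 * r * c + r * r * (s * s + c * c)) by ring.
    rewrite Hcs; ring. }
assert (Hr1 : (r / (1 - r))%C = RtoC (r / (1 - r))) by (rewrite RtoC_div, RtoC_minus by lra; reflexivity).
rewrite Hr1.
replace (fst (RtoC (r / (1 - r)) - q / (1 - q))%C) with (r / (1 - r) - fst (q / (1 - q))%C) by (simpl; ring).
rewrite Hfst; unfold arc_gain; field; split; lra.
Qed.

Lemma euler_prod_lower (q : C) (N : nat) : Cmod q < 1 ->
  Cmod (euler_prod (Cmod q) N) * exp (fst (csum (fun k => Cmod q ^ S k) N - csum (fun k => q ^ S k) N)%C / 2)
  <= Cmod (euler_prod q N).
Proof.
intros Hq; pose proof (Cmod_ge_0 q) as Hq0; set (r := Cmod q) in *.
induction N as [|N IH].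
- simpl; replace ((0 + - 0) / 2) with 0 by field; rewrite exp_0; lra.
- cbn [csum euler_prod]; rewrite !Cmod_mult.
  assert (Hp := pow_unit r N (conj Hq0 Hq)).
  assert (H1 : Cmod (1 - r ^ S N)%C = 1 - r ^ S N).
  { rewrite <- RtoC_pow, <- RtoC_minus, Cmod_R, Rabs_pos_eq; lra. }
  assert (H2 := one_minus_lower (q ^ S N)%C); rewrite Cmod_pow in H2; fold r in H2.
  specialize (H2 ltac:(lra)).
  replace (fst (csum (fun k => r ^ S k) N + r ^ S N - (csum (fun k => q ^ S k) N + q ^ S N))%C / 2)
    with (fst (csum (fun k => r ^ S k) N - csum (fun k => q ^ S k) N)%C / 2 + (r ^ S N - fst (q ^ S N)%C) / 2).
  + rewrite exp_plus, H1.
    set (e1 := exp (fst _ / 2)) in *.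
    replace (Cmod (euler_prod r N) * (1 - r ^ S N) * (e1 * exp ((r ^ S N - fst (q ^ S N)%C) / 2)))
      with ((Cmod (euler_prod r N) * e1) * ((1 - r ^ S N) * exp ((r ^ S N - fst (q ^ S N)%C) / 2))) by ring.
    apply Rmult_le_compat; [| | exact IH | exact H2].
    * apply Rmult_le_pos; [apply Cmod_ge_0 | left; apply exp_pos].
    * apply Rmult_le_pos; [lra | left; apply exp_pos].
  + rewrite <- RtoC_pow; generalize (r ^ S N); intros rN.
    generalize (csum (fun k => r ^ S k)%C N) (csum (fun k => q ^ S k)%C N) (q ^ S N)%C.
    intros [a1 a2] [b1 b2] [c1 c2]; simpl; field.
Qed.

Lemma clim_Cmod (u : nat -> C) (l : C) : clim u l -> is_lim_seq (fun n => Cmod (u n)) (Cmod l).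
Proof.
intros H; apply is_lim_seq_Reals; intros e He.
destruct (proj1 (is_lim_seq_Reals _ _) H e He) as [N HN]; exists N; intros n Hn.
specialize (HN n Hn); unfold R_dist in *; rewrite Rminus_0_r, Rabs_pos_eq in HN by apply Cmod_ge_0.
eapply Rle_lt_trans; [|exact HN]; apply Rabs_le; split.
- pose proof (Cmod_triangle (- (u n - l)) (u n)) as Ht; rewrite Cmod_opp in Ht.
  replace (- (u n - l) + u n)%C with l in Ht by ring; lra.
- pose proof (Cmod_triangle (u n - l) l) as Ht.
  replace (u n - l + l)%C with (u n) in Ht by ring; lra.
Qed.

Lemma clim_fst (u : nat -> C) (l : C) : clim u l -> is_lim_seq (fun n => fst (u n)) (fst l).
Proof.
intros H; apply is_lim_seq_Reals; intros e He.
destruct (proj1 (is_lim_seq_Reals _ _) H e He) as [N HN]; exists N; intros n Hn.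
specialize (HN n Hn); unfold R_dist in *; rewrite Rminus_0_r, Rabs_pos_eq in HN by apply Cmod_ge_0.
eapply Rle_lt_trans; [|exact HN].
exact (Rabs_fst_le (u n - l)%C).
Qed.

(** [one_minus_lower], multiplied over the powers q^k, compares the Euler products at q and at |q|;
    the exponents form geometric series, with total [arc_gain] / 2. *)
Lemma minor_arc_bound (x y : R) (Pr Pq : C) : 0 < x ->
  clim (p_sum (cexp (- (x, 0))%C)) Pr -> clim (p_sum (cexp (- (x, y))%C)) Pq ->
  Cmod Pq * exp (arc_gain (exp (- x)) (1 - cos y) / 2) <= Cmod Pr.
Proof.
intros Hx HPr HPq; set (q := cexp (- (x, y))%C) in *; set (r := exp (- x)).
assert (Hcq : Cmod q = r) by (unfold q; rewrite Cmod_cexp; reflexivity).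
assert (Hr : 0 < r < 1).
{ unfold r; split; [apply exp_pos | rewrite <- exp_0; apply exp_increasing; lra]. }
assert (Hrr : cexp (- (x, 0))%C = RtoC r).
{ unfold cexp; simpl; rewrite Ropp_0, cos_0, sin_0; unfold r, RtoC; f_equal; ring. }
rewrite Hrr in HPr.
assert (Hq1 : Cmod q < 1) by lra.
assert (Hr1 : Cmod (RtoC r) < 1) by (rewrite Cmod_R, Rabs_pos_eq; lra).
destruct (partition_series q Hq1) as (P1 & HP1 & HD1).
rewrite (clim_unique _ _ _ HP1 HPq) in HD1; clear P1 HP1.
destruct (partition_series (RtoC r) Hr1) as (P2 & HP2 & HD2).
rewrite (clim_unique _ _ _ HP2 HPr) in HD2; clear P2 HP2.
apply clim_Cmod in HD1; apply clim_Cmod in HD2; rewrite Cmod_1 in HD1, HD2.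
set (S := fun N => fst (csum (fun k => r ^ Datatypes.S k) N - csum (fun k => q ^ Datatypes.S k) N)%C).
assert (HS : is_lim_seq S (arc_gain r (1 - cos y))).
{ assert (HG := arc_gain_geom x y Hx); cbv zeta in HG; fold r q in HG.
  unfold S; rewrite <- HG.
  apply (clim_fst (fun N => csum (fun k => r ^ Datatypes.S k) N - csum (fun k => q ^ Datatypes.S k) N)%C).
  apply clim_ext with (fun N => csum (fun k => r ^ Datatypes.S k) N + -1 * csum (fun k => q ^ Datatypes.S k) N)%C;
    [intros; ring|].
  replace (r / (1 - r) - q / (1 - q))%C with (r / (1 - r) + -1 * (q / (1 - q)))%C by ring.
  apply clim_plus; [apply csum_geom_limit, Hr1 |
    apply clim_mult; [apply clim_const | apply csum_geom_limit, Hq1]]. }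
assert (HE : is_lim_seq (fun N => exp (S N / 2)) (exp (arc_gain r (1 - cos y) / 2))).
{ apply (is_lim_seq_continuous (fun s => exp (s / 2))); [|exact HS].
  apply continuity_pt_filterlim.
  apply (ex_derive_continuous (V := RN) (fun s => exp (s / 2))); auto_derive; exact I. }
rewrite <- (Rmult_1_l (Cmod Pr)).
rewrite <- (Rmult_1_l (Cmod Pq * _)).
apply (is_lim_seq_le
  (fun N => Cmod (euler_prod (RtoC r) N * Pr)%C * (Cmod Pq * exp (S N / 2)))
  (fun N => Cmod (euler_prod q N * Pq)%C * Cmod Pr)
  (1 * (Cmod Pq * exp (arc_gain r (1 - cos y) / 2))) (1 * Cmod Pr)).
- intros N; rewrite !Cmod_mult.
  assert (H := euler_prod_lower q N Hq1); rewrite Hcq in H; fold (S N) in H.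
  apply Rmult_le_compat_r with (r := Cmod Pr * Cmod Pq) in H;
    [|apply Rmult_le_pos; apply Cmod_ge_0].
  lra.
- apply is_lim_seq_mult'; [exact HD2|].
  apply is_lim_seq_mult'; [apply is_lim_seq_const | exact HE].
- apply is_lim_seq_mult'; [exact HD1 | apply is_lim_seq_const].
Qed.

(** * Extraction of the coefficients *)

(** On the arc dz = i z dth, and on the vertical segment dz = i dy. Both real integrands are
    therefore Re (e^{kz} dz/i), with primitive Im (e^{kz})/k, or Im z when k = 0. *)
Lemma is_RInt_arc_term (k t phi : R) :
  is_RInt (fun th => fst (polar t th * cexp (k * polar t th))%C) 0 phi
    (if Req_EM_T k 0 then t * sin phi else exp (k * (t * cos phi)) * sin (k * (t * sin phi)) / k).
Proof.
apply (is_RInt_ext (V := RN) (fun th => exp (k * (t * cos th)) *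
  (t * cos th * cos (k * (t * sin th)) - t * sin th * sin (k * (t * sin th))))).
{ intros th _; unfold polar; rewrite cexp_Ci; unfold cexp; simpl.
  replace (t * cos th - 0 * sin th) with (t * cos th) by ring.
  replace (t * sin th + 0 * cos th) with (t * sin th) by ring.
  replace (k * (t * cos th) - 0 * (t * sin th)) with (k * (t * cos th)) by ring.
  replace (k * (t * sin th) + 0 * (t * cos th)) with (k * (t * sin th)) by ring.
  ring. }
destruct (Req_EM_T k 0) as [->|Hk].
- replace (t * sin phi) with (minus (t * sin phi) (t * sin 0))
    by (rewrite sin_0; unfold minus, plus, opp; simpl; ring).
  apply (is_RInt_derive (V := RC) (fun th => t * sin th)); intros th _.
  + auto_derive; [exact I|].
    rewrite !Rmult_0_l, exp_0, cos_0, sin_0; ring.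
  + revert th; cont.
- replace (exp (k * (t * cos phi)) * sin (k * (t * sin phi)) / k)
    with (minus (exp (k * (t * cos phi)) * sin (k * (t * sin phi)) / k)
       (exp (k * (t * cos 0)) * sin (k * (t * sin 0)) / k))
    by (rewrite sin_0, Rmult_0_r, Rmult_0_r, sin_0; unfold minus, plus, opp; simpl; field; exact Hk).
  apply (is_RInt_derive (V := RC)
    (fun th => exp (k * (t * cos th)) * sin (k * (t * sin th)) / k)); intros th _.
  + auto_derive; [exact I | field; exact Hk].
  + revert th; cont.
Qed.

Lemma is_RInt_vert_term (k x a b : R) :
  is_RInt (fun y => fst (cexp (k * (x, y)))%C) a b
    (if Req_EM_T k 0 then b - a else exp (k * x) * sin (k * b) / k - exp (k * x) * sin (k * a) / k).
Proof.
apply (is_RInt_ext (V := RN) (fun y => exp (k * x) * cos (k * y))).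
{ intros y _; unfold cexp; simpl; f_equal; f_equal; ring. }
destruct (Req_EM_T k 0) as [->|Hk].
- apply (is_RInt_derive (V := RC) (fun y => y)); intros y _.
  + auto_derive; [exact I | rewrite !Rmult_0_l, exp_0, cos_0; ring].
  + revert y; cont.
- apply (is_RInt_derive (V := RC) (fun y => exp (k * x) * sin (k * y) / k)); intros y _.
  + auto_derive; [exact I | field; exact Hk].
  + revert y; cont.
Qed.

Definition arc_integrand (n : nat) (t : R) (M : nat) (th : R) : R :=
  fst (polar t th * (cexp (INR n * polar t th) * p_sum (cexp (- polar t th)) M))%C.

Definition vert_integrand (n : nat) (x : R) (M : nat) (y : R) : R :=
  fst (cexp (INR n * (x, y)) * p_sum (cexp (- (x, y))) M)%C.

Lemma sin_int_PI (n m : nat) : sin ((INR n - INR m) * PI) = 0.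
Proof.
apply sin_eq_0_1; exists (Z.of_nat n - Z.of_nat m)%Z.
rewrite minus_IZR, <- !INR_IZR_INZ; reflexivity.
Qed.

(* Cauchy's formula on the upper half of the contour, each term having an explicit primitive. *)
Lemma coefficient_extraction (n M : nat) (t phi : R) : (n < M)%nat ->
  exists A V, is_RInt (arc_integrand n t M) 0 phi A /\
  is_RInt (vert_integrand n (t * cos phi) M) (t * sin phi) PI V /\
  A + V = PI * INR (bounded_partitions n n).
Proof.
intros Hn.
assert (H : forall M, exists A V, is_RInt (arc_integrand n t M) 0 phi A /\
  is_RInt (vert_integrand n (t * cos phi) M) (t * sin phi) PI V /\
  A + V = if n <? M then PI * INR (bounded_partitions n n) else 0).
{ clear M Hn; induction M as [|M (A & V & HA & HV & HAV)].
  - exists 0, 0; split; [|split].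
    + apply (is_RInt_ext (V := RN) (fun _ => 0)).
      * intros th _; unfold arc_integrand, p_sum; cbn [csum].
        match goal with |- _ = fst ?z => replace z with (RtoC 0) by ring end; reflexivity.
      * evar_last; [apply (is_RInt_const (V := RN)) | apply Rmult_0_r].
    + apply (is_RInt_ext (V := RN) (fun _ => 0)).
      * intros th _; unfold vert_integrand, p_sum; cbn [csum].
        match goal with |- _ = fst ?z => replace z with (RtoC 0) by ring end; reflexivity.
      * evar_last; [apply (is_RInt_const (V := RN)) | apply Rmult_0_r].
    + simpl; ring.
  - set (k := INR n - INR M); set (p := INR (bounded_partitions M M)).
    assert (HI1 := is_RInt_arc_term k t phi).
    assert (HI2 := is_RInt_vert_term k (t * cos phi) (t * sin phi) PI).
    set (a := if Req_EM_T k 0 then _ else _) in HI1.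
    set (v := if Req_EM_T k 0 then _ else _) in HI2.
    exists (A + p * a), (V + p * v).
    assert (Hexp : forall z : C, (cexp (INR n * z) * cexp (- z) ^ M = cexp (k * z))%C).
    { intros z; rewrite cexp_pow, <- cexp_plus; f_equal; unfold k; rewrite RtoC_minus; ring. }
    split; [|split].
    + apply (is_RInt_ext (V := RN)
        (fun th => arc_integrand n t M th + p * fst (polar t th * cexp (k * polar t th))%C)).
      * intros th _; unfold arc_integrand, p_sum; cbn [csum]; rewrite <- Hexp; fold p.
        generalize (csum (fun n0 => INR (bounded_partitions n0 n0) * cexp (- polar t th) ^ n0)%C M).
        generalize (cexp (- polar t th) ^ M)%C (cexp (INR n * polar t th))%C (polar t th).
        intros [q1 q2] [e1 e2] [z1 z2] [s1 s2]; simpl; ring.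
      * apply (is_RInt_plus (V := RN)); [exact HA|].
        apply (is_RInt_scal (V := RN)), HI1.
    + apply (is_RInt_ext (V := RN)
        (fun y => vert_integrand n (t * cos phi) M y + p * fst (cexp (k * ((t * cos phi)%R, y)))%C)).
      * intros y _; unfold vert_integrand, p_sum; cbn [csum]; rewrite <- Hexp; fold p.
        set (z := ((t * cos phi)%R, y) : C).
        generalize (csum (fun n0 => INR (bounded_partitions n0 n0) * cexp (- z) ^ n0)%C M).
        generalize (cexp (- z) ^ M)%C (cexp (INR n * z))%C.
        intros [q1 q2] [e1 e2] [s1 s2]; simpl; ring.
      * apply (is_RInt_plus (V := RN)); [exact HV|].
        apply (is_RInt_scal (V := RN)), HI2.
    (* The two primitives agree at the corner t e^{i phi}; at the top y = pi there remains sin (k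
       pi) = 0, or the length pi when k = 0. *)
    + replace (A + p * a + (V + p * v)) with ((A + V) + p * (a + v)) by ring.
      rewrite HAV; unfold a, v; destruct (Req_EM_T k 0) as [Hk|Hk].
      * assert (HnM : n = M) by (apply INR_eq; unfold k in Hk; lra).
        rewrite (proj2 (Nat.ltb_ge n M)), (proj2 (Nat.ltb_lt n (S M))) by lia.
        unfold p; rewrite <- HnM; ring.
      * assert (HnM : n <> M) by (intros ->; apply Hk; unfold k; ring).
        replace (sin (k * PI)) with 0 by (symmetry; apply sin_int_PI).
        destruct (Nat.ltb_spec n M); destruct (Nat.ltb_spec n (S M)); try lia; field; exact Hk. }
destruct (H M) as (A & V & HA & HV & HAV); exists A, V.
rewrite (proj2 (Nat.ltb_lt n M)) in HAV by exact Hn; auto.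
Qed.

(** Before the minor-arc gain, the exponent on the segment exceeds the saddle value 2 lam by only
    lam/20 at this angle, and the gain of at least 0.056 lam covers it. The 3-4-5 triangle keeps the
    constants rational. *)
Lemma contour_angle : exists phi, 0 < phi < PI / 2 /\ cos phi = 4 / 5 /\ sin phi = 3 / 5.
Proof.
assert (Hc : cos (acos (4 / 5)) = 4 / 5) by (apply cos_acos; lra).
assert (Hs : sin (acos (4 / 5)) = 3 / 5).
{ rewrite sin_acos by lra; replace (1 - (4 / 5)²) with (3 / 5 * (3 / 5)) by (unfold Rsqr; field).
  apply sqrt_square; lra. }
exists (acos (4 / 5)); split; [|split; assumption].
destruct (acos_bound_lt (4 / 5)) as [H1 H2]; [lra|]; split; [exact H1|].
apply Rnot_le_lt; intros H3; assert (cos (acos (4 / 5)) <= 0); [|lra].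
apply cos_le_0; lra.
Qed.

Lemma inverse_near_one (E : C) : Cmod (E - 1)%C <= 1 / 2 -> 1 / 2 <= Cmod E /\ E <> RtoC 0.
Proof.
intros H; assert (H1 : 1 / 2 <= Cmod E).
{ pose proof (Cmod_triangle E (- (E - 1))) as Ht; rewrite Cmod_opp in Ht.
  replace (E + - (E - 1))%C with (RtoC 1) in Ht by ring; rewrite Cmod_1 in Ht; lra. }
split; [exact H1|]; intros ->; rewrite Cmod_0 in H1; lra.
Qed.

Lemma exp_neg_small (x : R) : 7 <= x -> 4 * exp (- x) <= 1 / 2.
Proof.
intros Hx; assert (H : exp (- x) <= / 8); [|lra].
rewrite exp_Ropp; apply Rinv_le_contravar; [lra|]; pose proof (exp_ineq1_le x); lra.
Qed.

(** The exponents add up to lam (e^{i th} + e^{-i th}). The factor e^{i th} of dz and the factor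
    e^{i th/2} of sqrt z make the phase 3 th/2. *)
Lemma arc_main_identity (C0 t th lam n : R) : 0 < t -> PI * PI / 6 = lam * t -> (n - 1 / 24) * t = lam ->
  (polar t th * (cexp (n * polar t th) * gf_main C0 t th) =
   (C0 * (t * sqrt t) * exp (2 * lam * cos th))%R * cexp (Ci * (3 / 2 * th)%R))%C.
Proof.
intros Ht Hlam Hn; unfold gf_main.
assert (Hexp : (Ci * th + (n * polar t th + (Ci * (th / 2)%R + ((PI * PI / 6)%R / polar t th - polar t th / 24)))
   = (2 * lam * cos th)%R + Ci * (3 / 2 * th)%R)%C).
{ unfold Cdiv at 1; rewrite polar_inv, cexp_opp, Hlam, <- Hn by exact Ht.
  unfold polar; rewrite cexp_Ci.
  assert (Hsc := sin2_cos2 th); unfold Rsqr in Hsc.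
  assert (Hi : (/ (cos th, sin th))%C = (cos th, - sin th)).
  { unfold Cinv; simpl; replace (cos th * (cos th * 1) + sin th * (sin th * 1)) with 1 by lra.
    f_equal; field. }
  rewrite Hi; unfold Ci, Cplus, Cminus, Cmult, Copp, Cdiv, Cinv, RtoC; simpl; f_equal; field; lra. }
transitivity (RtoC (C0 * (t * sqrt t)) * (cexp (Ci * th) * (cexp (n * polar t th)
   * cexp (Ci * (th / 2)%R + ((PI * PI / 6)%R / polar t th - polar t th / 24)))))%C.
- unfold polar at 1; rewrite !RtoC_mult; ring.
- rewrite <- !cexp_plus, Hexp, cexp_plus, cexp_R, (RtoC_mult (C0 * (t * sqrt t))); ring.
Qed.

(** The relative error is |1 - E|/|E| with |E| >= 1/2, hence at most 8 e^{-8 lam cos th}, which is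
    weakened to 8 e^{-lam}; the main term is bounded by its size at th = 0. *)
Lemma arc_pointwise (C0 t th lam : R) (n : nat) (P : C) :
  0 < C0 -> gf_asymptotic C0 -> 0 < t -> 2 <= lam -> PI * PI / 6 = lam * t ->
  (INR n - 1 / 24) * t = lam -> Rabs th < PI / 2 -> 4 / 5 <= cos th ->
  clim (p_sum (cexp (- polar t th)%C)) P ->
  Rabs (fst (polar t th * (cexp (INR n * polar t th) * P))%C
    - C0 * (t * sqrt t) * exp (2 * lam * cos th) * cos (3 / 2 * th))
  <= C0 * (t * sqrt t) * exp (2 * lam) * (8 * exp (- lam)).
Proof.
intros HC0 Hspec Ht Hlam Htl Hn Hth Hcos HP.
assert (Hrho : PI * PI * cos th / (6 * t) = lam * cos th).
{ replace (PI * PI * cos th / (6 * t)) with (PI * PI / 6 * cos th / t) by (field; lra).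
  rewrite Htl; field; lra. }
assert (Hl : 7 <= 8 * (lam * cos th)) by nra.
assert (Hsm := exp_neg_small _ Hl).
destruct (Hspec t th P Ht Hth) as (E & HE & HPE).
{ rewrite Hrho; pose proof (exp_pos (- (8 * (lam * cos th)))); lra. }
{ exact HP. }
rewrite Hrho in HE.
destruct (inverse_near_one E) as [HE1 HE0]; [lra|].
assert (Hst : 0 < C0 * (t * sqrt t)).
{ repeat apply Rmult_lt_0_compat; try assumption; apply sqrt_lt_R0, Ht. }
set (W := (polar t th * (cexp (INR n * polar t th) * gf_main C0 t th))%C).
assert (HW : W = ((C0 * (t * sqrt t) * exp (2 * lam * cos th))%R * cexp (Ci * (3 / 2 * th)%R))%C)
  by (apply arc_main_identity; assumption).
assert (HWfst : fst W = C0 * (t * sqrt t) * exp (2 * lam * cos th) * cos (3 / 2 * th)).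
{ rewrite HW, cexp_Ci; simpl; ring. }
assert (HWmod : Cmod W <= C0 * (t * sqrt t) * exp (2 * lam)).
{ rewrite HW, Cmod_mult, Cmod_R, Cmod_cexp; simpl.
  replace (0 * (3 / 2 * th) - 1 * 0) with 0 by ring; rewrite exp_0, Rmult_1_r.
  rewrite Rabs_pos_eq by (apply Rmult_le_pos; [lra | left; apply exp_pos]).
  apply Rmult_le_compat_l; [lra|]; apply exp_le; pose proof (COS_bound th); nra. }
rewrite <- HWfst.
set (Z := (polar t th * (cexp (INR n * polar t th) * P))%C).
assert (HZ : (Z - W = W * ((1 - E) / E))%C).
{ unfold W; rewrite <- HPE; unfold Z; field; exact HE0. }
apply Rle_trans with (Cmod (Z - W)%C); [exact (Rabs_fst_le (Z - W)%C)|].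
rewrite HZ, Cmod_mult; apply Rmult_le_compat; try apply Cmod_ge_0; [exact HWmod|].
rewrite Cmod_div by exact HE0.
replace (1 - E)%C with (- (E - 1))%C by ring; rewrite Cmod_opp.
apply Rmult_le_reg_r with (Cmod E); [lra|].
replace (Cmod (E - 1)%C / Cmod E * Cmod E) with (Cmod (E - 1)%C) by (field; lra).
assert (Hee : exp (- (8 * (lam * cos th))) <= exp (- lam)) by (apply exp_le; nra).
pose proof (exp_pos (- lam)); nra.
Qed.

(** 1 - cos a = 2 sin^2 (a/2), and sin (a/2) >= 0.95 a/2 while cos >= 0.95; the constant comes from
    2 (0.95/2)^2 > 0.45. *)
Lemma one_minus_cos_lower : exists d, 0 < d /\ forall a, 0 < a <= d -> 45 / 100 * (a * a) <= 1 - cos a.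
Proof.
assert (Hc : continuity_pt cos 0) by apply continuity_cos.
destruct (Hc (1 / 20) ltac:(lra)) as (d & Hd & Hnear).
exists (Rmin d 1); split; [apply Rmin_glb_lt; lra|]; intros a [Ha0 Ha].
pose proof (Rmin_l d 1); pose proof (Rmin_r d 1).
destruct (MVT_gen sin 0 (a / 2) cos) as (xi & Hxi & Heq).
- intros x _; auto_derive; [exact I | ring].
- intros x _; apply continuity_sin.
- rewrite Rmin_left, Rmax_right in Hxi by lra.
  rewrite sin_0, !Rminus_0_r in Heq.
  assert (Hcx : 95 / 100 <= cos xi).
  { destruct (Req_dec xi 0) as [->|Hne]; [rewrite cos_0; lra|].
    assert (HR : Rabs (cos xi - cos 0) < 1 / 20).
    { apply Hnear; split; [split; [exact I | auto] | unfold R_dist; simpl; unfold R_dist].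
      rewrite Rminus_0_r, Rabs_pos_eq; lra. }
    rewrite cos_0 in HR; apply Rabs_lt_between in HR; lra. }
  assert (Hs : 95 / 100 * (a / 2) <= sin (a / 2)) by (rewrite Heq; apply Rmult_le_compat_r; lra).
  assert (Hcos : cos a = 1 - 2 * sin (a / 2) * sin (a / 2)).
  { replace a with (2 * (a / 2)) at 1 by field; apply cos_2a_sin. }
  rewrite Hcos.
  assert (95 / 100 * (a / 2) * (95 / 100 * (a / 2)) <= sin (a / 2) * sin (a / 2))
    by (apply Rmult_le_compat; lra).
  assert (0 <= a * a) by nra. lra.
Qed.

(** The corner y = 3t/5 is the worst point: there v = 1 - cos y is at least 0.45 (9/25) t^2 = 0.162
    t^2. Since (1 - r)^2 <= 0.64 t^2 <= 3.96 v, the gain is at least 1.8/(0.8 t 5.96) > 0.3/t; t <=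
    1/25 ensures r (1 + r) >= 1.8. *)
Lemma arc_gain_lower : exists t0, 0 < t0 /\ forall t y, 0 < t <= t0 -> 3 / 5 * t <= y <= PI ->
  3 / 10 / t <= arc_gain (exp (- (4 / 5 * t))) (1 - cos y).
Proof.
destruct one_minus_cos_lower as (d & Hd & Hcos).
exists (Rmin d (1 / 25)); split; [apply Rmin_glb_lt; lra|].
intros t y [Ht0 Ht] Hy; pose proof (Rmin_l d (1 / 25)); pose proof (Rmin_r d (1 / 25)).
set (r := exp (- (4 / 5 * t))).
assert (Hr : 1 - 4 / 5 * t <= r < 1).
{ unfold r; split; [pose proof (exp_ineq1_le (- (4 / 5 * t))); lra|].
  rewrite <- exp_0; apply exp_increasing; lra. }
set (v := 1 - cos y); set (v0 := 162 / 1000 * (t * t)).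
assert (Htt : 0 < t * t) by (apply Rmult_lt_0_compat; lra).
assert (Hv : v0 <= v).
{ unfold v0, v; pose proof PI_RGT_0.
  assert (Hc1 := Hcos (3 / 5 * t) ltac:(lra)).
  assert (Hc2 : cos y <= cos (3 / 5 * t)) by (apply cos_decr_1; lra).
  lra. }
assert (Hv0 : 0 < v0) by (unfold v0; lra).
unfold arc_gain.
assert (Hden : 0 < (1 - r) * (1 - r) + 2 * r * v).
{ assert (0 < (1 - r) * (1 - r)) by (apply Rmult_lt_0_compat; lra).
  assert (0 <= r * v) by (apply Rmult_le_pos; lra). lra. }
assert (H1r : 0 < (1 - r) * ((1 - r) * (1 - r) + 2 * r * v)) by (apply Rmult_lt_0_compat; lra).
apply Rmult_le_reg_r with (t * ((1 - r) * ((1 - r) * (1 - r) + 2 * r * v))).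
{ apply Rmult_lt_0_compat; lra. }
replace (3 / 10 / t * (t * ((1 - r) * ((1 - r) * (1 - r) + 2 * r * v))))
  with (3 / 10 * ((1 - r) * ((1 - r) * (1 - r) + 2 * r * v))) by (field; lra).
replace (r * (1 + r) * v / ((1 - r) * ((1 - r) * (1 - r) + 2 * r * v))
  * (t * ((1 - r) * ((1 - r) * (1 - r) + 2 * r * v)))) with (t * (r * (1 + r) * v))
  by (field; split; lra).
assert (Hr2 : 18 / 10 <= r * (1 + r)) by nra.
assert (Hb : (1 - r) * (1 - r) + 2 * r * v <= 596 / 100 * v).
{ assert ((1 - r) * (1 - r) <= 4 / 5 * t * (4 / 5 * t)) by (apply Rmult_le_compat; lra).
  assert (r * v <= v) by nra. unfold v0 in *; lra. }
apply Rle_trans with (3 / 10 * (4 / 5 * t * (596 / 100 * v))).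
- apply Rmult_le_compat_l; [lra|]; apply Rmult_le_compat; lra.
- assert (0 <= t * v) by (apply Rmult_le_pos; lra).
  replace (t * (r * (1 + r) * v)) with (r * (1 + r) * (t * v)) by ring.
  nra.
Qed.

(* The exponent on the segment is (4/5 + 5/4) lam - 3/(20 t), and 1/t >= 3 lam / 8 because
   pi <= 4; this is below (2 - 1/200) lam. *)
Lemma vert_pointwise (C0 t lam y t0 : R) (n : nat) (P : C) :
  0 < C0 -> gf_asymptotic C0 -> 0 < t <= 1 -> t <= t0 -> 2 <= lam -> PI * PI / 6 = lam * t ->
  (INR n - 1 / 24) * t = lam -> 3 / 5 * t <= y <= PI ->
  (forall t y, 0 < t <= t0 -> 3 / 5 * t <= y <= PI ->
    3 / 10 / t <= arc_gain (exp (- (4 / 5 * t))) (1 - cos y)) ->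
  clim (p_sum (cexp (- ((4 / 5 * t)%R, y))%C)) P ->
  Cmod (cexp (INR n * ((4 / 5 * t)%R, y)) * P)%C <= 4 * C0 * sqrt t * exp ((2 - 1 / 200) * lam).
Proof.
intros HC0 Hspec Ht Htt0 Hlam Htl Hn Hy Hgain HP.
set (x := 4 / 5 * t) in *.
assert (Hx : 0 < x) by (unfold x; lra).
pose proof PI_RGT_0 as HPI; pose proof PI_4 as HPI4.
assert (Hpol : polar x 0 = (x, 0)).
{ unfold polar; rewrite cexp_Ci, cos_0, sin_0; unfold Cmult, RtoC; simpl; f_equal; ring. }
assert (Hq1 : Cmod (cexp (- polar x 0)%C) < 1).
{ rewrite Hpol, Cmod_cexp; simpl; rewrite <- exp_0; apply exp_increasing; lra. }
destruct (partition_series _ Hq1) as (Pr & HPr & _).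
assert (Hrho : PI * PI * cos 0 / (6 * x) = 5 / 4 * lam).
{ rewrite cos_0; unfold x; replace (PI * PI * 1 / (6 * (4 / 5 * t))) with (5 / 4 * (PI * PI / 6 / t))
    by (field; lra).
  rewrite Htl; field; lra. }
assert (Hsm := exp_neg_small (8 * (5 / 4 * lam)) ltac:(lra)).
destruct (Hspec x 0 Pr Hx) as (E & HE & HPE).
{ rewrite Rabs_R0; lra. }
{ rewrite Hrho; pose proof (exp_pos (- (8 * (5 / 4 * lam)))); lra. }
{ exact HPr. }
rewrite Hrho in HE; destruct (inverse_near_one E) as [HE1 HE0]; [lra|].
assert (HPrb : Cmod Pr <= 2 * (C0 * sqrt t * exp (5 / 4 * lam))).
{ assert (H : Cmod (gf_main C0 x 0) <= C0 * sqrt t * exp (5 / 4 * lam)).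
  { unfold gf_main; rewrite !Cmod_mult, !Cmod_R, Cmod_cexp.
    rewrite (Rabs_pos_eq C0), (Rabs_pos_eq (sqrt x)) by (try apply sqrt_pos; lra).
    apply Rmult_le_compat; [apply Rmult_le_pos; [lra | apply sqrt_pos] | left; apply exp_pos | |].
    - apply Rmult_le_compat_l; [lra|]; apply sqrt_le_1_alt; unfold x; lra.
    - apply exp_le; rewrite Hpol; unfold Ci, Cplus, Cminus, Cmult, Copp, Cdiv, Cinv, RtoC; simpl.
      replace (5 / 4 * lam) with (PI * PI / 6 / x) by (rewrite Htl; unfold x; field; lra).
      match goal with |- ?a <= _ => replace a with (PI * PI / 6 / x - x / 24) by (field; lra) end.
      lra. }
  rewrite <- HPE, Cmod_mult in H; pose proof (Cmod_ge_0 Pr); nra. }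
rewrite Hpol in HPr.
assert (Hmin := minor_arc_bound x y Pr P Hx HPr HP).
specialize (Hgain t y ltac:(lra) Hy); fold x in Hgain.
set (G := arc_gain (exp (- x)) (1 - cos y)) in *.
assert (Hlamt : 375 / 1000 * lam <= / t).
{ apply Rmult_le_reg_r with t; [lra|]; rewrite Rinv_l by lra.
  assert (PI * PI <= 4 * 4) by (apply Rmult_le_compat; lra). nra. }
assert (HGl : 5625 / 100000 * lam <= G / 2).
{ unfold Rdiv in Hgain at 1; lra. }
rewrite Cmod_mult, Cmod_cexp.
replace (fst (INR n * (x, y))%C) with (INR n * x) by (simpl; ring).
(* The shift by 1/24 leaves t/30 in the exponent, paid for by the factor e^{1/20} <= 2. *)
assert (Hnx : INR n * x <= 4 / 5 * lam + 1 / 20).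
{ unfold x; replace (INR n * (4 / 5 * t)) with (4 / 5 * ((INR n - 1 / 24) * t) + t / 30) by field.
  rewrite Hn; lra. }
assert (He20 : exp (1 / 20) <= 2).
{ rewrite <- (Ropp_involutive (1 / 20)), exp_Ropp, <- (Rinv_inv 2).
  apply Rinv_le_contravar; [lra|]; pose proof (exp_ineq1_le (- (1 / 20))); lra. }
assert (HPb : Cmod P <= Cmod Pr * exp (- (5625 / 100000 * lam))).
{ apply Rle_trans with (Cmod Pr * exp (- (G / 2))).
  - apply Rmult_le_reg_r with (exp (G / 2)); [apply exp_pos|].
    rewrite Rmult_assoc, <- exp_plus, Rplus_opp_l, exp_0, Rmult_1_r; exact Hmin.
  - apply Rmult_le_compat_l; [apply Cmod_ge_0 | apply exp_le; lra]. }
assert (Hs : 0 <= C0 * sqrt t) by (apply Rmult_le_pos; [lra | apply sqrt_pos]).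
apply Rle_trans with ((exp (4 / 5 * lam) * 2) * (2 * (C0 * sqrt t * exp (5 / 4 * lam)) * exp (- (5625 / 100000 * lam)))).
- apply Rmult_le_compat; [left; apply exp_pos | apply Cmod_ge_0 | |].
  + apply Rle_trans with (exp (4 / 5 * lam + 1 / 20)); [apply exp_le, Hnx|].
    rewrite exp_plus; apply Rmult_le_compat_l; [left; apply exp_pos | exact He20].
  + eapply Rle_trans; [exact HPb|]; apply Rmult_le_compat_r; [left; apply exp_pos | exact HPrb].
- replace (exp (4 / 5 * lam) * 2 * (2 * (C0 * sqrt t * exp (5 / 4 * lam)) * exp (- (5625 / 100000 * lam))))
    with (4 * C0 * sqrt t * (exp (4 / 5 * lam) * exp (5 / 4 * lam) * exp (- (5625 / 100000 * lam)))) by ring.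
  rewrite <- !exp_plus; apply Rmult_le_compat_l; [lra|]; apply exp_le; lra.
Qed.

(* u = sin (th/2) turns the contour integral into a Gaussian one, exactly. *)
Lemma arc_integral_gauss (lam phi : R) : 0 < lam ->
  RInt (fun th => exp (2 * lam * cos th) * cos (3 / 2 * th)) 0 phi =
  exp (2 * lam) * ((1 - / (2 * lam)) / sqrt lam *
      RInt (fun x => exp (- (x * x))) 0 (2 * sqrt lam * sin (phi / 2))
    + sin (phi / 2) * exp (- (4 * lam * (sin (phi / 2) * sin (phi / 2)))) / lam) :> R.
Proof.
intros Hlam; set (u0 := sin (phi / 2)).
assert (Hs : 0 < sqrt lam) by (apply sqrt_lt_R0, Hlam).
assert (Hss : sqrt lam * sqrt lam = lam) by (apply sqrt_sqrt; lra).
set (f := fun u => 2 * exp (2 * lam) * ((1 - 4 * (u * u)) * exp (- (4 * lam * (u * u))))).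
assert (Hf : forall u, continuous f u) by (unfold f; cont).
assert (H1 := RInt_comp (V := RC) f (fun th => sin (th / 2))
  (fun th => cos (th / 2) / 2) 0 phi (fun x _ => Hf (sin (x / 2)))).
assert (H1' : RInt (fun th => exp (2 * lam * cos th) * cos (3 / 2 * th)) 0 phi = RInt f 0 u0 :> R).
{ cbv beta in H1; replace (sin (0 / 2)) with 0 in H1
    by (unfold Rdiv; rewrite Rmult_0_l; symmetry; apply sin_0).
  unfold u0; rewrite <- H1.
  - apply RInt_Rext; intros th; change (exp (2 * lam * cos th) * cos (3 / 2 * th)
      = cos (th / 2) / 2 * f (sin (th / 2))); unfold f.
    assert (Hsc := sin2_cos2 (th / 2)); unfold Rsqr in Hsc.
    assert (Hc : cos th = 1 - 2 * (sin (th / 2) * sin (th / 2))).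
    { replace th with (2 * (th / 2)) at 1 by field; rewrite cos_2a_sin; ring. }
    (* The factor cos (th/2) is exactly what the differential of u = sin (th/2) consumes. *)
    assert (Hc3 : cos (3 / 2 * th) = cos (th / 2) * (1 - 4 * (sin (th / 2) * sin (th / 2)))).
    { replace (3 / 2 * th) with (2 * (th / 2) + th / 2) by field.
      rewrite cos_plus, cos_2a, sin_2a.
      replace (cos (th / 2) * cos (th / 2) - sin (th / 2) * sin (th / 2))
        with (1 - 2 * (sin (th / 2) * sin (th / 2))) by lra.
      ring. }
    rewrite Hc3, Hc.
    replace (2 * lam * (1 - 2 * (sin (th / 2) * sin (th / 2))))
      with (2 * lam + - (4 * lam * (sin (th / 2) * sin (th / 2)))) by ring.
    rewrite exp_plus; field.
  - intros x _; split; [auto_derive; [exact I | cbv beta; unfold Rdiv; ring]|].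
    apply (ex_derive_continuous (V := RN)); auto_derive; exact I. }
rewrite H1'.
(* Integration by parts reduces the u^2 part to the Gaussian and a boundary term; this is where 1 -
   1/(2 lam) comes from. *)
assert (Hprim : is_RInt (fun u => (1 - 4 * (u * u)) * exp (- (4 * lam * (u * u)))
    - (1 - / (2 * lam)) * exp (- (4 * lam * (u * u)))) 0 u0
    (u0 * exp (- (4 * lam * (u0 * u0))) / (2 * lam))).
{ evar_last.
  - apply (is_RInt_derive (V := RC) (fun u => u * exp (- (4 * lam * (u * u))) / (2 * lam))).
    + intros u _; auto_derive; [exact I | field; lra].
    + intros u _; revert u; cont.
  - unfold minus, plus, opp; simpl; field; lra. }
assert (Hscale : RInt (fun u => exp (- (4 * lam * (u * u)))) 0 u0
   = RInt (fun x => exp (- (x * x))) 0 (2 * sqrt lam * u0) / (2 * sqrt lam) :> R).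
{ assert (H := RInt_comp_lin (V := RC) (fun x => exp (- (x * x))) (2 * sqrt lam) 0 0 u0).
  replace (2 * sqrt lam * 0 + 0) with 0 in H by ring.
  replace (2 * sqrt lam * u0 + 0) with (2 * sqrt lam * u0) in H by ring.
  specialize (H (ex_RInt_gauss _ _)).
  rewrite (RInt_Rext _ (fun u => 2 * sqrt lam * exp (- (4 * lam * (u * u))))) in H.
  - rewrite RInt_Rscal in H by cont; rewrite <- H.
    assert (Hcancel : forall I s : R, s <> 0 -> I = s * I / s) by (intros; field; assumption).
    apply Hcancel; lra.
  - intros u; change (2 * sqrt lam * exp (- ((2 * sqrt lam * u + 0) * (2 * sqrt lam * u + 0)))
      = 2 * sqrt lam * exp (- (4 * lam * (u * u)))).
    do 3 f_equal; rewrite <- Hss at 3; ring. }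
assert (Hcf : forall u, continuous (fun u => (1 - 4 * (u * u)) * exp (- (4 * lam * (u * u)))) u) by cont.
apply (is_RInt_unique (V := RC)) in Hprim.
rewrite RInt_Rminus, RInt_Rscal, Hscale in Hprim by cont.
unfold f; rewrite RInt_Rscal by exact Hcf.
match type of Hprim with ?I - _ = _ => replace I with
  ((1 - / (2 * lam)) * (RInt (fun x => exp (- (x * x))) 0 (2 * sqrt lam * u0) / (2 * sqrt lam))
   + u0 * exp (- (4 * lam * (u0 * u0))) / (2 * lam)) by (rewrite <- Hprim; ring) end.
field; lra.
Qed.

(** On the contour the series is replaced by a partial sum, to which the exact coefficient formula
    applies, and the truncation error eps is removed at the end. The outer factors 2 and 4 bound the
    angle of the arc and the length of the segment. *)
Lemma contour_estimate (C0 t lam phi t0 : R) (n : nat) :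
  0 < C0 -> gf_asymptotic C0 -> 0 < t <= 1 -> t <= t0 -> 2 <= lam -> PI * PI / 6 = lam * t ->
  (INR n - 1 / 24) * t = lam ->
  (forall t y, 0 < t <= t0 -> 3 / 5 * t <= y <= PI ->
    3 / 10 / t <= arc_gain (exp (- (4 / 5 * t))) (1 - cos y)) ->
  0 < phi < PI / 2 -> cos phi = 4 / 5 -> sin phi = 3 / 5 ->
  Rabs (PI * INR (bounded_partitions n n) - C0 * (t * sqrt t) *
    RInt (fun th => exp (2 * lam * cos th) * cos (3 / 2 * th)) 0 phi)
  <= 2 * (C0 * (t * sqrt t) * exp (2 * lam) * (8 * exp (- lam)))
   + 4 * (4 * C0 * sqrt t * exp ((2 - 1 / 200) * lam)).
Proof.
intros HC0 Hspec Ht Htt0 Hlam Htl Hn Hgain Hphi Hcos Hsin.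
set (x := 4 / 5 * t); set (r := exp (- x)).
pose proof PI_RGT_0 as HPI; pose proof PI_4 as HPI4; pose proof PI2_3_2 as HPI3.
assert (Hx : 0 < x) by (unfold x; lra).
assert (Hr : 0 <= r < 1).
{ unfold r; split; [left; apply exp_pos | rewrite <- exp_0; apply exp_increasing; lra]. }
(* [K] bounds the weights z e^{nz} on the arc and e^{nz} on the segment that multiply the truncation
   error; the 6 in eps / (6 K) is 2 + 4. *)
set (K := t * exp (INR n * t) + exp (INR n * x)).
assert (HK : 0 < K).
{ unfold K; assert (0 < t * exp (INR n * t)) by (apply Rmult_lt_0_compat; [lra | apply exp_pos]).
  pose proof (exp_pos (INR n * x)); lra. }
apply le_epsilon; intros eps Heps.
destruct (p_sum_uniform r (eps / (6 * K)) Hr ltac:(apply Rdiv_lt_0_compat; lra)) as [M0 HM0].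
set (M := (M0 + S n)%nat).
destruct (coefficient_extraction n M t phi ltac:(unfold M; lia)) as (A & V & HA & HV & HAV).
rewrite Hcos, Hsin in HV; replace (t * (4 / 5)) with x in HV by (unfold x; ring).
assert (HKe : K * (eps / (6 * K)) = eps / 6) by (field; lra).
set (g := fun th => C0 * (t * sqrt t) * (exp (2 * lam * cos th) * cos (3 / 2 * th))).
assert (Hg : forall th, continuous g th) by (unfold g; cont).
assert (HgI : is_RInt g 0 phi (C0 * (t * sqrt t) * RInt (fun th => exp (2 * lam * cos th) * cos (3 / 2 * th)) 0 phi)).
{ unfold g at 1; rewrite <- RInt_Rscal by cont.
  apply (RInt_correct (V := RC) g), continuous_ex_RInt, Hg. }
set (B1 := C0 * (t * sqrt t) * exp (2 * lam) * (8 * exp (- lam))).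
set (B2 := 4 * C0 * sqrt t * exp ((2 - 1 / 200) * lam)).
assert (HB1 : 0 <= B1).
{ unfold B1; repeat apply Rmult_le_pos; try (left; apply exp_pos); try apply sqrt_pos; lra. }
assert (HB2 : 0 <= B2).
{ unfold B2; repeat apply Rmult_le_pos; try (left; apply exp_pos); try apply sqrt_pos; lra. }
assert (HAg : Rabs (A - C0 * (t * sqrt t) * RInt (fun th => exp (2 * lam * cos th) * cos (3 / 2 * th)) 0 phi)
   <= (phi - 0) * (B1 + eps / 6)).
{ apply (norm_RInt_le_const (V := RN) (fun th => arc_integrand n t M th - g th) 0 phi);
    [lra | | apply (is_RInt_minus (V := RN)); [exact HA | exact HgI]].
  intros th Hth; change (Rabs (arc_integrand n t M th - g th) <= B1 + eps / 6).
  assert (Hct : 4 / 5 <= cos th) by (rewrite <- Hcos; apply cos_decr_1; lra).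
  assert (Hq : Cmod (cexp (- polar t th)%C) <= r).
  { rewrite Cmod_cexp; unfold r, x, polar; rewrite cexp_Ci; apply exp_le; simpl; nra. }
  destruct (partition_series (cexp (- polar t th)%C)) as (P & HP & _); [lra|].
  assert (Htail := HM0 M _ P ltac:(unfold M; lia) Hq HP).
  assert (Hmain := arc_pointwise C0 t th lam n P HC0 Hspec ltac:(lra) Hlam Htl Hn
    ltac:(apply Rabs_def1; lra) Hct HP).
  unfold arc_integrand.
  set (z := polar t th) in *; set (sM := p_sum (cexp (- z)%C) M) in *.
  replace (fst (z * (cexp (INR n * z) * sM))%C - g th) with
    (fst (z * cexp (INR n * z) * (sM - P))%C
     + (fst (z * (cexp (INR n * z) * P))%C - C0 * (t * sqrt t) * exp (2 * lam * cos th) * cos (3 / 2 * th))).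
  - eapply Rle_trans; [apply Rabs_triang|]; rewrite Rplus_comm; apply Rplus_le_compat; [exact Hmain|].
    eapply Rle_trans; [apply Rabs_fst_le|]; rewrite Cmod_mult, <- HKe.
    apply Rmult_le_compat; try apply Cmod_ge_0; [|exact Htail].
    rewrite Cmod_mult, Cmod_cexp; unfold z, polar; rewrite Cmod_mult, Cmod_R, Rabs_pos_eq by lra.
    rewrite Cmod_cexp, cexp_Ci; simpl.
    replace (0 * th - 1 * 0) with 0 by ring; rewrite exp_0, Rmult_1_r.
    unfold K; assert (Hle : t * exp (INR n * (t * cos th - 0 * sin th) - 0 * (t * sin th + 0 * cos th)) <= t * exp (INR n * t)).
    { apply Rmult_le_compat_l; [lra|]; apply exp_le.
      pose proof (pos_INR n); pose proof (COS_bound th).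
      assert (t * cos th <= t) by nra. nra. }
    pose proof (exp_pos (INR n * x)); lra.
  - unfold g.
    replace (z * (cexp (INR n * z) * sM))%C with (z * cexp (INR n * z) * sM)%C by ring.
    replace (z * (cexp (INR n * z) * P))%C with (z * cexp (INR n * z) * P)%C by ring.
    generalize (z * cexp (INR n * z))%C; intros [a b]; destruct sM as [c d], P as [e f]; simpl; ring. }
assert (HVb : Rabs V <= (PI - t * (3 / 5)) * (B2 + eps / 6)).
{ apply (norm_RInt_le_const (V := RN) (vert_integrand n x M) (t * (3 / 5)) PI);
    [lra | | exact HV].
  intros y Hy; change (Rabs (vert_integrand n x M y) <= B2 + eps / 6).
  assert (Hq : Cmod (cexp (- (x, y))%C) <= r) by (rewrite Cmod_cexp; right; reflexivity).
  destruct (partition_series (cexp (- (x, y))%C)) as (P & HP & _); [lra|].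
  assert (Htail := HM0 M _ P ltac:(unfold M; lia) Hq HP).
  assert (Hmain := vert_pointwise C0 t lam y t0 n P HC0 Hspec Ht Htt0 Hlam Htl Hn ltac:(lra) Hgain HP).
  fold x in Hmain; fold B2 in Hmain.
  unfold vert_integrand; set (sM := p_sum (cexp (- (x, y))%C) M) in *.
  set (e := cexp (INR n * (x, y))%C) in *.
  eapply Rle_trans; [apply Rabs_fst_le|].
  replace (e * sM)%C with (e * P + e * (sM - P))%C by ring.
  eapply Rle_trans; [apply Cmod_triangle|]; apply Rplus_le_compat; [exact Hmain|].
  rewrite Cmod_mult, <- HKe; apply Rmult_le_compat; try apply Cmod_ge_0; [|exact Htail].
  unfold e; rewrite Cmod_cexp; simpl; rewrite Rmult_0_l, Rminus_0_r.
  unfold K; assert (0 < t * exp (INR n * t)) by (apply Rmult_lt_0_compat; [lra | apply exp_pos]); lra. }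
rewrite <- HAV.
match goal with |- Rabs (A + V - ?J) <= _ => replace (A + V - J) with ((A - J) + V) by ring end.
eapply Rle_trans; [apply Rabs_triang|].
assert ((phi - 0) * (B1 + eps / 6) <= 2 * (B1 + eps / 6)) by (apply Rmult_le_compat_r; lra).
assert ((PI - t * (3 / 5)) * (B2 + eps / 6) <= 4 * (B2 + eps / 6)) by (apply Rmult_le_compat_r; lra).
lra.
Qed.

(** * Asymptotics of log p(n) *)

(** The exponent sqrt lam comes from the tail e^{-L} of the Gaussian integral at L = 2 sqrt lam sin
    (phi/2). The contour errors and the boundary term are exponential in lam and are weakened to the
    same w. *)
Lemma partition_asymptotic : exists C2 B Lam, 0 < C2 /\ 0 < B /\ 2 <= Lam /\
  forall n lam, Lam <= lam -> INR n - 1 / 24 = 6 * (lam * lam) / (PI * PI) ->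
  Rabs (INR (bounded_partitions n n) * (lam * lam) * exp (- (2 * lam)) / C2 - (1 - / (2 * lam)))
  <= B * (lam * lam) * exp (- (/ 200 * sqrt lam)).
Proof.
destruct gf_asymptotic_exists as (C0 & HC0 & Hspec).
destruct gauss_integral_limit as (kappa & Hkappa & Hk).
destruct contour_angle as (phi & Hphi & Hcos & Hsin).
destruct arc_gain_lower as (t0 & Ht0 & Hgain).
pose proof PI_RGT_0 as HPI; pose proof PI2_3_2 as HPI3; pose proof PI_4 as HPI4.
set (a := PI * PI / 6).
assert (Ha : 3 / 2 <= a <= 3).
{ unfold a; assert (3 * 3 <= PI * PI) by (apply Rmult_le_compat; lra).
  assert (PI * PI <= 4 * 4) by (apply Rmult_le_compat; lra). lra. }
assert (Ha6 : PI * PI / 6 = a) by reflexivity; clearbody a.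
set (u0 := sin (phi / 2)).
(* sin^2 (phi/2) = (1 - 4/5)/2 = 1/10, just above (3/10)^2. *)
assert (Hu0 : 3 / 10 <= u0 <= 1).
{ assert (Hu : 0 <= u0) by (apply sin_ge_0; lra).
  assert (Hc : cos phi = 1 - 2 * u0 * u0).
  { replace phi with (2 * (phi / 2)) at 1 by field; apply cos_2a_sin. }
  split; [|apply SIN_bound].
  apply Rnot_lt_le; intros Hlt; assert (u0 * u0 < 3 / 10 * (3 / 10)) by nra; lra. }
assert (HC2 : 0 < C0 * (a * sqrt a) * kappa / PI).
{ assert (0 < sqrt a) by (apply sqrt_lt_R0; lra).
  apply Rdiv_lt_0_compat; [|lra]; repeat apply Rmult_lt_0_compat; lra. }
(* lam >= 9 gives 2 sqrt lam u0 >= 1, as the Gaussian tail requires, and lam >= 3/t0 gives t = a/lam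
   <= t0. Of the 40, 38 covers the contour error and 2 the Gaussian tail with its boundary term. *)
exists (C0 * (a * sqrt a) * kappa / PI), (40 / kappa), (9 + 3 / t0).
assert (0 < 3 / t0) by (apply Rdiv_lt_0_compat; lra).
split; [exact HC2|]; split; [apply Rdiv_lt_0_compat; lra|]; split; [lra|].
intros n lam Hlam Hn.
set (t := a / lam).
assert (Ht : 0 < t) by (apply Rdiv_lt_0_compat; lra).
assert (Htdef : t = a / lam) by reflexivity; clearbody t.
assert (Htl : a = lam * t) by (rewrite Htdef; field; lra).
assert (Ht1 : t <= 1).
{ apply Rmult_le_reg_r with lam; [lra|]; rewrite (Rmult_comm t), <- Htl; lra. }
assert (Htt0 : t <= t0).
{ apply Rmult_le_reg_r with lam; [lra|]; rewrite (Rmult_comm t), <- Htl.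
  assert (t0 * (3 / t0) = 3) by (field; lra). nra. }
assert (Hnt : (INR n - 1 / 24) * t = lam).
{ rewrite Hn, Htdef, <- Ha6; field; lra. }
assert (Hest := contour_estimate C0 t lam phi t0 n HC0 Hspec (conj Ht Ht1) Htt0 ltac:(lra) (eq_trans Ha6 Htl) Hnt
  Hgain Hphi Hcos Hsin).
rewrite arc_integral_gauss in Hest by lra; fold u0 in Hest.
set (s := sqrt lam) in *.
assert (Hss : s * s = lam) by (apply sqrt_sqrt; lra).
assert (Hs3 : 3 <= s).
{ unfold s; replace 3 with (sqrt (3 * 3)) by (apply sqrt_square; lra); apply sqrt_le_1_alt; lra. }
set (Igauss := RInt (fun x => exp (- (x * x))) 0 (2 * s * u0)) in *.
assert (HI := Hk (2 * s * u0) ltac:(nra)); fold Igauss in HI.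
set (w := exp (- (/ 200 * s))).
assert (Hw1 : exp (- (2 * s * u0)) <= w) by (apply exp_le; nra).
assert (Hw2 : exp (- (4 * lam * (u0 * u0))) <= w).
{ apply exp_le; assert (3 / 10 * (3 / 10) <= u0 * u0) by nra; rewrite <- Hss.
  assert (s * s * (u0 * u0) >= s * s * (9 / 100)) by nra. nra. }
assert (Hw3 : exp (- lam) <= w) by (apply exp_le; rewrite <- Hss; nra).
assert (Hw4 : exp (- (/ 200 * lam)) <= w) by (apply exp_le; rewrite <- Hss; nra).
assert (He2 : 0 < exp (2 * lam)) by apply exp_pos.
assert (Hst : 0 < sqrt t) by (apply sqrt_lt_R0, Ht).
assert (Hsqrt : t * sqrt t / s = a * sqrt a / (lam * lam)).
{ assert (Hsa : sqrt t = sqrt a / s) by (rewrite Htdef; apply sqrt_div; lra).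
  rewrite Hsa, Htdef, <- Hss; field; lra. }
set (Sc := C0 * (t * sqrt t) * kappa * exp (2 * lam) / s).
assert (HSc : 0 < Sc) by (unfold Sc; apply Rdiv_lt_0_compat; [|lra]; repeat apply Rmult_lt_0_compat; lra).
set (p := INR (bounded_partitions n n)) in *.
assert (Hratio : p * (lam * lam) * exp (- (2 * lam)) / (C0 * (a * sqrt a) * kappa / PI) = PI * p / Sc).
{ unfold Sc; replace (C0 * (t * sqrt t) * kappa * exp (2 * lam) / s)
    with (C0 * (t * sqrt t / s) * kappa * exp (2 * lam)) by (field; lra).
  rewrite Hsqrt, exp_Ropp; assert (0 < sqrt a) by (apply sqrt_lt_R0; lra).
  field; repeat split; lra. }
rewrite Hratio; clear Hratio.
set (h := 1 - / (2 * lam)).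
assert (Hh : 0 <= h <= 1).
{ unfold h; assert (0 < / (2 * lam)) by (apply Rinv_0_lt_compat; lra).
  assert (/ (2 * lam) <= / 1) by (apply Rinv_le_contravar; lra). rewrite Rinv_1 in *; lra. }
fold h in Hest.
match type of Hest with Rabs (_ - ?J) <= ?E => set (main := J) in Hest; set (err := E) in Hest end.
assert (Hmain : main / Sc - h = - (h * (kappa - Igauss) / kappa)
  + u0 * exp (- (4 * lam * (u0 * u0))) / (s * kappa)).
{ unfold main, Sc; generalize He2; generalize (exp (2 * lam)); intros e2 He2'.
  set (E4 := exp (- (4 * lam * (u0 * u0)))).
  replace (u0 * E4 / lam) with (u0 * E4 / (s * s)) by (rewrite Hss; reflexivity).
  field; repeat split; lra. }
assert (Herr : err / Sc <= 38 / kappa * (lam * lam) * w).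
{ assert (E1 : err = C0 * (t * sqrt t) * exp (2 * lam) * (16 * exp (- lam) + 16 / t * exp (- (/ 200 * lam)))).
  { unfold err; replace ((2 - 1 / 200) * lam) with (2 * lam + - (/ 200 * lam)) by field.
    rewrite exp_plus; field; lra. }
  assert (E2 : err / Sc = s / kappa * (16 * exp (- lam) + 16 / t * exp (- (/ 200 * lam)))).
  { rewrite E1; unfold Sc; field; repeat split; lra. }
  rewrite E2.
  assert (H16 : 16 / t <= 16 * lam).
  { rewrite Htdef; replace (16 / (a / lam)) with (16 * lam * / a) by (field; lra).
    rewrite <- (Rmult_1_r (16 * lam)) at 2; apply Rmult_le_compat_l; [lra|].
    rewrite <- Rinv_1; apply Rinv_le_contravar; lra. }
  assert (H0t : 0 <= 16 / t) by (apply Rdiv_le_0_compat; lra).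
  assert (E3 : 16 * exp (- lam) + 16 / t * exp (- (/ 200 * lam)) <= 38 * lam * w).
  { assert (16 / t * exp (- (/ 200 * lam)) <= 16 * lam * w)
      by (apply Rmult_le_compat; try lra; left; apply exp_pos).
    nra. }
  apply Rle_trans with (s / kappa * (38 * lam * w)).
  - apply Rmult_le_compat_l; [apply Rdiv_le_0_compat; lra | exact E3].
  - replace (38 / kappa * (lam * lam) * w) with (lam * (38 * lam * w) / kappa) by (field; lra).
    replace (s / kappa * (38 * lam * w)) with (s * (38 * lam * w) / kappa) by (field; lra).
    apply Rmult_le_compat_r; [left; apply Rinv_0_lt_compat; lra|].
    apply Rmult_le_compat_r; [repeat apply Rmult_le_pos; lra | rewrite <- Hss; nra]. }
assert (Herr2 : Rabs (PI * p / Sc - main / Sc) <= err / Sc).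
{ replace (PI * p / Sc - main / Sc) with ((PI * p - main) / Sc) by (field; lra).
  unfold Rdiv; rewrite Rabs_mult, (Rabs_pos_eq (/ Sc)) by (left; apply Rinv_0_lt_compat; lra).
  apply Rmult_le_compat_r; [left; apply Rinv_0_lt_compat; lra | exact Hest]. }
replace (PI * p / Sc - h) with ((PI * p / Sc - main / Sc) + (main / Sc - h)) by ring.
eapply Rle_trans; [apply Rabs_triang|].
assert (Hm2 : Rabs (main / Sc - h) <= 2 / kappa * w).
{ rewrite Hmain; eapply Rle_trans; [apply Rabs_triang|]; rewrite Rabs_Ropp.
  assert (Hik : 0 < / kappa) by (apply Rinv_0_lt_compat; lra).
  rewrite !Rabs_pos_eq.
  - replace (2 / kappa * w) with (w / kappa + w / kappa) by (field; lra).
    apply Rplus_le_compat.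
    + apply Rmult_le_compat_r; [lra|]; nra.
    + replace (u0 * exp (- (4 * lam * (u0 * u0))) / (s * kappa))
        with (u0 * exp (- (4 * lam * (u0 * u0))) * / s / kappa) by (field; lra).
      apply Rmult_le_compat_r; [lra|].
      assert (0 < / s <= 1).
      { split; [apply Rinv_0_lt_compat; lra|]; rewrite <- Rinv_1; apply Rinv_le_contravar; lra. }
      pose proof (exp_pos (- (4 * lam * (u0 * u0)))).
      assert (0 <= u0 * exp (- (4 * lam * (u0 * u0)))) by (apply Rmult_le_pos; lra).
      nra.
  - apply Rdiv_le_0_compat; [|nra]; apply Rmult_le_pos; [lra | left; apply exp_pos].
  - apply Rdiv_le_0_compat; [apply Rmult_le_pos; lra | lra]. }
assert (Hll : 1 <= lam * lam) by nra.
assert (0 <= 2 / kappa * w) by (apply Rmult_le_pos; [apply Rdiv_le_0_compat|]; lra).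
replace (40 / kappa * (lam * lam) * w) with (38 / kappa * (lam * lam) * w + 2 / kappa * w * (lam * lam)) by (field; lra).
nra.
Qed.

(** With s = sqrt x and m = 2K + 4, x^(K+2) = s^m, and s e^{-cs/m} <= m/c because e^y >= y; it
    remains to take m-th powers. *)
Lemma exp_sqrt_decay (c : R) (K : nat) : 0 < c ->
  exists B, 0 < B /\ forall x, 1 <= x -> x * x * exp (- (c * sqrt x)) <= B / x ^ K.
Proof.
intros Hc; set (m := (2 * K + 4)%nat).
assert (Hm : 0 < INR m) by (apply lt_0_INR; unfold m; lia).
exists ((INR m / c) ^ m); split; [apply pow_lt, Rdiv_lt_0_compat; lra|].
intros x Hx; set (s := sqrt x).
assert (Hs : 0 < s) by (apply sqrt_lt_R0; lra).
assert (Hss : s * s = x) by (apply sqrt_sqrt; lra).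
assert (HxK : 0 < x ^ K) by (apply pow_lt; lra).
assert (Hpow : x * x * x ^ K = s ^ m).
{ unfold m; rewrite pow_add, pow_mult; replace (s ^ 2) with (s * s) by ring; simpl; rewrite <- Hss; ring. }
apply Rmult_le_reg_r with (x ^ K); [exact HxK|].
replace ((INR m / c) ^ m / x ^ K * x ^ K) with ((INR m / c) ^ m) by (field; lra).
replace (x * x * exp (- (c * s)) * x ^ K) with (s ^ m * exp (- (c * s))) by (rewrite <- Hpow; ring).
replace (- (c * s)) with (INR m * - (c * s / INR m)) by (field; lra).
rewrite <- pow_exp, <- Rpow_mult_distr; apply pow_incr; split.
- apply Rmult_le_pos; [lra | left; apply exp_pos].
- rewrite exp_Ropp.
  apply Rmult_le_reg_r with (exp (c * s / INR m)); [apply exp_pos|].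
  pose proof (exp_pos (c * s / INR m)).
  replace (s * / exp (c * s / INR m) * exp (c * s / INR m)) with s by (field; lra).
  pose proof (exp_ineq1_le (c * s / INR m)) as He.
  apply Rle_trans with (INR m / c * (c * s / INR m)); [right; field; lra|].
  apply Rmult_le_compat_l; [left; apply Rdiv_lt_0_compat; lra | lra].
Qed.

Lemma ln_1p_bound (d : R) : Rabs d <= 1 / 2 -> Rabs (ln (1 + d)) <= 2 * Rabs d.
Proof.
intros Hd; apply Rabs_le_between in Hd.
assert (Hln : forall x, 0 < x -> ln x <= x - 1).
{ intros x Hx; pose proof (exp_ineq1_le (ln x)); rewrite exp_ln in *; lra. }
assert (H1 := Hln (1 + d) ltac:(lra)).
assert (H2 := Hln (/ (1 + d)) ltac:(apply Rinv_0_lt_compat; lra)).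
rewrite ln_Rinv in H2 by lra.
assert (H3 : / (1 + d) - 1 = - d / (1 + d)) by (field; lra); rewrite H3 in H2.
assert (H4 : - d / (1 + d) <= 2 * Rabs d).
{ apply Rmult_le_reg_r with (1 + d); [lra|].
  replace (- d / (1 + d) * (1 + d)) with (- d) by (field; lra).
  unfold Rabs; destruct (Rcase_abs d); nra. }
pose proof (Rle_abs d); pose proof (Rabs_pos d); apply Rabs_le; lra.
Qed.

(** The constant precedes K: one expansion serves every order of precision. *)
Lemma log_partition_asymptotic : exists c2, forall K, exists B Lam, 0 < B /\ 2 <= Lam /\
  forall n lam, Lam <= lam -> INR n - 1 / 24 = 6 * (lam * lam) / (PI * PI) ->
  Rabs (ln (INR (bounded_partitions n n)) - (c2 + 2 * lam - 2 * ln lam + ln (1 - / (2 * lam))))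
  <= B / lam ^ K.
Proof.
destruct partition_asymptotic as (C2 & B & Lam & HC2 & HB & HLam & Hp).
exists (ln C2); intros K.
destruct (exp_sqrt_decay (/ 200) K ltac:(lra)) as (B1 & HB1 & Hdec1).
(* The second use, with exponent 1, brings the relative error below 1/2, where [ln_1p_bound]
   applies; it fixes the threshold. *)
destruct (exp_sqrt_decay (/ 200) 1 ltac:(lra)) as (B2 & HB2 & Hdec2).
exists (4 * B * B1), (Lam + 4 * B * B2).
assert (0 < 4 * B * B1) by (repeat apply Rmult_lt_0_compat; lra).
assert (0 < 4 * B * B2) by (repeat apply Rmult_lt_0_compat; lra).
split; [lra|]; split; [lra|]; intros n lam Hlam Hn.
specialize (Hp n lam ltac:(lra) Hn); specialize (Hdec1 lam ltac:(lra)); specialize (Hdec2 lam ltac:(lra)).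
set (p := INR (bounded_partitions n n)) in *; set (h := 1 - / (2 * lam)) in *.
set (e := lam * lam * exp (- (/ 200 * sqrt lam))) in *.
rewrite (Rmult_assoc B) in Hp; fold e in Hp.
assert (Hh : 1 / 2 <= h).
{ unfold h; assert (/ (2 * lam) <= / 2) by (apply Rinv_le_contravar; lra); lra. }
set (X := p * (lam * lam) * exp (- (2 * lam)) / C2) in *.
set (d := (X - h) / h).
assert (Hd : Rabs d <= 2 * (B * e)).
{ unfold d, Rdiv; rewrite Rabs_mult, (Rabs_pos_eq (/ h)) by (left; apply Rinv_0_lt_compat; lra).
  rewrite (Rmult_comm 2); apply Rmult_le_compat; [apply Rabs_pos | left; apply Rinv_0_lt_compat; lra | exact Hp |].
  rewrite <- (Rinv_inv 2); apply Rinv_le_contravar; lra. }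
assert (Hsmall : 2 * (B * e) <= 1 / 2).
{ simpl in Hdec2; rewrite Rmult_1_r in Hdec2.
  apply Rle_trans with (2 * B * (B2 / lam)); [rewrite <- Rmult_assoc; apply Rmult_le_compat_l; lra|].
  apply Rmult_le_reg_r with lam; [lra|].
  replace (2 * B * (B2 / lam) * lam) with (2 * B * B2) by (field; lra); lra. }
assert (HX : X = h * (1 + d)) by (unfold d; field; lra).
apply Rabs_le_between in Hd as Hd'.
assert (HX0 : 0 < X) by (rewrite HX; apply Rmult_lt_0_compat; lra).
assert (Hpe : p = C2 * X / (lam * lam) * exp (2 * lam)).
{ unfold X; rewrite exp_Ropp; pose proof (exp_pos (2 * lam)); field; repeat split; lra. }
assert (Hlnp : ln p = ln C2 + 2 * lam - 2 * ln lam + ln h + ln (1 + d)).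
{ rewrite Hpe, ln_mult; [|apply Rdiv_lt_0_compat; [apply Rmult_lt_0_compat; lra | nra] | apply exp_pos].
  rewrite ln_exp; unfold Rdiv; rewrite ln_mult; [|apply Rmult_lt_0_compat; lra | apply Rinv_0_lt_compat; nra].
  rewrite ln_Rinv, !ln_mult by nra; rewrite HX, ln_mult by lra; ring. }
rewrite Hlnp.
match goal with |- Rabs ?x <= _ => replace x with (ln (1 + d)) by ring end.
eapply Rle_trans; [apply ln_1p_bound; lra|].
apply Rle_trans with (4 * B * e); [lra|].
unfold Rdiv in *; rewrite (Rmult_assoc (4 * B)); apply Rmult_le_compat_l; lra.
Qed.

(** * Finite differences *)

Fixpoint Delta (r : nat) (f : nat -> R) (n : nat) : R :=
  match r with O => f n | S r => Delta r f (S n) - Delta r f n end.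

Lemma Delta_ext (r : nat) (f g : nat -> R) (n : nat) :
  (forall k, (n <= k)%nat -> f k = g k) -> Delta r f n = Delta r g n.
Proof.
revert n; induction r as [|r IH]; intros n H; simpl; [apply H; lia|].
rewrite !IH; [reflexivity | exact H | intros k Hk; apply H; lia].
Qed.

Lemma Delta_plus (r : nat) (f g : nat -> R) (n : nat) :
  Delta r (fun k => f k + g k) n = Delta r f n + Delta r g n.
Proof. revert n; induction r as [|r IH]; intros n; simpl; [|rewrite !IH]; ring. Qed.

Lemma Delta_scal (r : nat) (c : R) (f : nat -> R) (n : nat) :
  Delta r (fun k => c * f k) n = c * Delta r f n.
Proof. revert n; induction r as [|r IH]; intros n; simpl; [|rewrite !IH]; ring. Qed.

Lemma Delta_shift (r : nat) (f : nat -> R) (n : nat) :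
  Delta r (fun k => f (S k) - f k) n = Delta r f (S n) - Delta r f n.
Proof. revert n; induction r as [|r IH]; intros n; simpl; [|rewrite !IH]; ring. Qed.

(** [F i] is the i-th derivative. The difference of order r + 1 of F is the one of order r of F (x +
    1) - F x, whose r-th derivative is, by the mean value theorem, a value of the next derivative
    between x and x + 1. *)
Lemma Delta_mean_value (r n : nat) (F : nat -> R -> R) (lo hi : R) :
  (forall i x, (i < r)%nat -> INR n <= x -> is_derive (F i) x (F (S i) x)) ->
  (forall x, INR n <= x <= INR n + INR r -> lo <= F r x <= hi) ->
  lo <= Delta r (fun k => F O (INR k)) n <= hi.
Proof.
revert F; induction r as [|r IH]; intros F HF Hb; [apply Hb; simpl; lra|].
cbn [Delta]; rewrite <- Delta_shift.
rewrite (Delta_ext r _ (fun k => (fun i x => F i (x + 1) - F i x) O (INR k)))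
  by (intros k _; rewrite S_INR; reflexivity).
apply (IH (fun i x => F i (x + 1) - F i x)).
- intros i x Hi Hx; apply (is_derive_minus (V := RN) (fun x => F i (x + 1)) (F i));
    [|apply HF; [lia | exact Hx]].
  evar_last.
  + apply (is_derive_comp (V := RN) (F i) (fun x => x + 1)).
    * apply HF; [lia | lra].
    * auto_derive; [exact Logic.I | reflexivity].
  + apply Rmult_1_l.
- intros x Hx; rewrite S_INR in Hb.
  destruct (MVT_gen (F r) x (x + 1) (F (S r))) as (c & Hc & ->).
  + intros y Hy; rewrite Rmin_left, Rmax_right in Hy by lra; apply HF; [lia | lra].
  + intros y Hy; rewrite Rmin_left, Rmax_right in Hy by lra.
    apply continuity_pt_filterlim, (ex_derive_continuous (V := RN)).
    exists (F (S r) y); apply HF; [lia | lra].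
  + rewrite Rmin_left, Rmax_right in Hc by lra.
    replace (F (S r) c * (x + 1 - x)) with (F (S r) c) by ring; apply Hb; lra.
Qed.

(** The terms that are negligible against the main difference, which has order n^(1/2 - r). *)
Definition diff_small (r : nat) (f : nat -> R) : Prop :=
  exists C N, forall n, (N <= n)%nat -> Rabs (Delta r f n) <= C / INR n ^ r.

Lemma diff_small_plus (r : nat) (f g : nat -> R) :
  diff_small r f -> diff_small r g -> diff_small r (fun n => f n + g n).
Proof.
intros (C1 & N1 & H1) (C2 & N2 & H2); exists (C1 + C2), (N1 + N2)%nat; intros n Hn.
rewrite Delta_plus; eapply Rle_trans; [apply Rabs_triang|].
unfold Rdiv; rewrite Rmult_plus_distr_r; apply Rplus_le_compat; [apply H1 | apply H2]; lia.
Qed.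

Lemma diff_small_scal (r : nat) (c : R) (f : nat -> R) :
  diff_small r f -> diff_small r (fun n => c * f n).
Proof.
intros (C & N & H); exists (Rabs c * C), N; intros n Hn.
rewrite Delta_scal, Rabs_mult; unfold Rdiv; rewrite Rmult_assoc.
apply Rmult_le_compat_l; [apply Rabs_pos | apply H, Hn].
Qed.

Lemma diff_small_ext (r : nat) (f g : nat -> R) :
  (exists N, forall n, (N <= n)%nat -> f n = g n) -> diff_small r f -> diff_small r g.
Proof.
intros [M HM] (C & N & H); exists C, (M + N)%nat; intros n Hn.
rewrite <- (Delta_ext r f g) by (intros; apply HM; lia); apply H; lia.
Qed.

Lemma diff_small_const (r : nat) (c : R) : (1 <= r)%nat -> diff_small r (fun _ => c).
Proof.
intros Hr; destruct r as [|r]; [lia|]; exists 0, 1%nat; intros n Hn.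
assert (H : forall m, Delta (S r) (fun _ => c) m = 0).
{ induction r as [|r IH]; intros m; [simpl; ring|].
  change (Delta (S r) (fun _ => c) (S m) - Delta (S r) (fun _ => c) m = 0); rewrite !IH by lia; ring. }
rewrite H, Rabs_R0; unfold Rdiv; rewrite Rmult_0_l; lra.
Qed.

(** No smoothness is involved: each differencing at most doubles a bound valid from n on. This
    serves the remainder of the asymptotics and the Taylor remainder. *)
Lemma diff_small_bounded (r : nat) (f : nat -> R) (C : R) (N : nat) : 0 <= C ->
  (forall n, (N <= n)%nat -> Rabs (f n) <= C / INR n ^ r) -> diff_small r f.
Proof.
intros HC Hf; exists (2 ^ r * C), (S N); intros n Hn.
assert (Hn0 : 0 < INR n) by (apply lt_0_INR; lia).
assert (H : forall j m, (n <= m)%nat -> Rabs (Delta j f m) <= 2 ^ j * (C / INR n ^ r)).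
{ induction j as [|j IH]; intros m Hm; cbn [Delta].
  - rewrite Rmult_1_l; eapply Rle_trans; [apply Hf; lia|].
    unfold Rdiv; apply Rmult_le_compat_l; [exact HC|]; apply Rinv_le_contravar.
    + apply pow_lt, Hn0.
    + apply pow_incr; split; [lra | apply le_INR, Hm].
  - unfold Rminus; eapply Rle_trans; [apply Rabs_triang|]; rewrite Rabs_Ropp.
    assert (A := IH (S m) ltac:(lia)); assert (B := IH m Hm); simpl; lra. }
unfold Rdiv; rewrite Rmult_assoc; apply (H r n (Nat.le_refl n)).
Qed.

(** The falling factorial a (a - 1) ... (a - i + 1), the coefficient in the i-th derivative of
    x^a. *)
Fixpoint ffact (a : R) (i : nat) : R :=
  match i with O => 1 | S i => ffact a i * (a - INR i) end.

Lemma power_derive (a : R) (i : nat) (x : R) : 1 / 24 < x ->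
  is_derive (fun x => ffact a i * Rpower (x - 1 / 24) (a - INR i)) x
    (ffact a (S i) * Rpower (x - 1 / 24) (a - INR (S i))).
Proof.
intros Hx; rewrite S_INR; cbn [ffact].
replace (Rpower (x - 1 / 24) (a - (INR i + 1)))
  with (Rpower (x - 1 / 24) (a - INR i) * / (x - 1 / 24)).
- unfold Rpower; auto_derive; [lra | change (x + - (1 / 24)) with (x - 1 / 24); field; lra].
- replace (a - (INR i + 1)) with ((a - INR i) + - (1)) by ring.
  rewrite Rpower_plus, Rpower_Ropp, Rpower_1 by lra; reflexivity.
Qed.

Lemma shifted_range (r n : nat) (x : R) : (r + 2 <= n)%nat -> INR n <= x <= INR n + INR r ->
  2 <= INR n /\ INR n / 2 <= x - 1 / 24 <= 2 * INR n.
Proof.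
intros Hn Hx; assert (H2 : INR 2 <= INR n) by (apply le_INR; lia).
assert (Hr : INR r <= INR n) by (apply le_INR; lia); simpl in H2; lra.
Qed.

Lemma Rpower_le_pow (y a b : R) (r : nat) : 1 <= b -> b <= y -> a <= 0 ->
  0 <= Rpower y (a - INR r) <= / b ^ r.
Proof.
intros Hb Hy Ha; split; [left; apply exp_pos|].
unfold Rminus; rewrite Rpower_plus, Rpower_Ropp, Rpower_pow by lra.
assert (Hbr : 0 < b ^ r) by (apply pow_lt; lra).
assert (Hpow : b ^ r <= y ^ r) by (apply pow_incr; lra).
rewrite <- (Rmult_1_l (/ b ^ r)).
apply Rmult_le_compat; [left; apply exp_pos | left; apply Rinv_0_lt_compat; lra | | apply Rinv_le_contravar; lra].
rewrite <- (Rpower_O y) by lra; apply Rle_Rpower; lra.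
Qed.

Lemma pow_half_inv (n r : nat) : 0 < INR n -> / (INR n / 2) ^ r = 2 ^ r / INR n ^ r.
Proof.
intros Hn; unfold Rdiv; rewrite Rpow_mult_distr, pow_inv, Rinv_mult, Rinv_inv; ring.
Qed.

Lemma diff_small_power (r : nat) (a : R) : a <= 0 ->
  diff_small r (fun n => Rpower (INR n - 1 / 24) a).
Proof.
intros Ha; exists (Rabs (ffact a r) * 2 ^ r), (r + 2)%nat; intros n Hn.
set (F := fun i x => ffact a i * Rpower (x - 1 / 24) (a - INR i)).
rewrite (Delta_ext r _ (fun k => F O (INR k)))
  by (intros k _; unfold F; simpl; rewrite Rmult_1_l, Rminus_0_r; reflexivity).
apply Rabs_le, (Delta_mean_value _ n F).
- intros i x _ Hx; apply power_derive.
  assert (INR 2 <= INR n) by (apply le_INR; lia); simpl in *; lra.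
- intros x Hx; destruct (shifted_range r n x Hn Hx) as [Hn2 Hx2].
  destruct (Rpower_le_pow (x - 1 / 24) a (INR n / 2) r ltac:(lra) ltac:(lra) Ha) as [H1 H2].
  rewrite pow_half_inv in H2 by lra.
  apply Rabs_le_between; unfold F; rewrite Rabs_mult, (Rabs_pos_eq (Rpower _ _)) by exact H1.
  unfold Rdiv; rewrite Rmult_assoc; apply Rmult_le_compat_l; [apply Rabs_pos | exact H2].
Qed.

Lemma diff_small_ln (r : nat) : (1 <= r)%nat -> diff_small r (fun n => ln (INR n - 1 / 24)).
Proof.
destruct r as [|r]; [lia|]; intros _.
exists (Rabs (ffact (-1) r) * 2 ^ S r), (S r + 2)%nat; intros n Hn.
set (F := fun i x => match i with O => ln (x - 1 / 24)
  | S j => ffact (-1) j * Rpower (x - 1 / 24) (-1 - INR j) end).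
change (fun n => ln (INR n - 1 / 24)) with (fun k => F O (INR k)).
apply Rabs_le, (Delta_mean_value _ n F).
- assert (INR 2 <= INR n) by (apply le_INR; lia); simpl INR in *.
  intros [|i] x _ Hx; [|apply power_derive; lra].
  unfold F; simpl; replace (-1 - 0) with (- (1)) by ring.
  rewrite Rpower_Ropp, Rpower_1 by lra; auto_derive; [lra | field; lra].
- intros x Hx; destruct (shifted_range (S r) n x Hn Hx) as [Hn2 Hx2].
  destruct (Rpower_le_pow (x - 1 / 24) 0 (INR n / 2) (S r) ltac:(lra) ltac:(lra) ltac:(lra)) as [H1 H2].
  rewrite pow_half_inv in H2 by lra; rewrite S_INR in H1, H2.
  replace (0 - (INR r + 1)) with (-1 - INR r) in H1, H2 by ring.
  apply Rabs_le_between; unfold F; rewrite Rabs_mult, (Rabs_pos_eq (Rpower _ _)) by exact H1.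
  unfold Rdiv; rewrite Rmult_assoc; apply Rmult_le_compat_l; [apply Rabs_pos | exact H2].
Qed.

(** After the positive factor 1/2 come r negative factors 1/2 - i: the source of the alternating
    sign in the theorem. *)
Lemma ffact_half_sign (r : nat) : 0 < (-1) ^ r * ffact (1 / 2) (S r).
Proof.
induction r as [|r IH]; [simpl; lra|].
change (ffact (1 / 2) (S (S r))) with (ffact (1 / 2) (S r) * (1 / 2 - INR (S r))).
rewrite S_INR; pose proof (pos_INR r); simpl pow.
replace (-1 * (-1) ^ r * (ffact (1 / 2) (S r) * (1 / 2 - (INR r + 1))))
  with ((-1) ^ r * ffact (1 / 2) (S r) * (INR r + 1 / 2)) by field.
apply Rmult_lt_0_compat; lra.
Qed.

(** The derivative of order r + 1 is a constant times sqrt y / y^(r+1), and y stays between n/2 and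
    2n on the whole range of the difference; so sqrt y >= sqrt n / 2 and y^(r+1) <= (2n)^(r+1). *)
Lemma Delta_sqrt_lower (r : nat) : exists c, 0 < c /\ forall n, (S r + 2 <= n)%nat ->
  c * sqrt (INR n) / INR n ^ S r <= (-1) ^ r * Delta (S r) (fun k => Rpower (INR k - 1 / 24) (1 / 2)) n.
Proof.
set (A := (-1) ^ r * ffact (1 / 2) (S r)); assert (HA : 0 < A) by apply ffact_half_sign.
exists (A * (/ 2 / 2 ^ S r)); split.
{ apply Rmult_lt_0_compat; [exact HA|]; apply Rdiv_lt_0_compat; [lra | apply pow_lt; lra]. }
intros n Hn; rewrite <- Delta_scal.
set (F := fun i x => (-1) ^ r * (ffact (1 / 2) i * Rpower (x - 1 / 24) (1 / 2 - INR i))).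
rewrite (Delta_ext (S r) _ (fun k => F O (INR k)))
  by (intros k _; unfold F; simpl; rewrite Rmult_1_l, Rminus_0_r; reflexivity).
assert (Hn2 : INR 2 <= INR n) by (apply le_INR; lia); simpl INR in Hn2.
set (hi := A * (2 * INR n)).
enough (H : A * (/ 2 / 2 ^ S r) * sqrt (INR n) / INR n ^ S r <= Delta (S r) (fun k => F O (INR k)) n <= hi) by apply H.
apply (Delta_mean_value _ n F).
- intros i x _ Hx; unfold F.
  apply (is_derive_scal (fun x => ffact (1 / 2) i * Rpower (x - 1 / 24) (1 / 2 - INR i))).
  apply power_derive; lra.
- intros x Hx; destruct (shifted_range (S r) n x Hn Hx) as [_ Hx2].
  set (y := x - 1 / 24) in *.
  assert (HF : F (S r) x = A * (sqrt y / y ^ S r)).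
  { unfold F, A; fold y; unfold Rminus at 1.
    rewrite Rpower_plus, Rpower_Ropp, Rpower_pow by lra.
    replace (1 / 2) with (/ 2) at 2 by field; rewrite Rpower_sqrt by lra.
    unfold Rdiv; ring. }
  assert (Hyr : 0 < y ^ S r) by (apply pow_lt; lra).
  assert (Hnr : 0 < INR n ^ S r) by (apply pow_lt; lra).
  assert (H2r : 0 < 2 ^ S r) by (apply pow_lt; lra).
  rewrite HF; split.
  + unfold Rdiv; rewrite !(Rmult_assoc A); apply Rmult_le_compat_l; [lra|].
    match goal with |- ?l <= _ => replace l
      with (/ 2 * sqrt (INR n) * / (2 * INR n) ^ S r)
      by (rewrite Rpow_mult_distr; field; lra) end.
    apply Rmult_le_compat.
    * apply Rmult_le_pos; [lra | apply sqrt_pos].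
    * left; apply Rinv_0_lt_compat, pow_lt; lra.
    * replace (/ 2) with (sqrt (/ 2 * / 2)) by (apply sqrt_square; lra).
      rewrite <- sqrt_mult_alt by lra; apply sqrt_le_1_alt; lra.
    * apply Rinv_le_contravar; [exact Hyr | apply pow_incr; lra].
  + unfold hi; apply Rmult_le_compat_l; [lra|].
    assert (H1 : 1 <= y ^ S r) by (apply pow_R1_Rle; lra).
    assert (Hs : 0 < sqrt y) by (apply sqrt_lt_R0; lra).
    assert (Hss : sqrt y * sqrt y = y) by (apply sqrt_sqrt; lra).
    apply Rle_trans with (sqrt y); [|nra].
    rewrite <- (Rmult_1_r (sqrt y)) at 2; apply Rmult_le_compat_l; [lra|].
    rewrite <- Rinv_1; apply Rinv_le_contravar; lra.
Qed.

Fixpoint log_taylor (J : nat) (u : R) : R :=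
  match J with O => 0 | S j => log_taylor j u + u ^ S j / INR (S j) end.

(** The left side without absolute value has derivative -x^J/(1 - x), which is at most 2 u^J in
    modulus on [0, u] for u <= 1/2. *)
Lemma ln_one_minus_taylor (J : nat) (u : R) : 0 <= u <= 1 / 2 ->
  Rabs (ln (1 - u) + log_taylor J u) <= 2 * u ^ S J.
Proof.
intros Hu.
assert (HT : forall x, 0 <= x <= 1 / 2 ->
  is_derive (fun x => ln (1 - x) + log_taylor J x) x (- x ^ J / (1 - x))).
{ intros x Hx; induction J as [|J IH].
  - simpl; auto_derive; [lra | field; lra].
  - assert (HJ : INR (S J) <> 0) by (apply not_0_INR; lia).
    assert (Hpow : is_derive (fun x => x ^ S J / INR (S J)) x (x ^ J)).
    { auto_derive; [exact Logic.I|].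
      cbn [pred]; field; exact HJ. }
    replace (- x ^ S J / (1 - x)) with (- x ^ J / (1 - x) + x ^ J) by (simpl pow; field; lra).
    apply (is_derive_ext (fun x => (ln (1 - x) + log_taylor J x) + x ^ S J / INR (S J))).
    + intros y; apply Rplus_assoc.
    + apply (is_derive_plus (V := RN) (fun x => ln (1 - x) + log_taylor J x)); assumption. }
destruct (MVT_gen (fun x => ln (1 - x) + log_taylor J x) 0 u (fun x => - x ^ J / (1 - x)))
  as (c & Hc & Heq).
- intros x Hx; rewrite Rmin_left, Rmax_right in Hx by lra; apply HT; lra.
- intros x Hx; rewrite Rmin_left, Rmax_right in Hx by lra.
  apply continuity_pt_filterlim, (ex_derive_continuous (V := RN) (fun x => ln (1 - x) + log_taylor J x)).
  eexists; apply HT; lra.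
- rewrite Rmin_left, Rmax_right in Hc by lra.
  assert (H0 : ln (1 - 0) + log_taylor J 0 = 0).
  { rewrite Rminus_0_r, ln_1; clear; induction J as [|J IH]; simpl in *; [ring|].
    rewrite Rmult_0_l; unfold Rdiv; rewrite Rmult_0_l; lra. }
  rewrite H0, !Rminus_0_r in Heq; rewrite Heq.
  rewrite Rabs_mult, (Rabs_pos_eq u) by lra; simpl pow; rewrite (Rmult_comm u), <- Rmult_assoc.
  apply Rmult_le_compat_r; [lra|]; unfold Rdiv.
  assert (Hcj : 0 <= c ^ J <= u ^ J) by (split; [apply pow_le; lra | apply pow_incr; lra]).
  rewrite Rabs_mult, Rabs_Ropp, Rabs_pos_eq, Rabs_pos_eq;
    [| left; apply Rinv_0_lt_compat; lra | lra].
  rewrite (Rmult_comm 2); apply Rmult_le_compat; [lra | left; apply Rinv_0_lt_compat; lra | lra |].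
  rewrite <- (Rinv_inv 2); apply Rinv_le_contravar; lra.
Qed.

(** The term ln (1 - 1/(2 lam)) is of order n^(-1/2), too large to be estimated by size. Its Taylor
    polynomial is a combination of negative powers of n - 1/24, handled through derivatives, and
    only the remainder is estimated by size. *)
Lemma partition_log_difference_sign (r : nat) : exists N, forall n, (N <= n)%nat ->
  0 < (-1) ^ r * Delta (S r) (fun k => ln (INR (bounded_partitions k k))) n.
Proof.
destruct log_partition_asymptotic as (c2 & Hlog).
(* lam^2 is proportional to n - 1/24, so this exponent gives an error O(n^(-(r+1))), matching the
   order r + 1 of the difference. *)
destruct (Hlog (2 * S r)%nat) as (B & Lam & HB & HLam & HlogK).
pose proof PI_RGT_0 as HPI.
set (b := PI / sqrt 6).
assert (Hs6 : 0 < sqrt 6) by (apply sqrt_lt_R0; lra).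
assert (Hb : 0 < b) by (apply Rdiv_lt_0_compat; lra).
assert (Hbb : b * b = PI * PI / 6).
{ unfold b; replace 6 with (sqrt 6 * sqrt 6) at 3 by (apply sqrt_sqrt; lra); field; lra. }
clearbody b.
set (m := fun k => INR k - 1 / 24).
set (lam := fun k => b * Rpower (m k) (1 / 2)).
assert (Hm : forall k, (1 <= k)%nat -> 0 < INR k / 2 <= m k).
{ intros k Hk; apply le_INR in Hk; simpl in Hk; unfold m; lra. }
assert (Hlam2 : forall k, (1 <= k)%nat -> 0 < lam k /\ lam k * lam k = b * b * m k).
{ intros k Hk; destruct (Hm k Hk) as [Hk0 Hkm]; unfold lam.
  replace (1 / 2) with (/ 2) by field; rewrite Rpower_sqrt by lra; split.
  - apply Rmult_lt_0_compat; [exact Hb | apply sqrt_lt_R0; lra].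
  - rewrite <- (sqrt_sqrt (m k)) at 3 by lra; ring. }
assert (Hrel : forall k, (1 <= k)%nat -> INR k - 1 / 24 = 6 * (lam k * lam k) / (PI * PI)).
{ intros k Hk; rewrite (proj2 (Hlam2 k Hk)), Hbb; unfold m; field; lra. }
assert (Hbig : forall L, exists N, (1 <= N)%nat /\ forall k, (N <= k)%nat -> L <= lam k).
{ intros L; destruct (INR_unbounded (2 * (L * L) / (b * b))) as [N HN].
  exists (S N); split; [lia|]; intros k Hk.
  destruct (Hlam2 k ltac:(lia)) as [Hl0 Hll]; destruct (Hm k ltac:(lia)) as [Hk0 Hkm].
  apply Rnot_lt_le; intros Hlt.
  assert (INR N <= INR k) by (apply le_INR; lia).
  assert (Hbb0 : 0 < b * b) by (apply Rmult_lt_0_compat; lra).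
  assert (HLL : L * L < b * b * m k).
  { apply Rlt_le_trans with (b * b * (INR k / 2)); [|apply Rmult_le_compat_l; lra].
    apply Rmult_lt_reg_l with (2 / (b * b)); [apply Rdiv_lt_0_compat; lra|].
    replace (2 / (b * b) * (L * L)) with (2 * (L * L) / (b * b)) by (field; lra).
    replace (2 / (b * b) * (b * b * (INR k / 2))) with (INR k) by (field; lra). lra. }
  rewrite <- Hll in HLL; nra. }
set (u := fun k => / (2 * lam k)).
assert (Hscale : forall k, (1 <= k)%nat -> / lam k ^ (2 * S r) <= (2 / (b * b)) ^ S r / INR k ^ S r).
{ intros k Hk; destruct (Hlam2 k Hk) as [Hl0 Hll]; destruct (Hm k Hk) as [Hk0 Hkm].
  rewrite pow_mult; replace (lam k ^ 2) with (lam k * lam k) by ring; rewrite Hll.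
  unfold Rdiv; rewrite <- !pow_inv, <- Rpow_mult_distr.
  assert (0 < b * b) by (apply Rmult_lt_0_compat; lra).
  apply pow_incr; split; [left; apply Rinv_0_lt_compat, Rmult_lt_0_compat; lra|].
  replace (2 * / (b * b) * / INR k) with (/ (b * b * (INR k / 2))) by (field; lra).
  apply Rinv_le_contravar; [apply Rmult_lt_0_compat; lra | apply Rmult_le_compat_l; lra]. }
assert (HQ : 0 <= (2 / (b * b)) ^ S r).
{ apply pow_le; left; apply Rdiv_lt_0_compat; [lra | apply Rmult_lt_0_compat; lra]. }
assert (Htaylor : forall J, diff_small (S r) (fun k => log_taylor J (u k))).
{ induction J as [|J IH]; cbn [log_taylor]; [apply diff_small_const; lia|].
  apply diff_small_plus; [exact IH|].
  apply diff_small_ext with (fun k => (/ (2 * b) ^ S J / INR (S J)) * Rpower (INR k - 1 / 24) (- (INR (S J) / 2))).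
  - exists 1%nat; intros k Hk; destruct (Hm k Hk) as [Hk0 Hkm]; fold (m k).
    unfold u, lam; rewrite <- Rmult_assoc, pow_inv, (Rpow_mult_distr (2 * b)).
    rewrite <- (Rpower_pow (S J) (Rpower (m k) (1 / 2))) by apply exp_pos.
    rewrite Rpower_mult, Rpower_Ropp.
    replace (1 / 2 * INR (S J)) with (INR (S J) / 2) by field.
    rewrite Rinv_mult; unfold Rdiv; ring.
  - apply diff_small_scal, diff_small_power.
    pose proof (pos_INR (S J)); lra. }
(* Degree 2 (r + 1) - 1 leaves a remainder of order u^(2(r+1)), that is n^(-(r+1)). *)
set (E := fun k => ln (1 - u k) + log_taylor (2 * S r - 1) (u k)).
assert (HE : diff_small (S r) E).
{ destruct (Hbig 1) as (N & HN1 & HN).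
  apply (diff_small_bounded (S r) E (2 * (2 / (b * b)) ^ S r) N); [lra|].
  intros k Hk; specialize (HN k Hk); unfold E.
  assert (Hu : 0 <= u k <= 1 / 2).
  { unfold u; split; [left; apply Rinv_0_lt_compat; lra|].
    replace (1 / 2) with (/ 2) by field; apply Rinv_le_contravar; lra. }
  eapply Rle_trans; [apply ln_one_minus_taylor, Hu|].
  replace (S (2 * S r - 1)) with (2 * S r)%nat by lia.
  unfold Rdiv; rewrite Rmult_assoc; apply Rmult_le_compat_l; [lra|].
  apply Rle_trans with (/ lam k ^ (2 * S r)); [|apply Hscale; lia].
  unfold u; rewrite pow_inv; apply Rinv_le_contravar; [apply pow_lt; lra|].
  apply pow_incr; lra. }
set (R0 := fun k => ln (INR (bounded_partitions k k)) -
  (c2 + 2 * lam k - 2 * ln (lam k) + ln (1 - / (2 * lam k)))).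
assert (HR0 : diff_small (S r) R0).
{ destruct (Hbig Lam) as (N & HN1 & HN).
  apply (diff_small_bounded (S r) R0 (B * (2 / (b * b)) ^ S r) N).
  - apply Rmult_le_pos; lra.
  - intros k Hk; eapply Rle_trans; [apply HlogK; [apply HN, Hk | apply Hrel; lia]|].
    unfold Rdiv; rewrite Rmult_assoc; apply Rmult_le_compat_l; [lra|]; apply Hscale; lia. }
set (h := fun k => c2 - 2 * ln b + (-1 * ln (INR k - 1 / 24)
   + (-1 * log_taylor (2 * S r - 1) (u k) + (E k + R0 k)))).
assert (Hh : diff_small (S r) h).
{ unfold h; apply diff_small_plus; [apply diff_small_const; lia|].
  apply diff_small_plus; [apply diff_small_scal, diff_small_ln; lia|].
  apply diff_small_plus; [apply diff_small_scal, Htaylor|].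
  apply diff_small_plus; assumption. }
destruct Hh as (C & N1 & HC).
destruct (Delta_sqrt_lower r) as (c & Hc & Hsq).
(* Beyond this threshold 2 b c sqrt n exceeds C, and the main difference beats that of [h]. *)
destruct (INR_unbounded ((C / (2 * b * c)) * (C / (2 * b * c)))) as [N2 HN2].
exists (N1 + N2 + S r + 2)%nat; intros n Hn.
rewrite (Delta_ext (S r) _ (fun k => 2 * b * Rpower (INR k - 1 / 24) (1 / 2) + h k)).
- rewrite Delta_plus, Delta_scal.
  specialize (Hsq n ltac:(lia)); specialize (HC n ltac:(lia)).
  assert (Hn0 : 0 < INR n) by (apply lt_0_INR; lia).
  assert (Hnr : 0 < / INR n ^ S r) by (apply Rinv_0_lt_compat, pow_lt, Hn0).
  set (D1 := Delta (S r) (fun k => Rpower (INR k - 1 / 24) (1 / 2)) n) in *.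
  set (D2 := Delta (S r) h n) in *.
  assert (HD2 : - (C / INR n ^ S r) <= (-1) ^ r * D2).
  { assert (Habs : Rabs ((-1) ^ r * D2) <= C / INR n ^ S r)
      by (rewrite Rabs_mult, pow_1_abs, Rmult_1_l; exact HC).
    apply Rabs_le_between in Habs; lra. }
  assert (Hbc : 0 < 2 * b * c) by (repeat apply Rmult_lt_0_compat; lra).
  assert (Hsqrt : C < 2 * b * c * sqrt (INR n)).
  { assert (Hsn : 0 < sqrt (INR n)) by (apply sqrt_lt_R0, Hn0).
    assert (Hlt : C / (2 * b * c) < sqrt (INR n)).
    { apply Rnot_le_lt; intros Hle.
      assert (INR N2 <= INR n) by (apply le_INR; lia).
      assert (Hss : sqrt (INR n) * sqrt (INR n) = INR n) by (apply sqrt_sqrt; lra).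
      assert (sqrt (INR n) * sqrt (INR n) <= C / (2 * b * c) * (C / (2 * b * c)))
        by (apply Rmult_le_compat; lra).
      lra. }
    apply (Rmult_lt_compat_l (2 * b * c)) in Hlt; [|exact Hbc].
    replace (2 * b * c * (C / (2 * b * c))) with C in Hlt by (field; lra); exact Hlt. }
  assert (Hmain : 2 * b * (c * sqrt (INR n) / INR n ^ S r) <= 2 * b * ((-1) ^ r * D1))
    by (apply Rmult_le_compat_l; lra).
  assert (Hpos : 0 < (2 * b * c * sqrt (INR n) - C) * / INR n ^ S r)
    by (apply Rmult_lt_0_compat; lra).
  unfold Rdiv in *; lra.
- intros k Hk; unfold h, R0, E, u.
  destruct (Hlam2 k ltac:(lia)) as [Hl0 _]; destruct (Hm k ltac:(lia)) as [Hk0 Hkm].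
  assert (Hln : ln (lam k) = ln b + 1 / 2 * ln (m k)).
  { unfold lam; rewrite ln_mult by (exact Hb || apply exp_pos); unfold Rpower; rewrite ln_exp; reflexivity. }
  rewrite Hln; unfold lam; fold (m k); field.
Qed.

(** * Transfer to an arbitrary realType *)

(* The r-th difference of log p is log (fst / snd), so its sign compares two naturals and
   passes from Stdlib's R to any realType. *)
Fixpoint difference_ratio (p : nat -> nat) (r n : nat) : nat * nat :=
  match r with
  | O => (p n, 1%nat)
  | S r => let a := difference_ratio p r n in let b := difference_ratio p r (S n) in
           (fst b * snd a, snd b * fst a)%nat
  end.

Lemma difference_ratio_pos (p : nat -> nat) (r n : nat) : (forall k, 0 < p k)%nat ->
  (0 < fst (difference_ratio p r n) /\ 0 < snd (difference_ratio p r n))%nat.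
Proof.
intros Hp; revert n; induction r as [|r IH]; intros n; simpl; [auto|].
split; apply Nat.mul_pos_pos; apply IH.
Qed.

Lemma Delta_ln_ratio (p : nat -> nat) (r n : nat) : (forall k, 0 < p k)%nat ->
  Delta r (fun k => ln (INR (p k))) n =
  ln (INR (fst (difference_ratio p r n))) - ln (INR (snd (difference_ratio p r n))).
Proof.
intros Hp; revert n; induction r as [|r IH]; intros n; cbn [Delta difference_ratio fst snd].
- simpl INR; rewrite ln_1; ring.
- rewrite !IH, !mult_INR.
  destruct (difference_ratio_pos p r n Hp) as [H1 H2].
  destruct (difference_ratio_pos p r (S n) Hp) as [H3 H4].
  rewrite !ln_mult by (apply lt_0_INR; assumption); ring.
Qed.

Lemma bounded_partitions_diag_pos (n : nat) : (0 < bounded_partitions n n)%nat.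
Proof.
destruct n as [|n]; [simpl; lia|].
rewrite bounded_partitions_S, Nat.leb_refl, Nat.sub_diag, (bounded_partitions_stable (S n) 0) by lia.
simpl (bounded_partitions 0 0); lia.
Qed.

Lemma partition_ratio_sign (r : nat) : exists N, forall n, (N <= n)%nat ->
  let a := difference_ratio (fun k => bounded_partitions k k) (S r) n in
  if Nat.even r then (snd a < fst a)%nat else (fst a < snd a)%nat.
Proof.
destruct (partition_log_difference_sign r) as [N HN]; exists N; intros n Hn a.
specialize (HN n Hn).
rewrite (Delta_ln_ratio (fun k => bounded_partitions k k)) in HN by apply bounded_partitions_diag_pos.
fold a in HN.
destruct (difference_ratio_pos (fun k => bounded_partitions k k) (S r) n bounded_partitions_diag_pos) as [H1 H2].
fold a in H1, H2; apply lt_0_INR in H1; apply lt_0_INR in H2.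
assert (Hsign : (-1) ^ r = if Nat.even r then 1 else -1).
{ clear; induction r as [|r IH]; [reflexivity|].
  rewrite Nat.even_succ, <- Nat.negb_even; simpl pow; rewrite IH; destruct (Nat.even r); simpl; ring. }
rewrite Hsign in HN; destruct (Nat.even r); apply INR_lt, ln_lt_inv; lra.
Qed.

(* The partition number, and the sign over a realType *)
From mathcomp Require Import all_boot all_order all_algebra.
From mathcomp Require Import reals sequences exp.
Require Import Defs.

Import GRing.Theory Num.Theory.
Local Open Scope ring_scope.

(** In a nonincreasing sequence a largest part N + 1 stands at the head, and deleting it leaves a
    partition of n - (N + 1) with the same bound; hence a strong induction on n inside the induction
    on N. *)
Lemma bounded_partitions_enum (N n : nat) : exists l : seq (seq nat),
  [/\ uniq l, l =i [pred s | is_integer_partition n s && all (fun k => (k <= N)%N) s]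
    & size l = bounded_partitions N n].
Proof.
elim: N n => [|N IHN] n.
  exists (if n is 0 then [:: [::]] else [::]); split; [by case: n | | by case: n].
  move=> s; rewrite inE; case: s => [|x s] /=.
    by rewrite /is_integer_partition /=; case: n.
  rewrite leqn0; case: x => [|x] /=; last by rewrite andbF; case: n.
  by rewrite /is_integer_partition /= andbF; case: n.
have [m] := ubnP n; elim: m n => // m IHm n nm.
have [l1 [u1 m1 s1]] := IHN n.
have [l2 [u2 m2 s2]] : exists l : seq (seq nat), [/\ uniq l,
    l =i [pred s | [&& (N.+1 <= n)%N, is_integer_partition (n - N.+1) s
                     & all (fun k => (k <= N.+1)%N) s]]
  & size l = if (N.+1 <= n)%N then bounded_partitions N.+1 (n - N.+1) else 0%N].
  case: ifP => Nn; last by exists [::].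
  have [|l [ul ml sl]] := IHm (n - N.+1)%N; first by rewrite ltn_subLR // (leq_trans nm) // addSn ltnS leq_addl.
  by exists l.
exists (l1 ++ [seq N.+1 :: s | s <- l2]); split.
- rewrite cat_uniq u1 map_inj_uniq ?u2 ?andbT => [|s t [] //].
  apply/hasPn => _ /mapP[s _ ->]; rewrite m1 inE /= ltnn /= andbF //.
- move=> s; rewrite mem_cat m1 !inE; apply/orP/idP.
    case=> [/andP[-> /=]|/mapP[t]].
      by apply: sub_all => k /leqW.
    rewrite m2 inE => /and3P[Nn /and3P[st pt /eqP sumt] bt] ->.
    rewrite /= leqnn bt andbT /is_integer_partition /= pt sumt subnKC // eqxx !andbT.
    by rewrite path_sortedE ?st ?andbT //; move=> a b c ab bc; exact: leq_trans bc ab.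
  case/andP=> ps bs; case: (boolP (all (fun k => (k <= N)%N) s)) => [bs'|nb].
    by left; apply/andP.
  right; case: s ps bs nb => // x s; rewrite /is_integer_partition /=.
  case/and3P=> px /andP[x0 ps] /eqP sums /andP[xN bs] nb.
  have geqT : transitive geq by move=> a b c ab bc; exact: leq_trans bc ab.
  have xE : x = N.+1.
    apply/eqP; rewrite eqn_leq xN /= ltnNge; apply: contra nb => xN'.
    rewrite xN' /=; apply/allP => y ys; apply: leq_trans xN'.
    by move: px; rewrite path_sortedE // => /andP[/allP /(_ y ys)].
  apply/mapP; exists s; last by rewrite xE.
  rewrite m2 inE -sums xE leq_addr addKn bs andbT /is_integer_partition ps eqxx andbT.
  by rewrite andbT (path_sorted px).
- rewrite size_cat size_map s1 s2 [RHS]bounded_partitions_S plusE; congr addn.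
  by case: (Nat.leb_spec N.+1 n) => [/leP -> //|/ltP]; rewrite ltnNge => /negbTE ->.
Qed.

(** Two duplicate-free lists with the same members have the same length; the bound n on the parts
    holds for every partition of n. *)
Lemma bounded_partitions_number (n : nat) : bounded_partitions n n = partition_number n.
Proof.
have [l [ul ml <-]] := bounded_partitions_enum n n.
have [k [uk mk <-]] := partition_numberP n.
apply/perm_size/uniq_perm => // s; rewrite ml mk inE.
case: (boolP (is_integer_partition n s)); rewrite -topredE /= => sP; last exact/esym/negbTE.
rewrite sP; case/and3P: sP => _ _ /eqP <-; elim: s => //= x s IHs.
rewrite leq_addr /=; apply: sub_all IHs => y /leq_trans; apply; exact: leq_addl.
Qed.

(** The counterpart of [Delta_ln_ratio]: both logarithms of reals are applied to the same pair of
    naturals, whose comparison carries the sign across. *)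
Lemma telescope_ln_ratio (R : realType) (p : nat -> nat) (r n : nat) :
  (forall k, 0 < p k)%N ->
  iter r telescope (fun m : nat => ln ((p m)%:R : R)) n =
  ln ((difference_ratio p r n).1%:R) - ln ((difference_ratio p r n).2%:R).
Proof.
move=> p_gt0; have pos k m : (0 < (difference_ratio p k m).1)%N /\ (0 < (difference_ratio p k m).2)%N.
  by have [/ltP ? /ltP ?] := difference_ratio_pos p k m (fun i => elimT ltP (p_gt0 i)).
elim: r n => [|r IHr] n /=; first by rewrite ln1 subr0.
rewrite -[LHS]/(iter r telescope _ n.+1 - iter r telescope _ n) !IHr.
rewrite !natrM !lnM ?posrE ?ltr0n; try by case: (pos r n); case: (pos r n.+1).
by rewrite opprB opprD [LHS]addrACA.
Qed.

Theorem theorem4p1 (R : realType) (r : nat) (hr : (1 <= r)%N) :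
  exists nr : nat, (0 < nr)%N /\
    forall n : nat, (nr <= n)%N ->
      0 < (-1) ^+ (r - 1) *
          iter r telescope (fun m : nat => ln ((partition_number m)%:R : R)) n.
Proof.
case: r hr => // r _; pose p k := bounded_partitions k k.
have [N HN] := partition_ratio_sign r; exists N.+1; split => // n Nn.
have p_gt0 k : (0 < p k)%N by exact/ltP/bounded_partitions_diag_pos.
have -> : (fun m => ln ((partition_number m)%:R : R)) = (fun m => ln ((p m)%:R : R)).
  by apply/boolp.funext => m; rewrite -bounded_partitions_number.
rewrite telescope_ln_ratio // subn1 succnK.
have [] := difference_ratio_pos p r.+1 n (fun k => elimT ltP (p_gt0 k)).
have := HN n (elimT leP (ltnW Nn)); rewrite -/p.
case: (difference_ratio p r.+1 n) => a b /= ab /ltP a_gt0 /ltP b_gt0.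
have -> : (-1) ^+ r = (if Nat.even r then 1 else -1) :> R.
  elim: (r) => [//|k IHk]; rewrite exprS IHk Nat.even_succ -Nat.negb_even.
  by case: (Nat.even k); rewrite ?mulr1 ?mulrN1 ?opprK.
case: (Nat.even r) ab => /ltP ab; rewrite ?mul1r ?mulN1r ?opprB subr_gt0;
  by rewrite ltr_ln ?posrE ?ltr0n // ltr_nat.
Qed.
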